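(* Let $\Bbbk$ be an algebraically closed field of characteristic zero. For every $\lambda\in\Bbbk$, the algebra $\mathfrak U(\lambda)$ satisfies the Dixmier--Moeglin equivalence.
   Context: $\mathfrak U(\lambda)$ is the associative unital $\Bbbk$-algebra generated by $g^{\pm1},x,y$ with relations $gg^{-1}=g^{-1}g=1$, $gxg^{-1}=x$, $gyg^{-1}=y+x$, $yx-xy=-\tfrac12x^2+\lambda(1-g^2)$; it is a Noetherian domain. A Noetherian $\Bbbk$-algebra $R$ satisfies the Dixmier--Moeglin equivalence if, for every prime ideal $P$ of $R$, the following three conditions are equivalent: (i) $P$ is locally closed, i.e. the intersection of all prime ideals properly containing $P$ strictly contains $P$ (with the empty intersection taken to be $R$); (ii) $P$ is primitive, i.e. the annihilator of a simple left $R$-module; (iii) $P$ is rational, i.e. the centre of the Goldie quotient ring $\mathrm{Frac}(R/P)$ is an algebraic field extension of $\Bbbk$. *)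

(* Defs.v *)
From HB Require Import structures.
From mathcomp Require Import all_boot all_order all_algebra.
From mathcomp Require Import generic_quotient ring_quotient.
From mathcomp Require Import boolp classical_sets.
From mathcomp Require Import monalg.

Set Implicit Arguments.
Unset Strict Implicit.
Unset Printing Implicit Defensive.

Import GRing.Theory.
Local Open Scope classical_set_scope.
Local Open Scope ring_scope.
Local Open Scope quotient_scope.

Section Ideals.
Variable R : nzRingType.

Definition two_sided_ideal (I : set R) : Prop :=
  [/\ I 0, forall a b, I a -> I b -> I (a - b)
    & forall a b c, I b -> I (a * b * c)].

(* Bundled with properness because MathComp algebras are nonzero rings. *)
Structure properIdeal := ProperIdeal {
  ideal_set :> set R;
  properIdeal_ideal : two_sided_ideal ideal_set;
  properIdeal_proper : ~ ideal_set 1 }.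

Definition prime_ideal (P : set R) : Prop :=
  [/\ two_sided_ideal P, P <> setT
    & forall I J : set R, two_sided_ideal I -> two_sided_ideal J ->
        (forall a b, I a -> J b -> P (a * b)) -> I `<=` P \/ J `<=` P].

Definition locally_closed (P : set R) : Prop :=
  P `<` \bigcap_(Q in [set Q : set R | prime_ideal Q /\ P `<` Q]) Q.

Definition submodule (M : lmodType R) (N : set M) : Prop :=
  [/\ N 0, forall u v, N u -> N v -> N (u + v) & forall a u, N u -> N (a *: u)].

Definition simple_module (M : lmodType R) : Prop :=
  (exists u : M, u != 0) /\
  (forall N : set M, submodule N -> N = [set 0] \/ N = setT).

Definition annihilator (M : lmodType R) : set R :=
  [set a | forall u : M, a *: u = 0].

Definition primitive_ideal (P : set R) : Prop :=
  exists M : lmodType R, simple_module M /\ P = annihilator M.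

Definition regular_elt (c : R) : Prop :=
  forall a : R, (c * a = 0 -> a = 0) /\ (a * c = 0 -> a = 0).

Definition central_elt (z : R) : Prop := forall a : R, z * a = a * z.

End Ideals.

(* MathComp only provides ring quotients by ideals of commutative rings, so
   the algebra structure is put on its quotient group [Quotient.quot] here. *)
Section QuotientAlgebra.
Variables (K : comNzRingType) (A : algType K) (I : properIdeal A).

Definition in_ideal : {pred A} := fun a => `[< ideal_set I a >].

Lemma in_idealP a : reflect (ideal_set I a) (a \in in_ideal).
Proof. exact: asboolP. Qed.

Fact in_ideal_zmod_closed : zmod_closed in_ideal.
Proof.
have [I0 IB _] := properIdeal_ideal I.
by split=> [|a b /in_idealP Ia /in_idealP Ib]; apply/in_idealP; auto.
Qed.
HB.instance Definition _ := GRing.isZmodClosed.Build A in_ideal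
  in_ideal_zmod_closed.

Lemma in_idealMl a b : b \in in_ideal -> a * b \in in_ideal.
Proof.
have [_ _ IM] := properIdeal_ideal I.
by move=> /in_idealP Ib; apply/in_idealP; rewrite -[_ * _]mulr1; apply: IM.
Qed.

Lemma in_idealMr a b : b \in in_ideal -> b * a \in in_ideal.
Proof.
have [_ _ IM] := properIdeal_ideal I.
by move=> /in_idealP Ib; apply/in_idealP; rewrite -[b]mul1r; apply: IM.
Qed.

Definition quot_alg : Type := Quotient.quot in_ideal.
HB.instance Definition _ := GRing.Zmodule.on quot_alg.
HB.instance Definition _ : EqQuotient A (Quotient.equiv in_ideal) quot_alg :=
  EqQuotient.on quot_alg.

Definition quot_map (a : A) : quot_alg := \pi_quot_alg a.
Definition quot_one : quot_alg := quot_map 1.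
Definition quot_mul (u v : quot_alg) : quot_alg := quot_map (repr u * repr v).
Definition quot_scale (c : K) (u : quot_alg) : quot_alg :=
  quot_map (c *: repr u).

Lemma quot_mapE a b : (quot_map a == quot_map b) = (a - b \in in_ideal).
Proof. by rewrite Quotient.idealrBE. Qed.

Lemma quot_eqP a b : quot_map a = quot_map b <-> ideal_set I (a - b).
Proof.
split=> [/eqP|Iab]; first by rewrite quot_mapE => /in_idealP.
by apply/eqP; rewrite quot_mapE; apply/in_idealP.
Qed.

Lemma quot_reprK u : quot_map (repr u) = u.
Proof. exact: reprK. Qed.

Lemma in_ideal_repr a : repr (quot_map a) - a \in in_ideal.
Proof. by rewrite -quot_mapE quot_reprK. Qed.

Lemma quot_mapD a b : quot_map (a + b) = quot_map a + quot_map b.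
Proof. exact: (Quotient.pi_add in_ideal). Qed.

Lemma quot_mapN a : quot_map (- a) = - quot_map a.
Proof. exact: (Quotient.pi_opp in_ideal). Qed.

Lemma quot_mapM a b : quot_map (a * b) = quot_mul (quot_map a) (quot_map b).
Proof.
apply/eqP; rewrite eq_sym quot_mapE.
rewrite -[X in X - _](subrK (a * repr (quot_map b))) -mulrBl -addrA -mulrBr.
by apply: rpredD; [apply: in_idealMr|apply: in_idealMl]; apply: in_ideal_repr.
Qed.

Lemma quot_mapZ c a : quot_map (c *: a) = quot_scale c (quot_map a).
Proof.
apply/eqP; rewrite eq_sym quot_mapE -scalerBr -mulr_algl.
by rewrite in_idealMl // in_ideal_repr.
Qed.

Fact quot_mulA : associative quot_mul.
Proof.
move=> u v w; rewrite -[u]quot_reprK -[v]quot_reprK -[w]quot_reprK.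
by rewrite -!quot_mapM mulrA.
Qed.
Fact quot_mul1 : left_id quot_one quot_mul.
Proof. by move=> u; rewrite -[u]quot_reprK -quot_mapM mul1r. Qed.
Fact quot_mulr1 : right_id quot_one quot_mul.
Proof. by move=> u; rewrite -[u]quot_reprK -quot_mapM mulr1. Qed.
Fact quot_mulDl : left_distributive quot_mul +%R.
Proof.
move=> u v w; rewrite -[u]quot_reprK -[v]quot_reprK -[w]quot_reprK.
by rewrite -quot_mapD -!quot_mapM -quot_mapD mulrDl.
Qed.
Fact quot_mulDr : right_distributive quot_mul +%R.
Proof.
move=> u v w; rewrite -[u]quot_reprK -[v]quot_reprK -[w]quot_reprK.
by rewrite -quot_mapD -!quot_mapM -quot_mapD mulrDr.
Qed.
Lemma quot_map0 : quot_map 0 = 0.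
Proof. by rewrite -[0 in LHS](subrr 0) quot_mapD quot_mapN subrr. Qed.
Fact quot_one_neq0 : quot_one != 0.
Proof.
rewrite -quot_map0 quot_mapE subr0; apply/in_idealP.
exact: properIdeal_proper.
Qed.
HB.instance Definition _ := GRing.Zmodule_isNzRing.Build quot_alg
  quot_mulA quot_mul1 quot_mulr1 quot_mulDl quot_mulDr quot_one_neq0.

Fact quot_scaleA c d u : quot_scale c (quot_scale d u) = quot_scale (c * d) u.
Proof. by rewrite -[u]quot_reprK -!quot_mapZ scalerA. Qed.
Fact quot_scale1 : left_id 1 quot_scale.
Proof. by move=> u; rewrite -[u]quot_reprK -!quot_mapZ scale1r. Qed.
Fact quot_scaleDr : right_distributive quot_scale +%R.
Proof.
move=> c u v; rewrite -[u]quot_reprK -[v]quot_reprK.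
by rewrite -quot_mapD -!quot_mapZ -quot_mapD scalerDr.
Qed.
Fact quot_scaleDl u : {morph quot_scale^~ u : c d / c + d}.
Proof.
by move=> c d; rewrite -[u]quot_reprK -!quot_mapZ -quot_mapD scalerDl.
Qed.
HB.instance Definition _ := GRing.Zmodule_isLmodule.Build K quot_alg
  quot_scaleA quot_scale1 quot_scaleDr quot_scaleDl.

Fact quot_scaleAl (c : K) (u v : quot_alg) : c *: (u * v) = (c *: u) * v.
Proof.
rewrite -[u]quot_reprK -[v]quot_reprK.
change (quot_scale c (quot_mul (quot_map (repr u)) (quot_map (repr v))) =
        quot_mul (quot_scale c (quot_map (repr u))) (quot_map (repr v))).
by rewrite -quot_mapM -!quot_mapZ -quot_mapM scalerAl.
Qed.
HB.instance Definition _ := GRing.Lmodule_isLalgebra.Build K quot_alg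
  quot_scaleAl.

Fact quot_scaleAr (c : K) (u v : quot_alg) : c *: (u * v) = u * (c *: v).
Proof.
rewrite -[u]quot_reprK -[v]quot_reprK.
change (quot_scale c (quot_mul (quot_map (repr u)) (quot_map (repr v))) =
        quot_mul (quot_map (repr u)) (quot_scale c (quot_map (repr v)))).
by rewrite -quot_mapM -!quot_mapZ -quot_mapM scalerAr.
Qed.
HB.instance Definition _ := GRing.Lalgebra_isAlgebra.Build K quot_alg
  quot_scaleAr.

Fact quot_map_is_zmod_morphism : zmod_morphism quot_map.
Proof. by move=> a b; rewrite quot_mapD quot_mapN. Qed.
HB.instance Definition _ := GRing.isZmodMorphism.Build A quot_alg quot_map
  quot_map_is_zmod_morphism.

Fact quot_map_is_monoid_morphism : monoid_morphism quot_map.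
Proof. by split=> // a b; rewrite quot_mapM. Qed.
HB.instance Definition _ := GRing.isMonoidMorphism.Build A quot_alg quot_map
  quot_map_is_monoid_morphism.

Fact quot_map_is_scalable : scalable quot_map.
Proof. by move=> c a; rewrite quot_mapZ. Qed.
HB.instance Definition _ := GRing.isScalable.Build K A quot_alg *:%R quot_map
  quot_map_is_scalable.

End QuotientAlgebra.

Section DixmierMoeglin.
Variables (K : fieldType) (A : algType K).

(* [f] exhibits [Q] as the two-sided classical (Ore) quotient ring of [B]; this
   determines [Q] up to isomorphism, and for a prime Noetherian ring it is the
   Goldie quotient ring. *)
Definition goldie_quotient (B : algType K) (Q : unitAlgType K)
    (f : {lrmorphism B -> Q}) : Prop :=
  [/\ injective f,
      forall c : B, regular_elt c -> f c \is a GRing.unit,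
      forall q : Q, exists a c : B, regular_elt c /\ q = f a / f c
    & forall q : Q, exists a c : B, regular_elt c /\ q = (f c)^-1 * f a].

Definition centre_algebraic_field (Q : unitAlgType K) : Prop :=
  forall z : Q, central_elt z ->
    (z != 0 -> z \is a GRing.unit) /\
    (exists2 p : {poly K}, p != 0 & root (map_poly (in_alg Q) p) z).

(* The existential asserts in particular that Frac(A/P) exists. *)
Definition rational_ideal (P : properIdeal A) : Prop :=
  exists (Q : unitAlgType K) (f : {lrmorphism quot_alg P -> Q}),
    goldie_quotient f /\ centre_algebraic_field Q.

Definition dixmier_moeglin : Prop :=
  forall P : properIdeal A, prime_ideal P ->
    (locally_closed P <-> primitive_ideal P) /\
    (primitive_ideal P <-> rational_ideal P).

End DixmierMoeglin.

Section AlgebraU.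
Variables (K : fieldType) (lam : K).

(* The free algebra K<g, g^-1, x, y>: multinomials only declares monoid
   algebras of commutative monoids to be algebras. *)
Definition free4 : Type := {malg K[{fmonom 'I_4}]}.
HB.instance Definition _ := GRing.Lalgebra.on free4.

Fact free4_scaleAr (c : K) (u v : free4) : c *: (u * v) = u * (c *: v).
Proof.
have mulC (w : {malg K[{fmonom 'I_4}]}) : malgC c * w = w * malgC c.
  rewrite !malgM_def fgmulUg fgmulgU.
  by apply: eq_bigr => m _; rewrite mul1m mulm1 mulrC.
by rewrite -!mul_malgC mulrA mulC mulrA.
Qed.
HB.instance Definition _ := GRing.Lalgebra_isAlgebra.Build K free4
  free4_scaleAr.

Definition free_gen (i : 'I_4) : free4 := mkmalgU (fmu i) 1.

Definition free_g : free4 := free_gen (@Ordinal 4 0 isT).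
Definition free_gV : free4 := free_gen (@Ordinal 4 1 isT).
Definition free_x : free4 := free_gen (@Ordinal 4 2 isT).
Definition free_y : free4 := free_gen (@Ordinal 4 3 isT).

Definition U_relators (A : algType K) (g gV x y : A) : seq A :=
  [:: g * gV - 1;
      gV * g - 1;
      g * x * gV - x;
      g * y * gV - (y + x);
      y * x - x * y - (- (2^-1 : K) *: x ^+ 2 + lam *: (1 - g ^+ 2))].

Definition U_relation_set : set free4 :=
  smallest (@two_sided_ideal free4)
    [set r | r \in U_relators free_g free_gV free_x free_y].

Lemma U_relation_ideal : two_sided_ideal U_relation_set.
Proof.
split=> [J [[]]//|a b Ia Ib J JP|a b c Ib J JP].
  by have [[_ JB _] _] := JP; apply: JB; [apply: Ia|apply: Ib].
by have [[_ _ JM] _] := JP; apply: JM; apply: Ib.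
Qed.

(* The algebra is nonzero: g |-> 1, x |-> 0, y |-> 0 respects the relations. *)
Definition augmentation_monom (m : {fmonom 'I_4}) : K :=
  \prod_(i <- (m : seq 'I_4)) (i < 2)%:R.

Fact augmentation_monom_mmorphism : mmorphism augmentation_monom.
Proof.
split=> [m1 m2|]; rewrite /augmentation_monom.
  by rewrite fmM big_cat.
by rewrite fm1 big_nil.
Qed.
HB.instance Definition _ := monalg.isMultiplicative.Build _ _
  augmentation_monom augmentation_monom_mmorphism.

Fact augmentation_relators (A : algType K) (g gV x y : A)
    (e : {rmorphism A -> K}) :
  scalable_for *%R e -> e g = 1 -> e gV = 1 -> e x = 0 -> e y = 0 ->
  {in U_relators g gV x y, forall r, e r = 0}.
Proof.
move=> eZ e_g e_gV e_x e_y r; rewrite !inE => /or4P[| | |/orP[]] /eqP ->.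
- by rewrite rmorphB rmorphM rmorph1 e_g e_gV mulr1 subrr.
- by rewrite rmorphB rmorphM rmorph1 e_g e_gV mulr1 subrr.
- by rewrite rmorphB !rmorphM /= e_x mulr0 mul0r subrr.
- by rewrite rmorphB rmorphD !rmorphM /= e_x e_y mulr0 mul0r addr0 subrr.
rewrite !expr2 !rmorphB rmorphD /= !eZ rmorphB !rmorphM rmorph1 /= e_x e_y e_g.
by rewrite !(mulr0, mulr1, subrr, addr0).
Qed.

Fact rmorphism_ker_ideal (A : nzRingType) (e : {rmorphism A -> K}) :
  two_sided_ideal [set a | e a = 0].
Proof.
split=> /= [|a b ea eb|a b c eb]; first exact: rmorph0.
  by rewrite rmorphB ea eb subrr.
by rewrite !rmorphM eb mulr0 mul0r.
Qed.

Lemma U_relation_proper : ~ U_relation_set 1.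
Proof.
pose e : {rmorphism {malg K[{fmonom 'I_4}]} -> K} :=
  mmap (@idfun K) augmentation_monom.
have e_gen i : e (free_gen i) = (i < 2)%:R.
  by rewrite /= mmapU /= mul1r /augmentation_monom fmU big_seq1.
have eZ : scalable_for *%R (e : free4 -> K).
  by move=> c u; rewrite -mul_malgC rmorphM /= mmapC.
have J1 : ~ e 1 = 0 by apply/eqP; rewrite rmorph1 oner_eq0.
move=> U1; apply: J1; apply: (U1 [set a | e a = 0]).
split; first exact: rmorphism_ker_ideal.
by apply: (@augmentation_relators free4) => //; apply: e_gen.
Qed.

Definition U_ideal : properIdeal free4 :=
  ProperIdeal U_relation_ideal U_relation_proper.

Definition frakU : Type := quot_alg U_ideal.
HB.instance Definition _ := GRing.Algebra.on frakU.

End AlgebraU.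

(* Main.v *)
From HB Require Import structures.
From mathcomp Require Import all_boot all_algebra.
From mathcomp Require Import generic_quotient ring_quotient ring zify polyXY ssrAC.
From mathcomp Require Import boolp classical_sets.
From mathcomp Require Import monalg.
Require Import Defs.

Set Implicit Arguments.
Unset Strict Implicit.
Unset Printing Implicit Defensive.

Import GRing.Theory.
Local Open Scope classical_set_scope.
Local Open Scope ring_scope.
Local Open Scope quotient_scope.

(** The subalgebra generated by [g], its inverse and [x] is commutative, and [y]
    acts on it by commutators through the derivation [del] with [del g = - x g]
    and [del x = - x ^ 2 / 2 + lam (1 - g ^ 2)]: the algebra is a ring of
    differential operators over a commutative ring. The element
    [z = g ^ -1 (x ^ 2 - 2 lam (1 + g ^ 2))] is killed by [del], hence central.

    Let [B] be the quotient by a prime [P]. Each of the three conditions only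
    depends on [B]: local closedness says that some nonzero element lies in all
    nonzero primes ([locally_closed_quot]), primitivity that [B] has a faithful
    simple module ([primitive_quot]). There are three cases.

    If [x = 0] in [B], then [B] is a commutative domain generated by [g], its
    inverse and [y]. By the Nullstellensatz ([comm_point]) every nonzero element
    survives at some point, and each of the conditions amounts to [B] being the
    field of scalars.

    If [x <> 0], the image [D] of the commutative subalgebra is a domain in which
    every nonzero element has a nonzero multiple in [K[z][g]] ([dc_norm]). The
    reason is that [D] has no two nonzero differential ideals with product 0: an
    element which is algebraic over the constants has a nilpotent derivative
    ([derivation_algebraic]), and [x] cannot be nilpotent ([dc_x_nilpotent]), so
    that [g] is transcendental over [K[z]]; moreover [x ^ 2] is a quadratic
    polynomial in [g], which is a square only when [x] is itself a polynomial in
    [g]. Commuting with [g] lowers the order of operators, so [B] is a free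
    [D]-module on the powers of [y], a domain with the Ore conditions on both
    sides, and every nonzero ideal of [B] contains a nonzero element of [K[z][g]]
    ([primeU_ideal]). Such an element is nonzero at a point with coordinates
    [z = c] and [g = a], at which lives a simple module
    ([primeU_point_module]).

    If [z] is a scalar in [B], all three conditions hold. A nonzero prime contains
    a nonzero polynomial in [g], so it contains [x] ([algebraic_prime_x]); hence
    the zero ideal is locally closed, and a simple module at a point with
    [x <> 0] is faithful. A central element of the quotient ring
    satisfies a polynomial relation with [g], and [g] is not algebraic over
    central elements, so that the central element is algebraic over [K]
    ([central_frac_algebraic]).

    If [z] is transcendental in [B], all three conditions fail. The annihilators
    of the point modules are nonzero primes with intersection 0, and [z] lies in
    the centre of any quotient ring. On a faithful simple module [M] all [z - c]
    would be bijective. If [M] were torsion-free over [D], dividing with remainder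
    by an operator of least order killing a vector [m] would make a single
    element of [D] divisible, up to powers, by all [z - c] ([torsion_exists]). So
    some vector is killed by a polynomial in [g] over [K[z]]; this polynomial, or
    [x], acts on the submodule it generates as [X] does on [K[d/dX]]
    ([lowering_exists]), which brings the division of a vector by [z - c] back
    to the commutative ring [D], where it fails for almost all [c]
    ([minimal_absurd]). *)

(** * Simple modules *)

Record submod_of (R : nzRingType) (M : lmodType R) := SubmodOf {
  submod_set :> set M;
  submod_ofP : submodule submod_set }.

Section QuotientModule.
Variables (R : nzRingType) (M : lmodType R) (N : submod_of M).

Definition in_submod : {pred M} := fun u => `[< submod_set N u >].

Lemma in_submodP u : reflect (submod_set N u) (u \in in_submod).
Proof. exact: asboolP. Qed.

Fact in_submod_zmod_closed : zmod_closed in_submod.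
Proof.
have [N0 ND NZ] := submod_ofP N.
split=> [|u v /in_submodP Nu /in_submodP Nv]; apply/in_submodP => //.
by apply: ND => //; rewrite -scaleN1r; apply: NZ.
Qed.
HB.instance Definition _ := GRing.isZmodClosed.Build M in_submod
  in_submod_zmod_closed.

Definition quot_mod : Type := Quotient.quot in_submod.
HB.instance Definition _ := GRing.Zmodule.on quot_mod.
HB.instance Definition _ : EqQuotient M (Quotient.equiv in_submod) quot_mod :=
  EqQuotient.on quot_mod.

Definition mod_map (u : M) : quot_mod := \pi_quot_mod u.
Definition qmod_scale (a : R) (u : quot_mod) : quot_mod :=
  mod_map (a *: repr u).

Lemma mod_mapE u v : mod_map u = mod_map v <-> submod_set N (u - v).
Proof.
split=> [/eqP|Nuv]; first by rewrite -Quotient.idealrBE => /in_submodP.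
by apply/eqP; rewrite -Quotient.idealrBE; apply/in_submodP.
Qed.

Lemma mod_reprK u : mod_map (repr u) = u.
Proof. exact: reprK. Qed.

Lemma mod_mapD u v : mod_map (u + v) = mod_map u + mod_map v.
Proof. exact: (Quotient.pi_add in_submod). Qed.

Lemma mod_mapZ a u : mod_map (a *: u) = qmod_scale a (mod_map u).
Proof.
have [_ _ NZ] := submod_ofP N.
apply/mod_mapE; rewrite -scalerBr; apply: NZ.
by apply/mod_mapE; rewrite mod_reprK.
Qed.

Fact qmod_scaleA a b u :
  qmod_scale a (qmod_scale b u) = qmod_scale (a * b) u.
Proof. by rewrite -[u]mod_reprK -!mod_mapZ scalerA. Qed.
Fact qmod_scale1 : left_id 1 qmod_scale.
Proof. by move=> u; rewrite -[u]mod_reprK -!mod_mapZ scale1r. Qed.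
Fact qmod_scaleDr : right_distributive qmod_scale +%R.
Proof.
move=> c u v; rewrite -[u]mod_reprK -[v]mod_reprK.
by rewrite -mod_mapD -!mod_mapZ -mod_mapD scalerDr.
Qed.
Fact qmod_scaleDl u : {morph qmod_scale^~ u : c d / c + d}.
Proof.
by move=> c d; rewrite -[u]mod_reprK -!mod_mapZ -mod_mapD scalerDl.
Qed.
HB.instance Definition _ := GRing.Zmodule_isLmodule.Build R quot_mod
  qmod_scaleA qmod_scale1 qmod_scaleDr qmod_scaleDl.

Lemma mod_map_scale a u : mod_map (a *: u) = a *: mod_map u.
Proof. exact: mod_mapZ. Qed.

Lemma mod_map_eq0 u : mod_map u = 0 <-> submod_set N u.
Proof.
have E0 : mod_map 0 = 0.
  by apply: (addrI (mod_map 0)); rewrite -mod_mapD !addr0.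
by rewrite -E0; split=> [/mod_mapE|Nu]; [|apply/mod_mapE]; rewrite subr0.
Qed.

End QuotientModule.

Section SimpleModules.
Variable R : nzRingType.

(** By Zorn's lemma [J] lies in a maximal left ideal; the quotient of [R] by it
    is simple and [J] kills the class of 1. *)
Lemma simple_module_killed (J : set R^o) :
  submodule J -> ~ J 1 ->
  exists (M : lmodType R) (m : M),
    [/\ simple_module M, m <> 0 & forall a, J a -> a *: m = 0].
Proof.
move=> sJ J1.
pose proper X := [/\ submodule (X : set R^o), J `<=` X & ~ X 1].
(* The empty set is thrown in so that the empty chain has its union in the
   family. *)
have [F Fc FP|L [LP Lmax]] :=
  @Zorn_bigcup R^o [set X | X = set0 \/ proper X].
- have [[X FX X0]|F0] := pselect (exists2 X, F X & X <> set0); last first.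
    left; rewrite -subset0 => u [X FX Xu].
    by apply: F0; exists X => // X0; rewrite X0 in Xu.
  have FpX Y u : F Y -> Y u -> proper Y.
    by move=> /Fc[Y0|//] Yu; rewrite Y0 in Yu.
  right; have [u Xu] : exists u, X u.
    by apply: contrapT => nX; apply: X0; rewrite -subset0 => u Xu; apply: nX; exists u.
  have [[X_0 XD XZ] JX X1] := FpX _ _ FX Xu.
  split; last 1 first.
  - by case=> Y FY Y1; have [_ _] := FpX _ _ FY Y1; apply.
  - split; first by exists X.
      move=> a b [Y FY Ya] [Z FZ Zb].
      have [[_ YD _] _ _] := FpX _ _ FY Ya.
      have [[_ ZD _] _ _] := FpX _ _ FZ Zb.
      by have [YZ|ZY] := FP _ _ FY FZ;
        [exists Z => //; apply: ZD => //; apply: YZ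
        |exists Y => //; apply: YD => //; apply: ZY].
    move=> c a [Y FY Ya]; exists Y => //.
    by have [[_ _ YZ] _ _] := FpX _ _ FY Ya; apply: YZ.
  - by move=> a Ja; exists X => //; apply: JX.
have [L0|[sL JL L1]] := LP.
  case: (Lmax J _); last by right; split.
  by rewrite L0; split=> // JJ0; have [/JJ0] := sJ.
pose N := SubmodOf sL.
have sN := sL; case: sN => L_0 LD LZ.
exists (quot_mod N), (mod_map N (1 : R^o)); split.
- split; first by exists (mod_map N (1 : R^o)); apply/eqP=> /mod_map_eq0.
  move=> W [W0 WD WZ].
  pose X : set R^o := [set a | W (mod_map N a)].
  have LX : L `<=` X.
    by move=> a La; rewrite /X /=; have -> : mod_map N a = 0 by apply/mod_map_eq0.
  have sX : submodule X.
    split=> [|a b|c a] //=; first exact: LX.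
      by move=> Wa Wb; move: (WD _ _ Wa Wb); rewrite -(mod_mapD N).
    by move=> Wa; move: (WZ c _ Wa); rewrite -(mod_map_scale N).
  have [X1|X1] := pselect (X 1).
    right; rewrite -subTset => u _; rewrite -[u]mod_reprK.
    have := WZ (repr u : R^o) _ X1; rewrite -mod_map_scale.
    by rewrite /GRing.scale /= mulr1.
  left; apply/seteqP; split=> [u Wu|u ->//] /=.
  rewrite -[u]mod_reprK; apply/mod_map_eq0.
  apply: contrapT => nL; apply: (Lmax X); last first.
    by right; split => // a /JL/LX.
  by split=> // XL; apply: nL; apply: XL; rewrite /X /= mod_reprK.
- by move=> /mod_map_eq0.
move=> a Ja; rewrite -(mod_map_scale N a (1 : R^o)); apply/mod_map_eq0.
by rewrite /GRing.scale /= mulr1; apply: JL.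
Qed.

Lemma simple_cyclic (M : lmodType R) (m v : M) :
  simple_module M -> m <> 0 -> exists a, v = a *: m.
Proof.
move=> [_ sM] m0.
have [||E] := sM [set u | exists a, u = a *: m].
- split=> [|u w [a ->] [b ->]|c u [a ->]].
  + by exists 0; rewrite scale0r.
  + by exists (a + b); rewrite scalerDl.
  + by exists (c * a); rewrite scalerA.
- move=> /seteqP[/(_ m) s0 _]; case: m0; apply: s0.
  by exists 1; rewrite scale1r.
by have : setT v by []; rewrite -E.
Qed.

Lemma annihilator_ideal (M : lmodType R) : two_sided_ideal (annihilator M).
Proof.
split=> [u|a b Ia Ib u|a b c Ib u]; rewrite ?scale0r //.
  by rewrite scalerBl Ia Ib subrr.
by rewrite -!scalerA Ib scaler0.
Qed.

(** If [b v <> 0] then [b v] generates the simple module, so that an ideal killing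
    it kills everything. *)
Lemma annihilator_prime (M : lmodType R) :
  simple_module M -> prime_ideal (annihilator M).
Proof.
move=> sM; have [[m m0] _] := sM.
split; first exact: annihilator_ideal.
  move=> AT; have /(_ m) : annihilator M 1 by rewrite AT.
  by rewrite scale1r => m00; rewrite m00 eqxx in m0.
move=> I J iI iJ IJ; apply: contrapT => /not_orP[].
move=> /existsNP[a /not_implyP[Ia nA]] /existsNP[b /not_implyP[Jb nB]].
have /existsNP[u /eqP au] := nA; have /existsNP[v /eqP bv] := nB.
have [c uE] : exists c, u = c *: (b *: v) by apply: simple_cyclic => //; apply/eqP.
case/eqP: au; rewrite uE !scalerA; apply: IJ => //.
by rewrite -[c * b]mulr1; have [_ _] := iJ; apply.
Qed.

End SimpleModules.

(** * Prime ideals and quotient algebras *)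

Section PrimeIdeals.
Variable R : nzRingType.

Lemma ideal_proper (I : set R) : two_sided_ideal I -> I <> setT -> ~ I 1.
Proof.
move=> [_ _ IM] IT I1; apply: IT; rewrite -subTset => a _.
by rewrite -[a]mulr1 -[a * 1]mulr1; apply: IM.
Qed.

Lemma ideal_opp (I : set R) a : two_sided_ideal I -> I a -> I (- a).
Proof. by move=> [I0 IB _] Ia; rewrite -sub0r; apply: IB. Qed.

Lemma ideal_add (I : set R) a b : two_sided_ideal I -> I a -> I b -> I (a + b).
Proof.
move=> iI Ia Ib; rewrite -[b]opprK; have [_ IB _] := iI.
by apply: IB => //; apply: ideal_opp.
Qed.

Lemma ideal_mull (I : set R) a b : two_sided_ideal I -> I b -> I (a * b).
Proof. by move=> [_ _ IM] Ib; rewrite -[a * b]mulr1; apply: IM. Qed.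

Lemma ideal_mulr (I : set R) a b : two_sided_ideal I -> I a -> I (a * b).
Proof. by move=> [_ _ IM] Ia; rewrite -[a]mul1r; apply: IM. Qed.

(** The [u] with all [u r b] in [P] form an ideal, and so do the [v] with all
    [u r v] in [P] for these [u]; the product of the two ideals lies in [P]. *)
Lemma prime_idealP (P : set R) :
  prime_ideal P <->
  [/\ two_sided_ideal P, ~ P 1 &
      forall a b, (forall r, P (a * r * b)) -> P a \/ P b].
Proof.
split=> [[iP PT pP]|[iP P1 pP]].
  have [P0 PB PM] := iP.
  split=> //; first exact: ideal_proper.
  move=> a b Pab.
  pose I : set R := [set u | forall r, P (u * r * b)].
  pose J : set R := [set v | forall u, I u -> forall r, P (u * r * v)].
  have iI : two_sided_ideal I.
    split=> [r|u v Iu Iv r|c u d Iu r] /=; first by rewrite !mul0r.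
      by rewrite !mulrBl; apply: PB; [apply: Iu|apply: Iv].
    by rewrite -!mulrA; apply: ideal_mull => //; rewrite !mulrA -(mulrA u).
  have iJ : two_sided_ideal J.
    split=> [u _ r|u v Ju Jv w Iw r|c u d Ju w Iw r] /=; first by rewrite mulr0.
      by rewrite mulrBr; apply: PB; [apply: Ju|apply: Jv].
    by rewrite !mulrA; apply: ideal_mulr => //; rewrite -(mulrA w); apply: Ju.
  have [|IP|JP] := pP I J iI iJ; last 2 first.
  - by left; apply: IP.
  - by right; apply: JP => u Iu.
  by move=> u v Iu /(_ u Iu 1); rewrite mulr1.
split=> // [PT|I J iI iJ IJ]; first by apply: P1; rewrite PT.
apply: contrapT => /not_orP[].
move=> /existsNP[a /not_implyP[Ia nA]] /existsNP[b /not_implyP[Jb nB]].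
have [r|//|//] := pP a b; apply: IJ => //.
exact: ideal_mulr.
Qed.

(** Local closedness of the zero ideal of a prime ring: the intersection of the
    nonzero primes is not 0. *)
Definition loc_closed0 : Prop :=
  exists2 b : R, b <> 0 &
    forall Q : set R, prime_ideal Q -> (exists2 q, Q q & q <> 0) -> Q b.

Definition faithful_simple : Prop :=
  exists M : lmodType R,
    simple_module M /\ forall b, annihilator M b -> b = 0.

Definition prime_ring : Prop :=
  forall a b : R, (forall r, a * r * b = 0) -> a = 0 \/ b = 0.

End PrimeIdeals.

(** Restriction of scalars along [f], as a separate type so that it can carry the
    new module structure. *)
Definition inflate (R S : nzRingType) (f : {rmorphism R -> S})
  (M : lmodType S) : Type := M.

Section Inflation.
Variables (R S : nzRingType) (f : {rmorphism R -> S}) (M : lmodType S).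
HB.instance Definition _ := GRing.Zmodule.on (inflate f M).
Definition inflate_scale (a : R) (u : inflate f M) : inflate f M :=
  f a *: (u : M).
Fact inflate_scaleA a b u :
  inflate_scale a (inflate_scale b u) = inflate_scale (a * b) u.
Proof. by rewrite /inflate_scale scalerA rmorphM. Qed.
Fact inflate_scale1 : left_id 1 inflate_scale.
Proof. by move=> u; rewrite /inflate_scale rmorph1 scale1r. Qed.
Fact inflate_scaleDr : right_distributive inflate_scale +%R.
Proof. by move=> c u v; rewrite /inflate_scale scalerDr. Qed.
Fact inflate_scaleDl u : {morph inflate_scale^~ u : c d / c + d}.
Proof. by move=> c d; rewrite /inflate_scale rmorphD scalerDl. Qed.
HB.instance Definition _ := GRing.Zmodule_isLmodule.Build R (inflate f M)
  inflate_scaleA inflate_scale1 inflate_scaleDr inflate_scaleDl.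

Lemma inflateE a (u : inflate f M) : a *: u = f a *: (u : M).
Proof. by []. Qed.
End Inflation.

Section QuotientTransfer.
Variables (K : comNzRingType) (A : algType K) (P : properIdeal A).
Local Notation B := (quot_alg P).
Local Notation pi := (quot_map P).

Lemma quot_map_eq0 a : pi a = 0 <-> ideal_set P a.
Proof. by rewrite -(rmorph0 pi) quot_eqP subr0. Qed.

Lemma quot_prime : prime_ideal P -> prime_ring B.
Proof.
move=> /prime_idealP[_ _ pP] a b ab0.
rewrite -[a](quot_reprK) -[b](quot_reprK).
have [r|Pa|Pb] := pP (repr a) (repr b).
- by apply/quot_map_eq0; rewrite !rmorphM /= !quot_reprK.
- by left; apply/quot_map_eq0.
- by right; apply/quot_map_eq0.
Qed.

Lemma quot_preim_prime (Q : set B) :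
  prime_ideal Q -> prime_ideal [set a | Q (pi a)].
Proof.
move=> /prime_idealP[[Q0 QB QM] Q1 pQ]; apply/prime_idealP; split=> /=.
- split=> [|a b Qa Qb|a b c Qb] /=; first by rewrite rmorph0.
    by rewrite rmorphB; apply: QB.
  by rewrite !rmorphM; apply: QM.
- by rewrite rmorph1.
move=> a b Qab; apply: pQ => r; rewrite -[r]quot_reprK.
by have := Qab (repr r); rewrite !rmorphM.
Qed.

Lemma quot_im_prime (Q : set A) : ideal_set P `<=` Q ->
  prime_ideal Q -> prime_ideal [set b : B | Q (repr b)].
Proof.
move=> PQ /prime_idealP[iQ Q1 pQ].
have QE b a : pi a = b -> Q a <-> Q (repr b).
  rewrite -{1}[b]quot_reprK => /quot_eqP/PQ Qab.
  split=> [Qa|Qb].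
    rewrite -[repr b](subKr a); have [_ QB _] := iQ; exact: QB.
  by rewrite -[a](subrK (repr b)); apply: ideal_add.
apply/prime_idealP; split.
- have [Q0 QB QM] := iQ; split=> [|a b Qa Qb|a b c Qb] /=.
  + by apply/(QE 0 0) => //; rewrite rmorph0.
  + apply/(QE _ (repr a - repr b)); last exact: QB.
    by rewrite rmorphB /= !quot_reprK.
  + apply/(QE _ (repr a * repr b * repr c)); last exact: QM.
    by rewrite !rmorphM /= !quot_reprK.
- by move=> /= Q1'; apply: Q1; apply/(QE 1 1) => //; rewrite rmorph1.
move=> a b Qab /=; apply: pQ => r.
apply/(QE (a * pi r * b)); last exact: Qab.
by rewrite !rmorphM /= !quot_reprK.
Qed.

Lemma locally_closed_quot : locally_closed P <-> loc_closed0 B.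
Proof.
split=> [[PQ /existsNP[a /not_implyP[aQ Pa]]]|[b b0 bQ]].
  exists (pi a); first by move/quot_map_eq0.
  move=> Q pQ [q Qq q0].
  apply: (aQ [set a | Q (pi a)]); split; first exact: quot_preim_prime.
  have [iQ _ _] := (prime_idealP Q).1 pQ.
  split=> [c Pc|QP] /=; first by rewrite (quot_map_eq0 c).2 //; have [] := iQ.
  by apply: q0; rewrite -[q]quot_reprK; apply/quot_map_eq0/QP; rewrite /= quot_reprK.
split=> [a Pa Q [pQ [PQ _]]|PQ]; first exact: PQ.
apply: b0; rewrite -[b]quot_reprK; apply/quot_map_eq0/PQ => Q [pQ [PQ' QP]].
apply: (bQ _ (quot_im_prime PQ' pQ)).
have [q /not_implyP[Qq Pq]] := (existsNP _).2 QP.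
have [iQ _ _] := (prime_idealP Q).1 pQ.
exists (pi q); last by move/quot_map_eq0.
have /PQ' Qd := (quot_eqP P (repr (pi q)) q).1 (quot_reprK _).
by rewrite /= -[repr _](subrK q); apply: ideal_add.
Qed.

(** A module killed by [P] is a module over the quotient. *)
Definition deflate (M : lmodType A) : Type := M.

Section Deflation.
Variable M : lmodType A.
Hypothesis annM : P `<=` annihilator M.

HB.instance Definition _ := GRing.Zmodule.on (deflate M).
Definition deflate_scale (b : B) (u : deflate M) : deflate M :=
  repr b *: (u : M).
Lemma deflate_scaleE a u : deflate_scale (pi a) u = a *: (u : M).
Proof.
apply/eqP; rewrite -subr_eq0 -scalerBl; apply/eqP.
by apply: annM; apply/quot_eqP; rewrite quot_reprK.
Qed.
Fact deflate_scaleA a b u :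
  deflate_scale a (deflate_scale b u) = deflate_scale (a * b) u.
Proof.
rewrite -[a]quot_reprK -[b]quot_reprK -rmorphM !deflate_scaleE.
by rewrite -[RHS]scalerA.
Qed.
Fact deflate_scale1 : left_id 1 deflate_scale.
Proof. by move=> u; rewrite -(rmorph1 pi) deflate_scaleE scale1r. Qed.
Fact deflate_scaleDr : right_distributive deflate_scale +%R.
Proof. by move=> c u v; rewrite /deflate_scale scalerDr. Qed.
Fact deflate_scaleDl u : {morph deflate_scale^~ u : c d / c + d}.
Proof.
move=> c d; rewrite -[c]quot_reprK -[d]quot_reprK -rmorphD !deflate_scaleE.
by rewrite -[LHS]/((_ + _) *: (u : M)) scalerDl.
Qed.
Definition deflate_mixin := GRing.Zmodule_isLmodule.Build B (deflate M)
  deflate_scaleA deflate_scale1 deflate_scaleDr deflate_scaleDl.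
End Deflation.

Lemma primitive_quot : primitive_ideal P <-> faithful_simple B.
Proof.
split=> [[M [sM PM]]|[M [sM fM]]].
  have annM : P `<=` annihilator M by rewrite -PM.
  pose M' : lmodType B := HB.pack_for (lmodType B) (deflate M) (deflate_mixin annM).
  exists M'; split.
    have [M0 sN] := sM; split; first exact: M0.
    move=> N [N0 ND NZ]; apply: (sN N); split=> // a u Nu.
    by have := NZ (pi a) u Nu; rewrite /GRing.scale /= deflate_scaleE.
  move=> b Mb; rewrite -[b]quot_reprK; apply/quot_map_eq0; rewrite PM => u.
  exact: (Mb u).
exists (inflate pi M); split.
  have [M0 sN] := sM; split; first exact: M0.
  move=> N [N0 ND NZ]; apply: (sN N); split=> // b u Nu.
  by have := NZ (repr b) u Nu; rewrite inflateE /= quot_reprK.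
apply/seteqP; split=> [a Pa u|a aM].
  by rewrite inflateE /= (quot_map_eq0 a).2 // scale0r.
by apply/quot_map_eq0; apply: fM => u; apply: aM.
Qed.

End QuotientTransfer.

(** * Ore localization of a domain *)

Definition domain (B : nzRingType) := forall a b : B, a * b = 0 -> a = 0 \/ b = 0.
Definition right_ore (B : nzRingType) :=
  forall a s : B, s <> 0 -> exists b t : B, t <> 0 /\ a * t = s * b.
Definition left_ore (B : nzRingType) :=
  forall a s : B, s <> 0 -> exists b t : B, t <> 0 /\ t * a = b * s.

Record oreDomain (K : comNzRingType) := OreDomain {
  ore_sort :> algType K;
  ore_domain : domain ore_sort;
  ore_right : right_ore ore_sort }.

Section OreLocalization.
Variables (K : comNzRingType) (B : oreDomain K).

Lemma ore_mulI (a b c : B) : a <> 0 -> a * b = a * c -> b = c.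
Proof.
move=> a0 /eqP; rewrite -subr_eq0 -mulrBr => /eqP/ore_domain[//|/eqP].
by rewrite subr_eq0 => /eqP.
Qed.

Lemma ore_mulIr (a b c : B) : a <> 0 -> b * a = c * a -> b = c.
Proof.
move=> a0 /eqP; rewrite -subr_eq0 -mulrBl => /eqP/ore_domain[/eqP|//].
by rewrite subr_eq0 => /eqP.
Qed.

Lemma ore_mul_neq0 (a b : B) : a <> 0 -> b <> 0 -> a * b <> 0.
Proof. by move=> a0 b0 /ore_domain[]. Qed.

Definition ore_pair := {p : B * B | p.2 != 0}.
HB.instance Definition _ := Choice.on ore_pair.

Definition ore_num (p : ore_pair) : B := (val p).1.
Definition ore_den (p : ore_pair) : B := (val p).2.

Lemma ore_den_neq0 p : ore_den p <> 0.
Proof. by apply/eqP; exact: (valP p). Qed.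

(** By the Ore condition, agreement on one nonzero common multiple of the
    denominators is enough ([ore_eqv1]). *)
Definition ore_eqv (p q : ore_pair) : bool :=
  `[< forall u v, ore_den p * u = ore_den q * v ->
        ore_num p * u = ore_num q * v >].

Lemma ore_common (s t : B) : s <> 0 -> t <> 0 ->
  exists u v, [/\ u <> 0, v <> 0 & s * u = t * v].
Proof.
move=> s0 t0; have [v [u [u0 E]]] := ore_right s t0.
exists u, v; split=> // v0; move: E; rewrite v0 mulr0.
exact: ore_mul_neq0.
Qed.

Lemma ore_eqv1 p q u v : u <> 0 -> ore_den p * u = ore_den q * v ->
  ore_num p * u = ore_num q * v -> ore_eqv p q.
Proof.
move=> u0 Ed En; apply/asboolP => u' v' Ed'.
have [b [t [t0 Eb]]] := ore_right u' u0.
apply: (ore_mulIr t0); rewrite -mulrA Eb mulrA En -!mulrA; congr (_ * _).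
by apply: (ore_mulI (@ore_den_neq0 q)); rewrite !mulrA -Ed -Ed' -!mulrA Eb.
Qed.

Fact ore_eqv_refl : reflexive ore_eqv.
Proof.
by move=> p; apply/asboolP => u v /(ore_mulI (@ore_den_neq0 p)) ->.
Qed.

Fact ore_eqv_sym : symmetric ore_eqv.
Proof.
move=> p q; apply/asboolP/asboolP => E u v Ed.
  by rewrite (E v u).
by rewrite (E v u).
Qed.

Fact ore_eqv_trans : transitive ore_eqv.
Proof.
move=> q p r /asboolP Epq /asboolP Eqr.
have [u [v [u0 v0 E]]] := ore_common (@ore_den_neq0 p) (@ore_den_neq0 q).
have [w [t [t0 E']]] := ore_right (ore_den q * v) (@ore_den_neq0 r).
apply: (@ore_eqv1 _ _ (u * t) w); first exact: ore_mul_neq0.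
  by rewrite mulrA E.
by rewrite mulrA (Epq _ _ E) -mulrA; apply: Eqr; rewrite mulrA.
Qed.

Canonical ore_equiv := EquivRel ore_eqv ore_eqv_refl ore_eqv_sym ore_eqv_trans.

Definition ore_frac : Type := {eq_quot ore_equiv}.
HB.instance Definition _ : EqQuotient ore_pair ore_equiv ore_frac :=
  EqQuotient.on ore_frac.
HB.instance Definition _ := Choice.on ore_frac.

Fact ore_one_neq0 : (1 : B) != 0. Proof. exact: oner_neq0. Qed.

(** The fraction [a s^-1]; a null denominator is read as 1. *)
Definition frac (a s : B) : ore_frac :=
  \pi_ore_frac (insubd (exist (fun p : B * B => p.2 != 0) (a, 1) ore_one_neq0)
                       (a, s)).

Lemma fracP q : exists a s, s <> 0 /\ q = frac a s.
Proof.
exists (ore_num (repr q)), (ore_den (repr q)); split; first exact: ore_den_neq0.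
rewrite -[LHS]reprK /frac; congr (\pi _); apply: val_inj.
rewrite val_insubd; move: (repr q) => [[a s] /= s0].
by rewrite /ore_num /ore_den /= s0.
Qed.

Lemma frac_insubd a s : s <> 0 ->
  val (insubd (exist (fun p : B * B => p.2 != 0) (a, 1) ore_one_neq0) (a, s))
    = (a, s).
Proof. by move=> /eqP s0; rewrite val_insubd /= s0. Qed.

Lemma fracE a s b t : s <> 0 -> t <> 0 ->
  frac a s = frac b t <-> forall u v, s * u = t * v -> a * u = b * v.
Proof.
move=> s0 t0; rewrite /frac; split=> [/eqmodP/asboolP|E].
  by rewrite /ore_num /ore_den !frac_insubd.
by apply/eqmodP/asboolP; rewrite /ore_num /ore_den !frac_insubd.
Qed.

Lemma frac_eq a s b t u v : s <> 0 -> t <> 0 -> u <> 0 ->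
  s * u = t * v -> a * u = b * v -> frac a s = frac b t.
Proof.
move=> s0 t0 u0 Ed En; rewrite /frac; apply/eqmodP.
by apply: (@ore_eqv1 _ _ u v); rewrite // /ore_num /ore_den !frac_insubd.
Qed.

Lemma frac_amp a s u : s <> 0 -> u <> 0 -> frac (a * u) (s * u) = frac a s.
Proof.
move=> s0 u0; apply: (@frac_eq _ _ _ _ 1 u) => //.
- exact: ore_mul_neq0.
- exact/eqP/oner_neq0.
- by rewrite mulr1.
- by rewrite mulr1.
Qed.

Lemma frac_common p q : exists a b s, [/\ s <> 0, p = frac a s & q = frac b s].
Proof.
have [a [s [s0 ->]]] := fracP p; have [b [t [t0 ->]]] := fracP q.
have [u [v [u0 v0 E]]] := ore_common s0 t0.
exists (a * u), (b * v), (s * u); split; first exact: ore_mul_neq0.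
  by rewrite frac_amp.
by rewrite E frac_amp.
Qed.

(** In this position the product is [a b t^-1]. *)
Lemma frac_chain p q : exists a s b t,
  [/\ s <> 0, t <> 0, p = frac a s & q = frac (s * b) t].
Proof.
have [a [s [s0 ->]]] := fracP p; have [b [t [t0 ->]]] := fracP q.
have [c [u [u0 E]]] := ore_right b s0.
exists a, s, c, (t * u); split=> //; first exact: ore_mul_neq0.
by rewrite -E frac_amp.
Qed.

Lemma frac_common_triple p q : exists x : B * B * B,
  [/\ x.2 <> 0, p = frac x.1.1 x.2 & q = frac x.1.2 x.2].
Proof. by have [a [b [s ?]]] := frac_common p q; exists (a, b, s). Qed.

Lemma frac_chain_quadruple p q : exists x : B * B * (B * B),
  [/\ x.1.2 <> 0, x.2.2 <> 0, p = frac x.1.1 x.1.2 &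
      q = frac (x.1.2 * x.2.1) x.2.2].
Proof.
by have [a [s [b [t ?]]]] := frac_chain p q; exists ((a, s), (b, t)).
Qed.

(** The operations are computed on chosen representations; [ore_addE] and
    [ore_mulE] show that any other choice gives the same result. *)
Definition ore_add p q : ore_frac :=
  let x := projT1 (cid (frac_common_triple p q)) in frac (x.1.1 + x.1.2) x.2.
Definition ore_mul p q : ore_frac :=
  let x := projT1 (cid (frac_chain_quadruple p q)) in frac (x.1.1 * x.2.1) x.2.2.
Definition ore_opp (p : ore_frac) : ore_frac :=
  frac (- ore_num (repr p)) (ore_den (repr p)).
Definition ore_scale (c : K) (p : ore_frac) : ore_frac :=
  frac (c *: ore_num (repr p)) (ore_den (repr p)).

Lemma frac_repr (p : ore_frac) : frac (ore_num (repr p)) (ore_den (repr p)) = p.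
Proof.
rewrite -[RHS]reprK /frac; congr (\pi _); apply: val_inj.
rewrite val_insubd; move: (repr p) => [[a s] /= s0].
by rewrite /ore_num /ore_den /= s0.
Qed.

Lemma ore_addE a b s : s <> 0 ->
  ore_add (frac a s) (frac b s) = frac (a + b) s.
Proof.
move=> s0; rewrite /ore_add; case: cid => -[[a' b'] s'] /= [s'0 Ea Eb].
have [u [v [u0 v0 E]]] := ore_common s0 s'0.
apply/esym/(frac_eq s0 s'0 u0 E).
by rewrite !mulrDl ((fracE _ _ s0 s'0).1 Ea _ _ E) ((fracE _ _ s0 s'0).1 Eb _ _ E).
Qed.

Lemma ore_mulE a s b t : s <> 0 -> t <> 0 ->
  ore_mul (frac a s) (frac (s * b) t) = frac (a * b) t.
Proof.
move=> s0 t0; rewrite /ore_mul; case: cid => -[[a' s'] [b' t']] /=.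
move=> [s'0 t'0 Ea Eb].
have [u [v [u0 v0 E]]] := ore_common t0 t'0.
apply/esym/(frac_eq t0 t'0 u0 E); rewrite -!mulrA.
apply: ((fracE _ _ s0 s'0).1 Ea); rewrite !mulrA.
exact: ((fracE _ _ t0 t'0).1 Eb).
Qed.

Lemma ore_oppE a s : s <> 0 -> ore_opp (frac a s) = frac (- a) s.
Proof.
move=> s0; rewrite /ore_opp; have d0 := @ore_den_neq0 (repr (frac a s)).
have [u [v [u0 v0 E]]] := ore_common d0 s0.
apply: (frac_eq d0 s0 u0 E); rewrite !mulNr; congr (- _).
exact: ((fracE _ _ d0 s0).1 (frac_repr _)).
Qed.

Lemma ore_scaleE c a s : s <> 0 -> ore_scale c (frac a s) = frac (c *: a) s.
Proof.
move=> s0; rewrite /ore_scale; have d0 := @ore_den_neq0 (repr (frac a s)).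
have [u [v [u0 v0 E]]] := ore_common d0 s0.
apply: (frac_eq d0 s0 u0 E); rewrite -!scalerAl; congr (_ *: _).
exact: ((fracE _ _ d0 s0).1 (frac_repr _)).
Qed.

Lemma ore1_neq0 : (1 : B) <> 0. Proof. exact/eqP/oner_neq0. Qed.
Local Notation n10 := ore1_neq0.

Lemma frac0 s : s <> 0 -> frac 0 s = frac 0 1.
Proof.
move=> s0; apply: (@frac_eq _ _ _ _ 1 s); rewrite ?mul0r ?mulr1 ?mul1r //.
all: exact: n10.
Qed.

Fact ore_addA : associative ore_add.
Proof.
move=> p q r; have [a [b [s [s0 -> ->]]]] := frac_common p q.
have [c [t [t0 ->]]] := fracP r.
have [u [v [u0 v0 E]]] := ore_common s0 t0.
rewrite -(frac_amp a s0 u0) -(frac_amp b s0 u0) -(frac_amp c t0 v0) -E.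
by have su0 := ore_mul_neq0 s0 u0; rewrite !ore_addE // addrA.
Qed.
Fact ore_addC : commutative ore_add.
Proof.
move=> p q; have [a [b [s [s0 -> ->]]]] := frac_common p q.
by rewrite !ore_addE // addrC.
Qed.
Fact ore_add0 : left_id (frac 0 1) ore_add.
Proof. by move=> p; have [a [s [s0 ->]]] := fracP p; rewrite -(frac0 s0) ore_addE // add0r. Qed.
Fact ore_addN : left_inverse (frac 0 1) ore_opp ore_add.
Proof.
move=> p; have [a [s [s0 ->]]] := fracP p.
by rewrite ore_oppE // ore_addE // addNr frac0.
Qed.
HB.instance Definition _ := GRing.isZmodule.Build ore_frac
  ore_addA ore_addC ore_add0 ore_addN.

Lemma frac_eq0 a s : s <> 0 -> frac a s = 0 <-> a = 0.
Proof.
move=> s0; split=> [/(fracE _ _ s0 n10)/(_ 1 s)|->]; last exact: frac0.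
by rewrite mulr1 mul1r mul0r mulr1; apply.
Qed.

Fact ore_mulA : associative ore_mul.
Proof.
move=> p q r; have [a [s [b [t [s0 t0 -> ->]]]]] := frac_chain p q.
have [c [w [w0 ->]]] := fracP r.
have [d [u [u0 E]]] := ore_right c t0.
have wu0 := ore_mul_neq0 w0 u0.
by rewrite -(frac_amp c w0 u0) E !ore_mulE // -!mulrA !ore_mulE // mulrA.
Qed.
Fact ore_mul1 : left_id (frac 1 1) ore_mul.
Proof.
move=> p; have [a [s [s0 ->]]] := fracP p.
by rewrite -{1}[a]mul1r ore_mulE ?mul1r //; apply: n10.
Qed.
Fact ore_mulr1 : right_id (frac 1 1) ore_mul.
Proof.
move=> p; have [a [s [s0 ->]]] := fracP p.
have -> : frac 1 1 = frac (s * 1) s.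
  by rewrite mulr1 -(frac_amp 1 n10 s0) mul1r.
by rewrite ore_mulE // mulr1.
Qed.
Fact ore_mulDl : left_distributive ore_mul +%R.
Proof.
move=> p q r; have [a [b [s [s0 -> ->]]]] := frac_common p q.
have [c [t [t0 ->]]] := fracP r.
have [d [u [u0 E]]] := ore_right c s0; have tu0 := ore_mul_neq0 t0 u0.
rewrite -(frac_amp c t0 u0) E -[frac a s + _]/(ore_add _ _) ore_addE //.
by rewrite !ore_mulE // -[RHS]/(ore_add _ _) ore_addE // mulrDl.
Qed.
Fact ore_mulDr : right_distributive ore_mul +%R.
Proof.
move=> p q r; have [b [c [t [t0 -> ->]]]] := frac_common q r.
have [a [s [s0 ->]]] := fracP p.
have [b' [u [u0 Eb]]] := ore_right b s0; have tu0 := ore_mul_neq0 t0 u0.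
have [c' [v [v0 Ec]]] := ore_right (c * u) s0.
have tuv0 := ore_mul_neq0 tu0 v0.
rewrite -(frac_amp b t0 u0) -(frac_amp c t0 u0).
rewrite -(frac_amp (b * u) tu0 v0) -(frac_amp (c * u) tu0 v0) Eb Ec -(mulrA s).
rewrite -[frac (s * _) _ + _]/(ore_add _ _) ore_addE // -mulrDr.
by rewrite !ore_mulE // -[RHS]/(ore_add _ _) ore_addE // mulrDr.
Qed.
Fact ore_frac1_neq0 : frac 1 1 != 0.
Proof. by apply/eqP => /frac_eq0 -/(_ n10); apply: n10. Qed.
HB.instance Definition _ := GRing.Zmodule_isNzRing.Build ore_frac
  ore_mulA ore_mul1 ore_mulr1 ore_mulDl ore_mulDr ore_frac1_neq0.

Fact ore_scaleA c d p : ore_scale c (ore_scale d p) = ore_scale (c * d) p.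
Proof.
by have [a [s [s0 ->]]] := fracP p; rewrite !ore_scaleE // scalerA.
Qed.
Fact ore_scale1 : left_id 1 ore_scale.
Proof. by move=> p; have [a [s [s0 ->]]] := fracP p; rewrite ore_scaleE // scale1r. Qed.
Fact ore_scaleDr : right_distributive ore_scale +%R.
Proof.
move=> c p q; have [a [b [s [s0 -> ->]]]] := frac_common p q.
rewrite -[frac a s + _]/(ore_add _ _) ore_addE // !ore_scaleE //.
by rewrite -[RHS]/(ore_add _ _) ore_addE // scalerDr.
Qed.
Fact ore_scaleDl p : {morph ore_scale^~ p : c d / c + d}.
Proof.
move=> c d; have [a [s [s0 ->]]] := fracP p; rewrite !ore_scaleE //.
by rewrite -[RHS]/(ore_add _ _) ore_addE // scalerDl.
Qed.
HB.instance Definition _ := GRing.Zmodule_isLmodule.Build K ore_frac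
  ore_scaleA ore_scale1 ore_scaleDr ore_scaleDl.

Lemma fracM a s b t : s <> 0 -> t <> 0 ->
  frac a s * frac (s * b) t = frac (a * b) t.
Proof. exact: ore_mulE. Qed.
Lemma fracZ c a s : s <> 0 -> c *: frac a s = frac (c *: a) s.
Proof. exact: ore_scaleE. Qed.
Lemma fracD a b s : s <> 0 -> frac a s + frac b s = frac (a + b) s.
Proof. exact: ore_addE. Qed.

Fact ore_scaleAl (c : K) (p q : ore_frac) : c *: (p * q) = (c *: p) * q.
Proof.
have [a [s [b [t [s0 t0 -> ->]]]]] := frac_chain p q.
by rewrite fracM // !fracZ // fracM // scalerAl.
Qed.
HB.instance Definition _ := GRing.Lmodule_isLalgebra.Build K ore_frac
  ore_scaleAl.
Fact ore_scaleAr (c : K) (p q : ore_frac) : c *: (p * q) = p * (c *: q).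
Proof.
have [a [s [b [t [s0 t0 -> ->]]]]] := frac_chain p q.
by rewrite fracM // !fracZ // (scalerAr c s b) fracM // scalerAr.
Qed.
HB.instance Definition _ := GRing.Lalgebra_isAlgebra.Build K ore_frac
  ore_scaleAr.

Definition ore_unit : pred ore_frac := fun p => p != 0.
Definition ore_inv (p : ore_frac) : ore_frac :=
  if p == 0 then p else frac (ore_den (repr p)) (ore_num (repr p)).

Lemma frac_num_neq0 (p : ore_frac) : p != 0 -> ore_num (repr p) <> 0.
Proof.
move=> p0 n0; case/eqP: p0; rewrite -[p]frac_repr n0.
by apply/frac_eq0 => //; apply: ore_den_neq0.
Qed.

Lemma fracMV a s : a <> 0 -> s <> 0 -> frac a s * frac s a = 1.
Proof.
move=> a0 s0; rewrite -{2}[s]mulr1 fracM // mulr1.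
by rewrite -[1]/(frac 1 1) -(frac_amp 1 n10 a0) !mul1r.
Qed.

Fact ore_mulVr : {in ore_unit, left_inverse 1 ore_inv *%R}.
Proof.
move=> p p0; have /frac_num_neq0 n0 := p0; rewrite /ore_inv.
rewrite (negPf p0) -[X in _ * X]frac_repr fracMV //; exact: ore_den_neq0.
Qed.
Fact ore_divrr : {in ore_unit, right_inverse 1 ore_inv *%R}.
Proof.
move=> p p0; have /frac_num_neq0 n0 := p0; rewrite /ore_inv.
rewrite (negPf p0) -[X in X * _]frac_repr fracMV //; exact: ore_den_neq0.
Qed.
Fact ore_unitP p q : q * p = 1 /\ p * q = 1 -> ore_unit p.
Proof.
move=> [E _]; apply/negP => /eqP p0; move: E; rewrite p0 mulr0 => /esym/eqP.
by rewrite oner_eq0.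
Qed.
Fact ore_inv0 : {in [predC ore_unit], ore_inv =1 id}.
Proof. by move=> p; rewrite inE /= negbK /ore_inv => ->. Qed.
HB.instance Definition _ := GRing.NzRing_hasMulInverse.Build ore_frac
  ore_mulVr ore_divrr ore_unitP ore_inv0.

Definition ore_inj (a : B) : ore_frac := frac a 1.
Fact ore_inj_additive : zmod_morphism ore_inj.
Proof.
move=> a b; rewrite /ore_inj -[b in RHS]opprK.
rewrite -[frac (- - b) 1]ore_oppE; last exact: n10.
rewrite -[ore_opp _]/(- frac (- b) 1) opprK.
by rewrite fracD //; apply: n10.
Qed.
HB.instance Definition _ := GRing.isZmodMorphism.Build B ore_frac ore_inj
  ore_inj_additive.
Fact ore_inj_multiplicative : monoid_morphism ore_inj.
Proof.
split=> // a b; rewrite /ore_inj -[b in RHS]mul1r fracM //; exact: n10.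
Qed.
HB.instance Definition _ := GRing.isMonoidMorphism.Build B ore_frac ore_inj
  ore_inj_multiplicative.
Fact ore_inj_scalable : scalable ore_inj.
Proof. by move=> c a; rewrite /ore_inj fracZ //; apply: n10. Qed.
HB.instance Definition _ := GRing.isScalable.Build K B ore_frac *:%R ore_inj
  ore_inj_scalable.

Lemma ore_inj_eq0 a : ore_inj a = 0 <-> a = 0.
Proof. exact: (frac_eq0 _ n10). Qed.

End OreLocalization.

(** The left Ore condition turns right fractions into left ones. *)
Lemma ore_goldie_quotient (K : fieldType) (B : oreDomain K) :
  left_ore B -> @goldie_quotient K B (ore_frac B) (@ore_inj K B).
Proof.
move=> lore.
have nz0 c : regular_elt c -> c <> 0 :> B.
  by move=> rc c0; have [/(_ _)/eqP] := rc 1; rewrite c0 mul0r oner_eq0; move=> /(_ erefl).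
have reg c : c <> 0 :> B -> regular_elt c.
  by move=> c0 a; split=> /ore_domain[].
have injU c : c <> 0 -> ore_inj c \is a @GRing.unit (ore_frac B).
  by move=> c0; apply/negP => /eqP/ore_inj_eq0.
split.
- by move=> a b /eqP; rewrite -subr_eq0 -rmorphB => /eqP/ore_inj_eq0/eqP; rewrite subr_eq0 => /eqP.
- by move=> c /nz0/injU.
- move=> q; have [a [s [s0 ->]]] := fracP q.
  exists a, s; split; first exact: reg.
  apply: (mulIr (injU _ s0)); rewrite mulrVK; last exact: injU.
  by rewrite /= /ore_inj -[s in X in _ * X]mulr1 fracM ?mulr1 //; apply: ore1_neq0.
move=> q; have [a [s [s0 ->]]] := fracP q.
have [b [t [t0 E]]] := lore a s s0.
exists b, t; split; first exact: reg.
apply: (mulrI (injU _ t0)); rewrite mulVKr; last exact: injU.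
apply: (mulIr (injU _ s0)); rewrite -rmorphM /= -E rmorphM /= -mulrA; congr (_ * _).
by rewrite /= /ore_inj -[s in X in _ * X]mulr1 fracM ?mulr1 //; apply: ore1_neq0.
Qed.

(** * Derivations and algebraic elements *)

Section AlgebraicDerivation.
Variables (R : nzRingType) (del : R -> R).
Hypothesis delD : {morph del : a b / a + b}.
Hypothesis delM : forall a b, del (a * b) = del a * b + a * del b.

Lemma derivation0 : del 0 = 0.
Proof. by apply: (addrI (del 0)); rewrite -delD !addr0. Qed.

Lemma derivation1 : del 1 = 0.
Proof. by apply: (addrI (del 1)); rewrite addr0 -[in RHS](mulr1 1) delM mulr1 mul1r. Qed.

Lemma derivationN a : del (- a) = - del a.
Proof. by apply: (addrI (del a)); rewrite -delD !subrr derivation0. Qed.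

Lemma derivation_sum (I : Type) (r : seq I) (F : I -> R) :
  del (\sum_(i <- r) F i) = \sum_(i <- r) del (F i).
Proof. exact: (big_morph del delD derivation0). Qed.

Lemma derivationX a n : GRing.comm a (del a) ->
  del (a ^+ n) = a ^+ n.-1 * del a *+ n.
Proof.
move=> ca; elim: n => [|[|n] IHn]; first by rewrite expr0 derivation1.
  by rewrite expr1 /= expr0 mul1r.
rewrite exprS delM IHn -[n.+1.-1]/n -[n.+2.-1]/n.+1 mulrnAr mulrA -exprS.
rewrite [RHS]mulrS; congr (_ + _); exact: (commrX n.+1 (esym ca)).
Qed.

Variable g : R.
Local Notation w := (del g).
Hypothesis comm_gw : GRing.comm g w.

Lemma derivation_horner (G : {poly R}) : (forall i, del G`_i = 0) ->
  del G.[g] = G^`().[g] * w.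
Proof.
move=> G0; rewrite horner_coef derivation_sum.
have sG : (size G^`() <= (size G).-1)%N by apply: size_poly.
rewrite (horner_coef_wide _ sG) mulr_suml.
case: (size G) => [|n] /=; first by rewrite !big_ord0.
rewrite big_ord_recl /= expr0 mulr1 G0 add0r; apply: eq_bigr => i _.
rewrite coef_deriv delM G0 mul0r add0r derivationX //.
by rewrite /bump leq0n add1n /= mulrnAr !mulrnAl mulrA.
Qed.

Hypothesis comm_w : GRing.comm w (del w).

Lemma derivation_nilp_step (G : {poly R}) m : (forall i, del G`_i = 0) ->
  G.[g] * w ^+ m = 0 -> G^`().[g] * w ^+ m.+2 = 0.
Proof.
move=> G0 E; have := congr1 (fun a => del a * w) E.
rewrite derivation0 mul0r delM derivation_horner // derivationX // mulrDl.
have -> : G.[g] * (w ^+ m.-1 * del w *+ m) * w = 0.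
  case: m E => [|m] E; first by rewrite mulr0n mulr0 mul0r.
  rewrite mulrnAr mulrnAl -!mulrA -[del w * w]comm_w (mulrA (w ^+ m)) -exprSr.
  by rewrite mulrA E mul0r mul0rn.
by rewrite addr0 exprSr exprS !mulrA.
Qed.

(** Differentiating a polynomial relation of [g] over constants as many times
    as its degree, each time multiplying by [w] to keep the factor of [w] in
    front, leaves its leading coefficient times a power of [w]. *)
Lemma derivation_algebraic (G : {poly R}) : (forall i, del G`_i = 0) ->
  G.[g] = 0 ->
  exists m, lead_coef G *+ (size G).-1`! * w ^+ m = 0.
Proof.
move=> G0 E; pose n := (size G).-1.
have H k : (forall i, del G^`(k)`_i = 0) /\ G^`(k).[g] * w ^+ (k + k) = 0.
  elim: k => [|k [Gk Ek]]; first by rewrite derivn0 E mul0r.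
  rewrite derivnS; split=> [i|]; last by rewrite addnS addSn; apply: derivation_nilp_step.
  rewrite coef_deriv; move: (_`_ _) (Gk i.+1) => c c0.
  elim: i.+1 => [|j IHj]; first by rewrite mulr0n derivation0.
  by rewrite mulrS delD IHj c0 addr0.
exists (n + n)%N; have [_ <-] := H n; congr (_ * _).
rewrite (_ : G^`(n) = (lead_coef G *+ n`!)%:P) ?hornerC //.
apply/polyP => i; rewrite coef_derivn coefC lead_coefE -/n.
case: i => [|i] /=; first by rewrite addn0 ffactnn.
rewrite nth_default ?mul0rn // /n; case: (size G) => [|s] /=; last by rewrite addnS ltnS leq_addr.
exact: leq0n.
Qed.

End AlgebraicDerivation.

(** * The differential curve of g and x *)

Structure diffCurve (K : closedFieldType) (lam : K) := DiffCurve {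
  dc_ring :> comAlgType K;
  dc_del : dc_ring -> dc_ring;
  dc_g : dc_ring;
  dc_gi : dc_ring;
  dc_x : dc_ring;
  dc_delD : {morph dc_del : a b / a + b};
  dc_delM : forall a b, dc_del (a * b) = dc_del a * b + a * dc_del b;
  dc_delK : forall c : K, dc_del c%:A = 0;
  dc_ggi : dc_g * dc_gi = 1;
  dc_delg : dc_del dc_g = - (dc_x * dc_g);
  dc_delx : dc_del dc_x =
    - ((2^-1 : K)%:A * dc_x ^+ 2) + lam%:A * (1 - dc_g ^+ 2);
  dc_gen : forall S : set dc_ring, (forall c : K, S c%:A) ->
    S dc_g -> S dc_gi -> S dc_x ->
    (forall a b, S a -> S b -> S (a + b)) ->
    (forall a b, S a -> S b -> S (a * b)) -> forall d, S d;
  dc_prime : forall d e, (forall j, iter j dc_del d * e = 0) -> d = 0 \/ e = 0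
}.

Section DiffCurveTheory.
Variables (K : closedFieldType) (hchar : [pchar K] =i pred0) (lam : K).
Variable D : diffCurve lam.
Local Notation del := (@dc_del K lam D).
Local Notation g := (@dc_g K lam D).
Local Notation gi := (@dc_gi K lam D).
Local Notation x := (@dc_x K lam D).
Local Notation L := (lam%:A : D).
Local Notation H := ((2^-1 : K)%:A : D).

Let delD := @dc_delD K lam D.
Let delM := @dc_delM K lam D.

(** The central element, for which [x ^ 2 = z g + 2 lam (1 + g ^ 2)]. *)
Definition dc_z : D := gi * (x ^+ 2 - L *+ 2 * (1 + g ^+ 2)).
Local Notation z := dc_z.

Lemma char0_natr n : n.+1%:R != 0 :> K.
Proof. by rewrite (pcharf0P K).1. Qed.

Lemma alg_natr_eq0 (V : lmodType K) n (v : V) : v *+ n.+1 = 0 -> v = 0.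
Proof.
move/eqP; rewrite -scaler_nat scaler_eq0 (negPf (char0_natr n)) /=.
by move/eqP.
Qed.

Lemma dc_half : H + H = 1.
Proof.
have h : (2^-1 + 2^-1 : K) = 1.
  by rewrite -mulr2n -[_ *+ 2]mulr_natr mulVf //; apply: (char0_natr 1).
by rewrite -scalerDl h scale1r.
Qed.

Lemma dc_del1 : del 1 = 0. Proof. exact: derivation1. Qed.
Lemma dc_delN a : del (- a) = - del a. Proof. exact: derivationN. Qed.
Lemma dc_delX a n : del (a ^+ n) = a ^+ n.-1 * del a *+ n.
Proof. by apply: derivationX => //; apply: mulrC. Qed.

Lemma dc_gX_inj n d : g ^+ n * d = 0 -> d = 0.
Proof.
move=> E; rewrite -[d]mul1r -(expr1n _ n) -(dc_ggi D) exprMn.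
by rewrite mulrAC E mul0r.
Qed.

Lemma dc_gz : g * z = x ^+ 2 - L *+ 2 * (1 + g ^+ 2).
Proof. by rewrite /z mulrA dc_ggi mul1r. Qed.

Lemma dc_delz : del z = 0.
Proof.
apply: (@dc_gX_inj 1); rewrite expr1.
have dL : del (L *+ 2) = 0 by rewrite mulr2n delD dc_delK addr0.
have := congr1 del dc_gz.
rewrite delM delD dc_delN (delM (L *+ 2)) (delD 1) dc_del1 dL mul0r !add0r.
rewrite !dc_delX dc_delx dc_delg /= !expr1 => E.
have {}E : g * del z = x * (g * z) + (x * (- (H * x ^+ 2) + L * (1 - g ^+ 2)) *+ 2 -
       L *+ 2 * (g * - (x * g) *+ 2)) by rewrite -E; ring.
rewrite E dc_gz.
have -> : x * (- (H * x ^+ 2) + L * (1 - g ^+ 2)) *+ 2 =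
  - ((H + H) * x ^+ 3) + L *+ 2 * x * (1 - g ^+ 2) by ring.
by rewrite dc_half; ring.
Qed.

(** Elements whose derivative vanishes generate differential ideals, so that in
    a differentially prime ring they are not zero divisors. *)
Lemma dc_const_reg c d : del c = 0 -> c * d = 0 -> c = 0 \/ d = 0.
Proof.
move=> c0 cd; apply: dc_prime => j; case: j => [|j] //=.
rewrite (_ : iter j del c = if j is 0 then c else 0); last first.
  by elim: j => //= j ->; case: j => //= _; apply: derivation0 delD.
by case: j => [|j]; rewrite ?c0 ?(derivation0 delD) mul0r.
Qed.

(** The powers of the ideal generated by [x] and [del x]. *)
Fixpoint xx_power (k : nat) (d : D) : Prop :=
  if k is k'.+1 then exists d1 d2, [/\ xx_power k' d1, xx_power k' d2 &
                                     d = x * d1 + del x * d2]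
  else True.

Lemma xx_power0 k : xx_power k 0.
Proof.
elim: k => //= k IHk; exists 0, 0; split=> //.
by rewrite !mulr0 addr0.
Qed.

Lemma xx_powerD k a b : xx_power k a -> xx_power k b -> xx_power k (a + b).
Proof.
elim: k a b => //= k IHk a b [a1 [a2 [Ha1 Ha2 ->]]] [b1 [b2 [Hb1 Hb2 ->]]].
exists (a1 + b1), (a2 + b2); split; [exact: IHk|exact: IHk|].
by rewrite !mulrDr addrACA.
Qed.

Lemma xx_powerM k a b : xx_power k a -> xx_power k (b * a).
Proof.
elim: k a => //= k IHk a [a1 [a2 [Ha1 Ha2 ->]]].
exists (b * a1), (b * a2); split; [exact: IHk|exact: IHk|].
by rewrite mulrDr !mulrA ![b * _]mulrC.
Qed.

(** Hence the ideal generated by [x] and [del x] is differential. *)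
Lemma dc_deldelx : del (del x) = x * (- del x + L *+ 2 * g ^+ 2).
Proof.
rewrite {1}dc_delx delD dc_delN (delM H) (delM L) !dc_delK !mul0r !add0r.
rewrite (delD 1) dc_delN !dc_delX dc_del1 dc_delg /= !expr1.
have -> : - (H * (x * del x *+ 2)) = - ((H + H) * (x * del x)) by ring.
by rewrite dc_half; ring.
Qed.

Lemma xx_power_del k a : xx_power k a -> xx_power k (del a).
Proof.
elim: k a => //= k IHk a [a1 [a2 [Ha1 Ha2 ->]]].
exists (del a1 + (- del x + L *+ 2 * g ^+ 2) * a2), (a1 + del a2); split.
- by apply: xx_powerD; [apply: IHk|apply: xx_powerM].
- by apply: xx_powerD => //; apply: IHk.
by rewrite delD !delM dc_deldelx; ring.
Qed.

Lemma dc_algebraic_nilp d (G : {poly D}) : (forall i, del G`_i = 0) ->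
  G.[d] = 0 -> lead_coef G <> 0 -> exists m, del d ^+ m = 0.
Proof.
move=> G0 Gd l0.
have [||||m] := @derivation_algebraic D del _ _ d _ _ G G0 Gd => //; try exact: mulrC.
rewrite mulrnAl => E; exists m.
have [] // : lead_coef G = 0 \/ del d ^+ m = 0.
apply: dc_const_reg; first by rewrite lead_coefE.
by case: _`! (fact_gt0 (size G).-1) E => // n _; apply: alg_natr_eq0.
Qed.

(** [x] and [del x] generate a differential ideal. If [x] is nilpotent then so
    is [del x], hence this ideal, and a differentially prime ring has no
    nilpotent differential ideal. *)
Lemma dc_x_nilpotent m : x ^+ m = 0 -> x = 0.
Proof.
move=> xm.
have [n x'n] : exists n, del x ^+ n = 0.
  apply: (@dc_algebraic_nilp _ 'X^m).
  - move=> i; rewrite coefXn; case: eqP => _; first exact: dc_del1.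
    exact: derivation0 delD.
  - by rewrite hornerXn.
  - by rewrite lead_coefXn; apply/eqP/oner_neq0.
have big k d : xx_power k d ->
  forall a b, (m + n <= a + b + k)%N -> x ^+ a * del x ^+ b * d = 0.
  elim: k d => [|k IHk] d /=.
    move=> _ a b; rewrite addn0 => le.
    have [ma|am] := leqP m a; first by rewrite -(subnK ma) exprD xm mulr0 !mul0r.
    have nb : (n <= b)%N by lia.
    by rewrite -(subnK nb) exprD x'n !mulr0 mul0r.
  move=> [d1 [d2 [H1 H2 ->]]] a b le.
  have E1 := IHk _ H1 a.+1 b _; have E2 := IHk _ H2 a b.+1 _.
  have -> : x ^+ a * del x ^+ b * (x * d1 + del x * d2) =
    x ^+ a.+1 * del x ^+ b * d1 + x ^+ a * del x ^+ b.+1 * d2.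
    by rewrite !exprSr; ring.
  by rewrite E1 ?E2 ?addr0 //; lia.
have top : forall d, xx_power (m + n) d -> d = 0.
  by move=> d /big/(_ 0%N 0%N); rewrite !expr0 !mul1r; apply; rewrite leqnn.
have [//|x0] := eqVneq x 0.
have down k : (forall d, xx_power k.+2 d -> d = 0) -> forall d, xx_power k.+1 d -> d = 0.
  move=> Hk d Hd; have : d = 0 \/ x = 0; last by case=> // /eqP; rewrite (negPf x0).
  apply: dc_prime => j; apply: Hk; exists (iter j del d), 0; split.
  - by elim: j => // j IHj; exact: (xx_power_del IHj).
  - exact: xx_power0.
  by rewrite mulr0 addr0 mulrC.
have one : forall d, xx_power 1 d -> d = 0.
  case: (m + n)%N top => [top d _|k]; first exact: top.
  by elim: k => // k IHk top; apply: IHk; apply: down.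
by apply: one; exists 1, 0; rewrite mulr1 mulr0 addr0.
Qed.

Lemma dc_g_algebraic (G : {poly D}) : (forall i, del G`_i = 0) ->
  G.[g] = 0 -> lead_coef G <> 0 -> x = 0.
Proof.
move=> G0 Gg l0; have [m] := dc_algebraic_nilp G0 Gg l0.
rewrite dc_delg exprNn exprMn => /(congr1 ( *%R ((-1) ^+ m))).
rewrite mulrA -exprD addnn -signr_odd odd_double mul1r mulr0 mulrC.
by move/dc_gX_inj/dc_x_nilpotent.
Qed.

Lemma dc_del_horner_z (p : {poly K}) : del (horner_alg z p) = 0.
Proof.
elim/poly_ind: p => [|p c IHp]; first by rewrite rmorph0 (derivation0 delD).
rewrite rmorphD rmorphM /= horner_algX horner_algC delD delM dc_delz IHp dc_delK.
by rewrite mul0r mulr0 !addr0.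
Qed.

(** A polynomial relation satisfied by [z] splits into linear factors, and the
    constants [z - a] are not zero divisors. *)
Lemma dc_z_cases : (exists c : K, z = c%:A) \/ injective (horner_alg z).
Proof.
have [[p p0 pz]|np] := pselect (exists2 p : {poly K}, p != 0 & horner_alg z p = 0).
  left; have [r pE] := closed_field_poly_normal p.
  have {pE} : horner_alg z (\prod_(a <- r) ('X - a%:P)) = 0.
    move: pz; rewrite pE -mul_polyC rmorphM /= horner_algC.
    move=> /(dc_const_reg (dc_delK D _))[/eqP|//].
    by rewrite scaler_eq0 oner_eq0 orbF lead_coef_eq0 (negPf p0).
  elim: r => [|a r IHr]; first by rewrite big_nil rmorph1 => /eqP; rewrite oner_eq0.
  rewrite big_cons rmorphM /= => /(dc_const_reg (dc_del_horner_z _))[|//].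
  rewrite rmorphB /= horner_algX horner_algC => /eqP; rewrite subr_eq0 => /eqP.
  by exists a.
right=> p q /eqP; rewrite -subr_eq0 -rmorphB => /eqP E.
apply/eqP; rewrite -subr_eq0; apply/negPn/negP => pq; apply: np.
by exists (p - q).
Qed.

End DiffCurveTheory.

(** * Squares of the quadratic attached to a central value *)

Section Quadratic.

(** When [zeta] is the value of [z] and [l] that of [lam], [x ^ 2] is the value of
    this polynomial at [g]. *)
Definition quad (S : nzRingType) (zeta l : S) : {poly S} :=
  zeta%:P * 'X + (l *+ 2)%:P * (1 + 'X^2).

Definition not_square_up_to (S : nzRingType) (q : {poly S}) :=
  forall u v : {poly S}, u ^+ 2 = v ^+ 2 * q -> u = 0 /\ v = 0.

(** Compare the parities of the degrees. *)
Lemma sqr_odd_degree (S : idomainType) (q : {poly S}) :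
  ~~ odd (size q) -> q != 0 -> not_square_up_to q.
Proof.
move=> oq q0 u v E; have [v0|v0] := eqVneq v 0.
  by move: E; rewrite v0 expr0n mul0r => /eqP; rewrite sqrf_eq0 => /eqP.
have u0 : u != 0.
  by rewrite -sqrf_eq0 E mulf_neq0 // sqrf_eq0.
have := congr1 (fun p : {poly S} => size p) E; rewrite !expr2 !size_mul ?mulf_neq0 //.
move: u0 v0 q0 oq; rewrite -!size_poly_gt0.
move: (size u) (size v) (size q) => i j k; lia.
Qed.

(** Here the quadratic has degree one in the coefficient variable. *)
Lemma not_square_two_var (K : fieldType) (l : {poly K}) :
  size l = 1%N \/ l = 0 -> not_square_up_to (quad 'X l).
Proof.
move=> Hl u v E.
have [c lE] : exists c, l *+ 2 = c%:P.
  case: Hl => [|->]; last by exists 0; rewrite mul0rn.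
  by move/eqP/size_poly1P => [c _ ->]; exists (c *+ 2); rewrite polyCMn.
pose r : {poly K} := c%:P * (1 + 'X ^+ 2).
have qE : swapXY (quad 'X l) = 'X%:P * 'X + r%:P.
  rewrite /quad lE rmorphD !rmorphM rmorphD rmorph1 rmorphXn /= swapXY_Y swapXY_X.
  rewrite mulrC; congr (_ + _).
  by rewrite swapXY_polyC map_polyC /= /r polyCD polyC1 polyC_exp.
have X0 : ('X%:P : {poly {poly K}}) != 0 by rewrite polyC_eq0 polyX_eq0.
have qs : size (swapXY (quad 'X l)) = 2%N.
  by rewrite qE size_MXaddC (negPf X0) size_polyC polyX_eq0.
have [|||Eu Ev] := @sqr_odd_degree _ (swapXY (quad 'X l)) _ _ (swapXY u) (swapXY v).
- by rewrite qs.
- by rewrite -size_poly_gt0 qs.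
- by rewrite -!rmorphXn -rmorphM /= -E.
by rewrite -[u]swapXYK Eu -[v]swapXYK Ev !rmorph0.
Qed.

(** The roots of the quadratic have product 1. If they are distinct, each has odd
    multiplicity; otherwise both are 1 or both are -1. *)
Lemma quad_cases (K : closedFieldType) (hchar : [pchar K] =i pred0) (c l : K) :
  [\/ not_square_up_to (quad c l), quad c l = 0 |
      exists a, a ^+ 2 = 1 /\ quad c l = (l *+ 2)%:P * ('X - a%:P) ^+ 2].
Proof.
have [l0|l0] := eqVneq l 0.
  have qE : quad c l = c *: 'X by rewrite /quad l0 mul0rn mul0r addr0 mul_polyC.
  have [c0|c0] := eqVneq c 0; first by apply: Or32; rewrite qE c0 scale0r.
  apply: Or31; apply: sqr_odd_degree; rewrite qE; first by rewrite size_scale ?size_polyX.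
  by rewrite scaler_eq0 polyX_eq0 orbF.
have l20 : l *+ 2 != 0.
  by apply/eqP => /(alg_natr_eq0 hchar (V := K^o))/eqP; rewrite (negPf l0).
pose q1 : {poly K} := 1 + (c / (l *+ 2))%:P * 'X + 'X^2.
have qE : quad c l = (l *+ 2)%:P * q1.
  have cE : (l *+ 2)%:P * (c / (l *+ 2))%:P = c%:P.
    by rewrite -polyCM mulrC divfK.
  by rewrite /q1 /quad -{1}cE; ring.
have q1s : size q1 = 3%N.
  by rewrite /q1 addrC size_polyDl ?size_polyXn // (leq_ltn_trans (size_polyD _ _)) //
    gtn_max size_poly1 /= (leq_ltn_trans (size_polyMleq _ _)) // size_polyX size_polyC;
    case: eqP.
have q10 : q1 != 0 by rewrite -size_poly_gt0 q1s.
have q1m : q1 \is monic.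
  rewrite monicE lead_coefE q1s /= /q1 !coefD coef1 coefCM coefX coefXn /=.
  by rewrite mulr0 !add0r.
have [a ra] : exists a, root q1 a by apply/closed_rootP; rewrite q1s.
have /factor_theorem[q2 q2E] := ra.
have q20 : q2 != 0 by apply: contraNneq q10 => q20; rewrite q2E q20 mul0r.
have q2s : size q2 = 2%N.
  have := q1s; rewrite q2E size_mul ?polyXsubC_eq0 // size_XsubC.
  by rewrite addn2 /= => -[].
have q2m : q2 \is monic.
  by rewrite -(monicMl _ (monicXsubC a)) mulrC -q2E.
have [b q2b] : exists b, q2 = 'X - b%:P.
  exists (- q2`_0); apply/polyP => i; rewrite coefB coefX coefC.
  case: i => [|[|i]] /=; first by rewrite sub0r opprK.
    by move: q2m; rewrite monicE lead_coefE q2s /= subr0 => /eqP.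
  by rewrite nth_default ?q2s ?subr0.
have [ab|ab] := eqVneq a b.
  apply: Or33; exists a; rewrite qE q2E q2b -ab -expr2; split=> //.
  have := congr1 (fun p : {poly K} => p`_0) q2E.
  rewrite q2b -ab -expr2 /q1 !coefD coef1 coefCM coefX coefXn /= mulr0 !addr0.
  by rewrite -horner_coef0 !hornerE /= ?sub0r ?sqrrN => <-.
apply: Or31 => u v E.
have [v0|v0] := eqVneq v 0.
  by move: E; rewrite v0 expr0n mul0r => /eqP; rewrite sqrf_eq0 => /eqP.
have q0 : quad c l != 0 by rewrite qE mulf_neq0 ?polyC_eq0.
have u0 : u != 0 by rewrite -sqrf_eq0 E mulf_neq0 // sqrf_eq0.
have mq : mup a (quad c l) = 1%N.
  rewrite qE q2E q2b mupMr ?rootC // mupMr ?root_XsubC //.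
  by rewrite -[_ - _]expr1 mup_XsubCX eqxx.
have := congr1 (mup a) E; rewrite !expr2 !mupM ?mulf_neq0 // mq.
move: (mup a u) (mup a v) => i j; lia.
Qed.

End Quadratic.

(** * Normal forms of the elements of the curve *)

Section CurveForm.
Variables (K : closedFieldType) (lam : K) (D : diffCurve lam).
Local Notation del := (@dc_del K lam D).
Local Notation g := (@dc_g K lam D).
Local Notation x := (@dc_x K lam D).
Local Notation z := (dc_z D).

(** [u(g)], the coefficients of [u] being read in [D] through [sig]. *)
Definition evalg (S : nzRingType) (sig : {rmorphism S -> D}) : {poly S} -> D :=
  horner_eval g \o map_poly sig.
HB.instance Definition _ (S : nzRingType) (sig : {rmorphism S -> D}) :=
  GRing.RMorphism.on (evalg sig).

(** [S] stands for the ring of constants [K[z]], embedded by [sig]. Elements of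
    [D] are, up to powers of [g], of the form [u(g) + v(g) x]; the predicate [V]
    restricts [v] to 0 when [x] is itself a polynomial in [g], and in either
    case makes the norm [u ^ 2 - v ^ 2 q] anisotropic. *)
Record curve_form (S : idomainType) (sig : {rmorphism S -> D})
    (iota : {rmorphism K -> S}) (zeta : S) : Prop := {
  cf_const : forall s, del (sig s) = 0;
  cf_alg : forall c, sig (iota c) = c%:A;
  cf_zeta : sig zeta = z;
  cf_inj : injective sig;
  cf_point : forall s, s != 0 ->
    exists phi : {rmorphism S -> K}, [/\ phi s != 0, forall c, phi (iota c) = c &
      forall s', exists d, sig s' = (phi s')%:A + d * (z - (phi zeta)%:A)];
  cf_norm : exists V : {poly S} -> Prop,
    [/\ forall v1 v2 a b, V v1 -> V v2 -> V (v1 * a + v2 * b),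
        forall d, exists n u v,
          V v /\ g ^+ n * d = evalg sig u + evalg sig v * x &
        forall u v, V v -> u ^+ 2 = v ^+ 2 * quad zeta (iota lam) ->
          u = 0 /\ v = 0] }.

Section Eval.
Variables (S : idomainType) (sig : {rmorphism S -> D}) (iota : {rmorphism K -> S}).
Local Notation E := (evalg sig).

Lemma evalgE u : E u = (map_poly sig u).[g]. Proof. by []. Qed.
Lemma evalgX : E 'X = g. Proof. by rewrite evalgE map_polyX hornerX. Qed.
Lemma evalgC s : E s%:P = sig s. Proof. by rewrite evalgE map_polyC hornerC. Qed.

Lemma evalg_quad zeta : (forall c, sig (iota c) = c%:A) -> sig zeta = z ->
  E (quad zeta (iota lam)) = x ^+ 2.
Proof.
move=> sK sz; rewrite /quad rmorphD !rmorphM /= !evalgC evalgX rmorphMn /= sK sz.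
rewrite mulrC dc_gz.
have -> : E (1 + 'X^2) = 1 + g ^+ 2 by rewrite rmorphD rmorph1 rmorphXn /= evalgX.
by rewrite subrK.
Qed.

Lemma evalg_full zeta : (forall c, sig (iota c) = c%:A) -> sig zeta = z ->
  forall d, exists n u v, g ^+ n * d = E u + E v * x.
Proof.
move=> sK sz.
have Eq := evalg_quad sK sz.
apply: dc_gen.
- by move=> c; exists 0%N, (iota c)%:P, 0; rewrite rmorph0 mul0r addr0 mul1r evalgC sK.
- by exists 0%N, 'X, 0; rewrite rmorph0 mul0r addr0 mul1r evalgX.
- exists 1%N, 1, 0; rewrite rmorph0 mul0r addr0 rmorph1 expr1; exact: dc_ggi.
- by exists 0%N, 0, 1; rewrite rmorph0 rmorph1 add0r !mul1r.
- move=> a b [n [u [v Ea]]] [m [u' [v' Eb]]].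
  exists (n + m)%N, ('X^m * u + 'X^n * u'), ('X^m * v + 'X^n * v').
  rewrite exprD mulrDr -mulrA mulrCA Ea -(mulrA (g ^+ n)) Eb.
  by rewrite !rmorphD !rmorphM !rmorphXn /= evalgX; ring.
move=> a b [n [u [v Ea]]] [m [u' [v' Eb]]].
exists (n + m)%N, (u * u' + v * v' * quad zeta (iota lam)), (u * v' + v * u').
rewrite exprD mulrACA Ea Eb !rmorphD !rmorphM /= Eq; ring.
Qed.

End Eval.

Hypothesis hchar : [pchar K] =i pred0.
Hypothesis x0 : x <> 0.

(** The constants are polynomials in [z], and points are values of [z]. *)
Lemma curve_form_transcendental : injective (horner_alg z) ->
  curve_form (horner_alg z) polyC 'X.
Proof.
move=> inj; have sK c : horner_alg z c%:P = c%:A by rewrite horner_algC.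
have sz : horner_alg z 'X = z by rewrite horner_algX.
split=> //; first exact: dc_del_horner_z.
  move=> s s0.
  have [a ra] := closed_nonrootP s s0.
  exists (horner_eval a); split=> [|c|p] /=; first exact: ra.
    by rewrite /horner_eval hornerC.
  have /factor_theorem[q qE] : root (p - p.[a]%:P) a by rewrite /root !hornerE subrr.
  exists (horner_alg z q); rewrite /horner_eval hornerX.
  rewrite -[p in LHS](subrK p.[a]%:P) qE rmorphD rmorphM rmorphB /=.
  by rewrite horner_algX !horner_algC addrC.
exists (fun=> True); split=> //.
  by move=> d; have [n [u [v ?]]] := evalg_full sK sz d; exists n, u, v.
move=> u v _; apply: not_square_two_var; rewrite size_polyC.
by case: eqP => [->|]; [right|left].
Qed.

(** A relation [(x - mu (g - a)) (x + mu (g - a)) = 0] whose factors generate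
    differential ideals: one of the factors vanishes. *)
Lemma dc_x_linear (c a : K) : z = c%:A -> a ^+ 2 = 1 ->
  quad c lam = (lam *+ 2)%:P * ('X - a%:P) ^+ 2 ->
  exists mu : K, x = mu%:A * (g - a%:A).
Proof.
move=> zc a1 qE.
have sK c' : in_alg D c' = c'%:A by [].
have x2 : x ^+ 2 = lam%:A *+ 2 * (g - a%:A) ^+ 2.
  rewrite -(@evalg_quad K (in_alg D) idfun c sK (esym zc)) /= qE.
  rewrite rmorphM rmorphXn rmorphB /= evalgX !evalgC /=; congr (_ * _).
  by rewrite -scalerMnl.
have [mu mu2] : exists mu : K, mu ^+ 2 = lam *+ 2.
  have [|mu] := (closed_rootP ('X^2 - (lam *+ 2)%:P) _).
    by rewrite size_polyDl ?size_polyXn // size_polyN (leq_ltn_trans (size_polyC_leq1 _)).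
  by rewrite /root !hornerE subr_eq0 => /eqP; exists mu.
pose M : D := mu%:A; pose A : D := a%:A; pose L : D := lam%:A.
have M2 : M ^+ 2 = L *+ 2.
  by rewrite /M /L -in_algE -rmorphXn mu2 rmorphMn.
have A2 : A ^+ 2 = 1 by rewrite /A -in_algE -rmorphXn a1 rmorph1.
pose H : D := (2^-1 : K)%:A; have HH : H + H = 1 := dc_half hchar D.
pose s := x - M * (g - A); pose s' := x + M * (g - A).
have ss' : s * s' = 0.
  have -> : s * s' = x ^+ 2 - M ^+ 2 * (g - A) ^+ 2 by rewrite /s /s'; ring.
  by rewrite x2 M2 subrr.
pose t := - H * (x - M * A - M * g).
have ds : del s = s * t.
  have -> : del s = del x - M * del g.
    rewrite /s dc_delD (derivationN (@dc_delD _ _ D)) (dc_delM M) dc_delK mul0r add0r.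
    by rewrite dc_delD (derivationN (@dc_delD _ _ D)) dc_delK subr0.
  rewrite dc_delx dc_delg -/H -/L.
  have -> : s * t = - H * x ^+ 2 + (H + H) * M * x * g
     - H * M ^+ 2 * (g ^+ 2 - A ^+ 2) by rewrite /s /t; ring.
  rewrite HH M2 A2.
  have -> : H * (L *+ 2) * (g ^+ 2 - 1) = (H + H) * L * (g ^+ 2 - 1) by ring.
  by rewrite HH; ring.
have dsj j : exists r, iter j del s = s * r.
  elim: j => [|j [r IHj]]; first by exists 1; rewrite mulr1.
  by exists (t * r + del r); rewrite iterS IHj dc_delM ds; ring.
have [s0|s0] : s = 0 \/ s' = 0.
- by apply: dc_prime => j; have [r ->] := dsj j; rewrite mulrAC ss' mul0r.
- by exists mu; apply/eqP; rewrite -subr_eq0; apply/eqP.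
exists (- mu); apply/eqP; rewrite -subr_eq0; apply/eqP; rewrite -[RHS]s0 /s' /M.
by rewrite scaleNr mulNr opprK.
Qed.

Lemma curve_form_algebraic (c : K) : z = c%:A -> curve_form (in_alg D) idfun c.
Proof.
move=> zc; have sK c' : in_alg D c' = c'%:A by [].
have full := @evalg_full K (in_alg D) idfun c sK (esym zc).
split=> //.
- by move=> s; apply: dc_delK.
- exact: fmorph_inj.
- move=> s s0; exists idfun; split=> // s'; exists 0.
  by rewrite mul0r addr0.
have [ns|q0|[a [a1 qE]]] := quad_cases hchar c lam.
- exists (fun=> True); split=> //.
    by move=> d; have [n [u [v ?]]] := full d; exists n, u, v.
  by move=> u v _; apply: ns.
- case: x0; apply: (@dc_x_nilpotent _ hchar _ _ 2).
  by rewrite -(@evalg_quad K (in_alg D) idfun c sK (esym zc)) /= q0 rmorph0.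
have [mu xE] := dc_x_linear zc a1 qE.
exists (fun v => v = 0); split=> [v1 v2 a' b -> ->|d|u v ->].
- by rewrite !mul0r addr0.
- have [n [u [v E]]] := full d.
  exists n, (u + v * (mu%:P * ('X - a%:P))), 0; split=> //.
  rewrite rmorph0 mul0r addr0 E {1}xE rmorphD !rmorphM rmorphB /= evalgX.
  by rewrite !evalgC.
by rewrite expr0n mul0r => /eqP; rewrite sqrf_eq0 => /eqP.
Qed.

End CurveForm.

Section CurveFormTheory.
Variables (K : closedFieldType) (lam : K) (D : diffCurve lam).
Hypothesis hchar : [pchar K] =i pred0.
Local Notation del := (@dc_del K lam D).
Local Notation g := (@dc_g K lam D).
Local Notation x := (@dc_x K lam D).
Local Notation z := (dc_z D).
Hypothesis x0 : x <> 0.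
Variables (S : idomainType) (sig : {rmorphism S -> D}).
Variables (iota : {rmorphism K -> S}) (zeta : S).
Hypothesis cf : curve_form sig iota zeta.
Local Notation E := (evalg sig).

(** A nontrivial kernel would make [g] algebraic over the constants. *)
Lemma evalg_inj : injective E.
Proof.
apply: raddf_inj => u Eu; apply/eqP/negPn/negP => u0.
have l0 : sig (lead_coef u) != 0.
  rewrite -(rmorph0 sig) (inj_eq (cf_inj cf)) lead_coef_eq0 //.
apply: x0; apply: (@dc_g_algebraic _ hchar _ _ (map_poly sig u)) => //.
- by move=> i; rewrite coef_map; apply: cf_const cf _.
- by rewrite lead_coef_map_eq //; apply/eqP.
Qed.

Lemma evalg_eq0 u : E u = 0 -> u = 0.
Proof. by rewrite -(rmorph0 E) => /evalg_inj. Qed.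

(** Multiply by the conjugate, under [x] to [- x], of the normal form. *)
Lemma dc_norm d : d <> 0 -> exists d' h, h <> 0 /\ d * d' = E h.
Proof.
move=> d0; have [V [_ V1 V2]] := cf_norm cf.
have [n [u [v [Vv Ed]]]] := V1 d.
exists (g ^+ n * (E u - E v * x)), (u ^+ 2 - v ^+ 2 * quad zeta (iota lam)).
split.
  move=> /eqP; rewrite subr_eq0 => /eqP/(V2 _ _ Vv)[u0 v0].
  by apply: d0; apply: (@dc_gX_inj _ _ D n); rewrite Ed u0 v0 rmorph0 mul0r addr0.
rewrite mulrCA mulrA Ed rmorphB (rmorphM E (v ^+ 2)) !rmorphXn /= evalg_quad; first by ring.
- exact: cf_alg cf.
- exact: cf_zeta cf.
Qed.

Lemma dc_domain (d e : D) : d * e = 0 -> d = 0 \/ e = 0.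
Proof.
move=> de; have [->|/eqP d0] := eqVneq d 0; first by left.
have [->|/eqP e0] := eqVneq e 0; first by right.
have [d' [h [h0 Eh]]] := dc_norm d0; have [e' [k [k0 Ek]]] := dc_norm e0.
have : E (h * k) = 0 by rewrite rmorphM /= -Eh -Ek mulrACA de mul0r.
by move/evalg_eq0/eqP; rewrite mulf_eq0 => /orP[]/eqP.
Qed.

Lemma dc_delg_neq0 : del g <> 0.
Proof.
rewrite dc_delg => /eqP; rewrite oppr_eq0 mulrC => /eqP xg.
by apply: x0; apply: (@dc_gX_inj _ _ D 1); rewrite expr1.
Qed.

(** Evaluating the component on 1 of a normal form at a point [(c, a)] with
    [a <> 0] shows that [z - c] and [g - a] generate a proper ideal. *)
Lemma dc_point_proper (phi : {rmorphism S -> K}) (a : K) (d1 d2 : D) :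
  (forall c, phi (iota c) = c) -> a <> 0 ->
  d1 * (z - (phi zeta)%:A) + d2 * (g - a%:A) <> 1.
Proof.
move=> phiK a0 E1; have [V [V3 V1 V2]] := cf_norm cf.
have [n1 [u1 [v1 [Vv1 E_1]]]] := V1 d1; have [n2 [u2 [v2 [Vv2 E_2]]]] := V1 d2.
pose c := iota (phi zeta).
pose w1 := (zeta - c)%:P * 'X^n2 : {poly S}; pose w2 := 'X^n1 * ('X - (iota a)%:P) : {poly S}.
have w1E : E w1 = (z - (phi zeta)%:A) * g ^+ n2.
  by rewrite rmorphM rmorphXn /= evalgX evalgC rmorphB /= (cf_zeta cf) (cf_alg cf).
have w2E : E w2 = g ^+ n1 * (g - a%:A).
  by rewrite rmorphM rmorphXn rmorphB /= evalgX evalgC (cf_alg cf).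
pose u := u1 * w1 + u2 * w2 - 'X^(n1 + n2); pose v := v1 * w1 + v2 * w2.
have Euv : E u + E v * x = 0.
  have -> : E u + E v * x = (E u1 + E v1 * x) * E w1 + (E u2 + E v2 * x) * E w2 - g ^+ (n1 + n2).
    rewrite /u /v rmorphB !rmorphD (rmorphM E u1 w1) (rmorphM E u2 w2).
    by rewrite (rmorphM E v1 w1) (rmorphM E v2 w2) rmorphXn /= evalgX; ring.
  rewrite -E_1 -E_2 w1E w2E; apply/eqP; rewrite subr_eq0; apply/eqP.
  transitivity (g ^+ (n1 + n2) * 1); last by rewrite mulr1.
  by rewrite -[X in _ = _ * X]E1 exprD; ring.
have [u0 _] : u = 0 /\ v = 0.
  apply: V2; first exact: V3.
  apply: evalg_inj; rewrite (rmorphM E (v ^+ 2)) !rmorphXn /= (evalg_quad (cf_alg cf) (cf_zeta cf)).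
  by move/eqP: Euv; rewrite addr_eq0 => /eqP ->; ring.
have : (map_poly phi u).[a] = 0 by rewrite u0 rmorph0 horner0.
have w10 : map_poly phi w1 = 0.
  by rewrite rmorphM /= map_polyC /= rmorphB /= phiK subrr mul0r.
have w20 : (map_poly phi w2).[a] = 0.
  rewrite rmorphM rmorphB /= map_polyX map_polyC /= phiK hornerM hornerXsubC.
  by rewrite subrr mulr0.
rewrite /u rmorphB rmorphD (rmorphM _ u1) (rmorphM _ u2) rmorphXn /= map_polyX w10.
rewrite mulr0 add0r hornerD hornerN hornerM w20 mulr0 add0r hornerXn.
by move/eqP; rewrite oppr_eq0 expf_eq0 => /andP[_ /eqP].
Qed.

Lemma dc_point_exists (h : {poly S}) : h <> 0 ->
  exists (phi : {rmorphism S -> K}) (a : K),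
    [/\ forall c, phi (iota c) = c, a <> 0, (map_poly phi h).[a] <> 0 &
      forall s, exists d, sig s = (phi s)%:A + d * (z - (phi zeta)%:A)].
Proof.
move=> /eqP h0; have l0 : lead_coef h != 0 by rewrite lead_coef_eq0.
have [phi [phil phiK phis]] := cf_point cf l0.
have hp0 : map_poly phi h * 'X != 0.
  rewrite mulf_neq0 ?polyX_eq0 //; apply: contraNneq phil => hp0.
  by rewrite lead_coefE -coef_map hp0 coef0.
have [a] := closed_nonrootP _ hp0; rewrite /root !hornerE mulf_eq0 => /norP[ha a0].
by exists phi, a; split=> //; apply/eqP.
Qed.

(** Taylor expansion at first order at the point [(phi zeta, a)]. *)
Lemma evalg_at_point (phi : {rmorphism S -> K}) (a : K) (h : {poly S}) :
  (forall s, exists d, sig s = (phi s)%:A + d * (z - (phi zeta)%:A)) ->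
  exists d1 d2, E h = (map_poly phi h).[a]%:A +
    (d1 * (z - (phi zeta)%:A) + d2 * (g - a%:A)).
Proof.
move=> phis; elim/poly_ind: h => [|h s [d1 [d2 IHh]]].
  by exists 0, 0; rewrite !rmorph0 horner0 scale0r !mul0r !addr0.
have [d Ed] := phis s.
exists (d1 * g + d), (d2 * g + (map_poly phi h).[a]%:A).
rewrite !rmorphD !rmorphM /= evalgX evalgC IHh Ed map_polyX map_polyC /= !hornerE.
rewrite scalerDl -[(_ * a)%:A]/(in_alg D _) rmorphM /=; ring.
Qed.

End CurveFormTheory.

(** * Differential operator rings *)

Section DiffOp.
Variables (D : comNzRingType) (B : nzRingType) (iota : {rmorphism D -> B}).
Variables (del : D -> D) (y : B) (g : D).
Hypothesis iota_inj : injective iota.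
Hypothesis D_domain : forall d e : D, d * e = 0 -> d = 0 \/ e = 0.
Hypothesis D_char0 : forall n (d : D), d *+ n.+1 = 0 -> d = 0.
Hypothesis delg : del g <> 0.
Hypothesis y_comm : forall d, y * iota d = iota d * y + iota (del d).
Hypothesis genB : forall S : set B, (forall d, S (iota d)) -> S y ->
  (forall a b, S a -> S b -> S (a + b)) ->
  (forall a b, S a -> S b -> S (a * b)) -> forall b, S b.

(** Operators of order less than [n], written with coefficients on the right. *)
Fixpoint order_lt (n : nat) (b : B) : Prop :=
  if n is k.+1 then exists d, order_lt k (b - y ^+ k * iota d) else b = 0.

Definition has_symbol n b d := order_lt n (b - y ^+ n * iota d).

Lemma order_lt0 n : order_lt n 0.
Proof. by elim: n => //= n IHn; exists 0; rewrite rmorph0 mulr0 subr0. Qed.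

Lemma order_ltD n a b : order_lt n a -> order_lt n b -> order_lt n (a + b).
Proof.
elim: n a b => /= [a b -> ->|n IHn a b [d Hd] [e He]]; first by rewrite addr0.
by exists (d + e); rewrite rmorphD mulrDr opprD addrACA; apply: IHn.
Qed.

Lemma order_ltMr n a d : order_lt n a -> order_lt n (a * iota d).
Proof.
elim: n a => /= [a ->|n IHn a [e He]]; first by rewrite mul0r.
by exists (e * d); rewrite rmorphM mulrA -mulrBl; apply: IHn.
Qed.

Lemma order_ltN n a : order_lt n a -> order_lt n (- a).
Proof. by move/(order_ltMr (-1)); rewrite rmorphN rmorph1 mulrN1. Qed.

Lemma order_ltB n a b : order_lt n a -> order_lt n b -> order_lt n (a - b).
Proof. by move=> Ha /order_ltN; apply: order_ltD. Qed.

Lemma order_ltS n a : order_lt n a -> order_lt n.+1 a.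
Proof. by move=> Ha; exists 0; rewrite rmorph0 mulr0 subr0. Qed.

Lemma order_lt_le m n a : (m <= n)%N -> order_lt m a -> order_lt n a.
Proof. by move/subnK <-; elim: (n - m)%N => //= k IHk /IHk/order_ltS. Qed.

Lemma order_lt_y n a : order_lt n a -> order_lt n.+1 (y * a).
Proof.
elim: n a => [a ->|n IHn a [d Hd]]; first by rewrite mulr0; apply: order_lt0.
by exists d; rewrite exprS -mulrA -mulrBr; apply: IHn.
Qed.

Lemma order_lt_yX k n a : order_lt n a -> order_lt (k + n) (y ^+ k * a).
Proof.
move=> Ha; elim: k => [|k IHk]; first by rewrite mul1r.
by rewrite exprS -mulrA; apply: order_lt_y.
Qed.

Lemma order_lt_mono n d : order_lt n.+1 (y ^+ n * iota d).
Proof. by exists d; rewrite subrr; apply: order_lt0. Qed.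

Lemma order_ltMn n a m : order_lt n a -> order_lt n (a *+ m).
Proof.
move=> Ha; elim: m => [|m IHm]; first exact: order_lt0.
by rewrite mulrS; apply: order_ltD.
Qed.

(** The first two terms of Leibniz's formula. *)
Lemma y_commX k d :
  order_lt k (iota d * y ^+ k.+1 - y ^+ k.+1 * iota d + y ^+ k * iota (del d) *+ k.+1).
Proof.
elim: k d => [|k IHk] d.
  by rewrite /= !expr1 y_comm mul1r mulr1n opprD addrA subrr add0r addNr.
have E : iota d * y ^+ k.+2 - y ^+ k.+2 * iota d + y ^+ k.+1 * iota (del d) *+ k.+2 =
  y * (iota d * y ^+ k.+1 - y ^+ k.+1 * iota d + y ^+ k * iota (del d) *+ k.+1)
  - (iota (del d) * y ^+ k.+1 - y ^+ k.+1 * iota (del d) +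
     y ^+ k * iota (del (del d)) *+ k.+1) + y ^+ k * iota (del (del d)) *+ k.+1.
  rewrite (exprS y k.+1) (mulrA (iota d)).
  have -> : iota d * y = y * iota d - iota (del d) by rewrite y_comm addrK.
  rewrite mulrBl mulrDr mulrBr mulrnAr !mulrA -!exprS (mulrS _ k.+1).
  by rewrite -[in LHS](addrA _ (- _)) opprD opprB !addrA subrK [LHS](ACl (1*3*5*4*2)).
rewrite E; apply: order_ltD.
  apply: order_ltB; first exact/order_lt_y/IHk.
  exact/order_ltS/IHk.
exact/order_ltMn/order_lt_mono.
Qed.

Lemma iota_yX k d : order_lt k (iota d * y ^+ k - y ^+ k * iota d).
Proof.
case: k => [|k]; first by rewrite mulr1 mul1r subrr.
exists (- (del d *+ k.+1)); rewrite rmorphN mulrN opprK rmorphMn mulrnAr.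
exact: y_commX.
Qed.

Lemma order_ltMl n a d : order_lt n a -> order_lt n (iota d * a).
Proof.
elim: n a => /= [a ->|n IHn a [e He]]; first by rewrite mulr0.
exists (d * e).
have -> : iota d * a - y ^+ n * iota (d * e) =
    iota d * (a - y ^+ n * iota e) + (iota d * y ^+ n - y ^+ n * iota d) * iota e.
  by rewrite mulrBr mulrBl rmorphM !mulrA addrA subrK.
by apply: order_ltD; [exact: IHn|apply/order_ltMr/iota_yX].
Qed.

Lemma order_ltM m n a b : order_lt m a -> order_lt n.+1 b -> order_lt (m + n) (a * b).
Proof.
elim: m a => [a -> _|m IHm a [d Hd] Hb]; first by rewrite mul0r; apply: order_lt0.
rewrite -[a](subrK (y ^+ m * iota d)) mulrDl; apply: order_ltD.
  by rewrite addSn; apply/order_ltS/IHm.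
by rewrite -mulrA addSnnS; apply/order_lt_yX/order_ltMl.
Qed.

Lemma has_symbolM m n a b d e :
  has_symbol m a d -> has_symbol n b e -> has_symbol (m + n) (a * b) (d * e).
Proof.
move=> Ha Hb; rewrite /has_symbol.
have -> : a * b - y ^+ (m + n) * iota (d * e) =
   (a - y ^+ m * iota d) * b + y ^+ m * (iota d * (b - y ^+ n * iota e) +
      (iota d * y ^+ n - y ^+ n * iota d) * iota e).
  have -> : iota d * (b - y ^+ n * iota e) + (iota d * y ^+ n - y ^+ n * iota d) * iota e
    = iota d * b - y ^+ n * iota (d * e).
    by rewrite mulrBr mulrBl rmorphM !mulrA addrA subrK.
  by rewrite mulrBl mulrBr exprD !mulrA addrA subrK.
apply: order_ltD; first by apply: order_ltM => //; exists e.
apply/order_lt_yX/order_ltD; first exact: order_ltMl.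
exact/order_ltMr/iota_yX.
Qed.

Lemma has_symbolD n a b d e :
  has_symbol n a d -> has_symbol n b e -> has_symbol n (a + b) (d + e).
Proof.
by move=> Ha Hb; rewrite /has_symbol rmorphD mulrDr opprD addrACA; apply: order_ltD.
Qed.

Lemma has_symbolN n a d : has_symbol n a d -> has_symbol n (- a) (- d).
Proof.
by move=> Ha; rewrite /has_symbol rmorphN mulrN -opprD; apply: order_ltN.
Qed.

Lemma has_symbol0 n a : has_symbol n a 0 <-> order_lt n a.
Proof. by rewrite /has_symbol rmorph0 mulr0 subr0. Qed.

Lemma has_symbol_iota d : has_symbol 0 (iota d) d.
Proof. by rewrite /has_symbol mul1r subrr. Qed.

Lemma has_symbol_yX n : has_symbol n (y ^+ n) 1.
Proof. by rewrite /has_symbol rmorph1 mulr1 subrr; apply: order_lt0. Qed.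

(** The commutator with [g] lowers the order by one and multiplies the symbol
    by the order times [del g], which is not a zero divisor. *)
Definition adg b := b * iota g - iota g * b.

Lemma adgD a b : adg (a + b) = adg a + adg b.
Proof. by rewrite /adg mulrDl mulrDr opprD addrACA. Qed.

Lemma adg_order n b : order_lt n.+1 b -> order_lt n (adg b).
Proof.
elim: n b => [b [d /= /eqP]|n IHn b [d Hd]].
  by rewrite mul1r subr_eq0 => /eqP ->; rewrite /adg -!rmorphM mulrC subrr.
rewrite -[b](subrK (y ^+ n.+1 * iota d)) adgD; apply: order_ltD.
  by apply/order_ltS/IHn.
rewrite /adg -mulrA -rmorphM (mulrC d) rmorphM !mulrA -mulrBl.
by apply/order_ltMr; rewrite -opprB; apply/order_ltN/iota_yX.
Qed.

Lemma adg_symbol n b d :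
  has_symbol n.+1 b d -> has_symbol n (adg b) (del g * d *+ n.+1).
Proof.
move=> Hd; rewrite -[b](subrK (y ^+ n.+1 * iota d)) adgD.
rewrite -[X in has_symbol _ _ X]add0r; apply: has_symbolD.
  by apply/has_symbol0; apply: adg_order.
rewrite /has_symbol /adg -mulrA -rmorphM (mulrC d) rmorphM !mulrA -mulrBl.
rewrite -mulrnAl rmorphM mulrA -mulrBl; apply/order_ltMr.
rewrite rmorphMn mulrnAr -[X in order_lt _ X]opprK; apply/order_ltN.
rewrite opprD opprB opprK; exact: y_commX.
Qed.

(** Iterated commutators with [g] bring a symbol down to order 0. *)
Lemma symbol0_eq0 n d : has_symbol n 0 d -> d = 0.
Proof.
elim: n d => [d|n IHn d].
  rewrite /has_symbol /= mul1r sub0r => /eqP; rewrite oppr_eq0 => /eqP d0.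
  by apply: iota_inj; rewrite d0 rmorph0.
move/adg_symbol; rewrite /adg mul0r mulr0 subr0 => /IHn/D_char0/D_domain[//|//].
Qed.

Lemma symbol_uniq n a d e : has_symbol n a d -> has_symbol n a e -> d = e.
Proof.
move=> Hd /has_symbolN He; have := has_symbolD Hd He; rewrite subrr.
by move/symbol0_eq0/eqP; rewrite subr_eq0 => /eqP.
Qed.

Lemma order_lt_symbol n a : order_lt n a ->
  a = 0 \/ exists m d, [/\ (m < n)%N, d <> 0 & has_symbol m a d].
Proof.
elim: n => [->|n IHn [d Hd]]; first by left.
have [d0|/eqP d0] := eqVneq d 0; last by right; exists n, d.
have [|->|[m [e [mn e0 He]]]] := IHn; first by apply/has_symbol0; rewrite -d0.
  by left.
by right; exists m, e; split=> //; apply: ltnW.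
Qed.

Lemma order_lt_ex b : exists n, order_lt n b.
Proof.
apply: (genB (S := [set b | exists n, order_lt n b])).
- by move=> d; exists 1%N, d; rewrite mul1r subrr.
- by exists 2%N, 1; rewrite rmorph1 mulr1 subrr; apply: (@order_lt0 1).
- move=> a c [m Ha] [n Hc]; exists (maxn m n); apply: order_ltD.
    exact: order_lt_le (leq_maxl _ _) Ha.
  exact: order_lt_le (leq_maxr _ _) Hc.
by move=> a c [m Ha] [n /order_ltS Hc]; exists (m + n)%N; apply: order_ltM.
Qed.

Lemma symbol_ex b : b <> 0 -> exists n d, d <> 0 /\ has_symbol n b d.
Proof.
move=> b0; have [n /order_lt_symbol[//|[m [d [_ d0 Hd]]]]] := order_lt_ex b.
by exists m, d.
Qed.

Lemma diffop_domain : domain B.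
Proof.
move=> a b ab.
have [->|/eqP/symbol_ex[m [d [d0 Hd]]]] := eqVneq a 0; first by left.
have [->|/eqP/symbol_ex[n [e [e0 He]]]] := eqVneq b 0; first by right.
by have := has_symbolM Hd He; rewrite ab => /symbol0_eq0/D_domain[].
Qed.

Lemma iota_pow_neq0 e k : e <> 0 -> iota (e ^+ k) <> 0.
Proof.
move=> e0; rewrite -(rmorph0 iota) => /iota_inj; elim: k => [|k IHk].
  by move/eqP; rewrite oner_eq0.
by rewrite exprS => /D_domain[].
Qed.

Lemma pseudo_division_right n s e m a : has_symbol n s e -> order_lt m a ->
  exists w k, order_lt n (a * iota (e ^+ k) - s * w).
Proof.
move=> Hs; elim: m a => [a ->|m IHm a [d Hd]].
  by exists 0, 0%N; rewrite mul0r mulr0 subr0; apply: order_lt0.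
have [mn|nm] := ltnP m n.
  exists 0, 0%N; rewrite expr0 rmorph1 mulr1 mulr0 subr0.
  by apply: (order_lt_le mn); exists d.
pose w0 := y ^+ (m - n) * iota d.
have H : order_lt m (a * iota e - s * w0).
  apply/has_symbol0; rewrite -(subrr (d * e)); apply: has_symbolD.
    by rewrite -[m]addn0; apply: has_symbolM => //; apply: has_symbol_iota.
  apply: has_symbolN; rewrite -(subnKC nm) mulrC; apply: has_symbolM => //.
  rewrite -[X in has_symbol X]addn0 -[X in has_symbol _ _ X]mul1r.
  by apply: has_symbolM; [apply: has_symbol_yX|apply: has_symbol_iota].
have [w [k Hw]] := IHm _ H.
exists (w0 * iota (e ^+ k) + w), k.+1.
by move: Hw; rewrite mulrBl exprS rmorphM mulrDr opprD !mulrA addrA.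
Qed.

Lemma pseudo_division_left n s e m a : has_symbol n s e -> order_lt m a ->
  exists w k, order_lt n (iota (e ^+ k) * a - w * s).
Proof.
move=> Hs; elim: m a => [a ->|m IHm a [d Hd]].
  by exists 0, 0%N; rewrite mulr0 mul0r subr0; apply: order_lt0.
have [mn|nm] := ltnP m n.
  exists 0, 0%N; rewrite expr0 rmorph1 mul1r mul0r subr0.
  by apply: (order_lt_le mn); exists d.
pose w0 := iota d * y ^+ (m - n).
have H : order_lt m (iota e * a - w0 * s).
  apply/has_symbol0; rewrite -(subrr (e * d)); apply: has_symbolD.
    by rewrite -[m]add0n; apply: has_symbolM => //; apply: has_symbol_iota.
  apply: has_symbolN; rewrite -(subnK nm) (mulrC e); apply: has_symbolM => //.
  rewrite -[X in has_symbol X]add0n -[X in has_symbol _ _ X]mulr1.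
  by apply: has_symbolM; [apply: has_symbol_iota|apply: has_symbol_yX].
have [w [k Hw]] := IHm _ H.
exists (iota (e ^+ k) * w0 + w), k.+1.
by move: Hw; rewrite mulrBr exprSr rmorphM mulrDl opprD !mulrA addrA.
Qed.

(** Common right multiples by the Euclidean algorithm on orders. *)
Lemma diffop_right_ore : right_ore B.
Proof.
suff H n : forall a s e, e <> 0 -> has_symbol n s e ->
    exists b t : B, t <> 0 /\ a * t = s * b.
  by move=> a s /symbol_ex[n [e [e0 He]]]; apply: H e0 He.
elim/ltn_ind: n => n IHn a s e e0 Hs.
have [m Ha] := order_lt_ex a.
have [w [k /order_lt_symbol[/eqP|[n' [e' [n'n e'0 Hr]]]]]] := pseudo_division_right Hs Ha.
  rewrite subr_eq0 => /eqP E; exists w, (iota (e ^+ k)); split=> //.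
  exact: iota_pow_neq0.
have s0 : s <> 0 by move=> s0; apply: e0; apply: (@symbol0_eq0 n); rewrite -s0.
have [b [t [t0 E]]] := IHn _ n'n s _ _ e'0 Hr.
exists (t + w * b), (iota (e ^+ k) * b); split.
  move=> /diffop_domain[|b0]; first exact: iota_pow_neq0.
  by move: E; rewrite b0 mulr0 => /diffop_domain[].
by rewrite mulrDr E mulrBl !mulrA subrK.
Qed.

Lemma diffop_centraliser b : b * iota g = iota g * b -> exists d, b = iota d.
Proof.
move=> bg; have ad0 : adg b = 0 by rewrite /adg bg subrr.
have [n] := order_lt_ex b; elim: n => [->|[_ [d]|n IHn]].
- by exists 0; rewrite rmorph0.
- by rewrite /= mul1r => /eqP; rewrite subr_eq0 => /eqP; exists d.
move=> [d Hd]; apply: IHn; have := adg_symbol Hd; rewrite ad0.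
by move=> /symbol0_eq0/D_char0/D_domain[//|d0]; apply/has_symbol0; rewrite -d0.
Qed.

(** Ideals are stable under commutators with [g], which lead from [b] to an
    element of order 0. *)
Lemma diffop_ideal b : b <> 0 ->
  exists2 d, d <> 0 & forall I : set B, two_sided_ideal I -> I b -> I (iota d).
Proof.
move=> /symbol_ex[n [d [d0 Hd]]]; elim: n => [|n IHn] in b d d0 Hd *.
  move: Hd; rewrite /has_symbol /= mul1r => /eqP; rewrite subr_eq0 => /eqP bd.
  by exists d; rewrite -?bd.
have [|e e0 He] := IHn _ _ _ (adg_symbol Hd); first by move=> /D_char0/D_domain[].
exists e => // I iI Ib; apply: He => //; have [_ IB _] := iI.
by apply: IB; [apply: ideal_mulr|apply: ideal_mull].
Qed.

Lemma order_const_coef b : exists d b', b = iota d + y * b'.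
Proof.
have [n] := order_lt_ex b; elim: n b => [b ->|n IHn b [d /IHn[e [b' E]]]].
  by exists 0, 0; rewrite rmorph0 mulr0 addr0.
move: E => /eqP; rewrite subr_eq => /eqP ->; case: n {IHn} => [|n].
  by exists (e + d), b'; rewrite mul1r rmorphD addrAC.
by exists e, (b' + y ^+ n * iota d); rewrite mulrDr exprS mulrA addrA.
Qed.

Lemma iota_eq_yM d b : iota d = y * b -> d = 0.
Proof.
move=> E; have [b0|/eqP/symbol_ex[n [e [e0 He]]]] := eqVneq b 0.
  by apply: iota_inj; rewrite E b0 mulr0 rmorph0.
have H1 : has_symbol n.+1 (iota d) (1 * e).
  by rewrite E -add1n; apply: has_symbolM He; rewrite -(expr1 y); apply: has_symbol_yX.
have H2 : has_symbol n.+1 (iota d) 0.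
  apply/has_symbol0; apply: (@order_lt_le 1%N) => //.
  by exists d; rewrite mul1r subrr.
by case: e0; rewrite -[e]mul1r (symbol_uniq H1 H2).
Qed.

End DiffOp.

Definition iota_op (D : comNzRingType) (B : nzRingType) (iota : {rmorphism D -> B}) :
  D -> B^c := iota.

Section Opposite.
Variables (D : comNzRingType) (B : nzRingType) (iota : {rmorphism D -> B}).
Fact iota_op_additive : zmod_morphism (iota_op iota).
Proof. by move=> a b; apply: (rmorphB iota). Qed.
HB.instance Definition _ := GRing.isZmodMorphism.Build D B^c (iota_op iota)
  iota_op_additive.
Fact iota_op_multiplicative : monoid_morphism (iota_op iota).
Proof. by split=> [|a b]; [apply: (rmorph1 iota)|rewrite mulrC; apply: (rmorphM iota)]. Qed.
HB.instance Definition _ := GRing.isMonoidMorphism.Build D B^c (iota_op iota)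
  iota_op_multiplicative.

(** The opposite ring is again a differential operator ring, for [- y]. *)
Lemma diffop_left_ore (del : D -> D) (y : B) (g : D) :
  injective iota ->
  (forall d e : D, d * e = 0 -> d = 0 \/ e = 0) ->
  (forall n (d : D), d *+ n.+1 = 0 -> d = 0) ->
  del g <> 0 ->
  (forall d, y * iota d = iota d * y + iota (del d)) ->
  (forall S : set B, (forall d, S (iota d)) -> S y ->
    (forall a b, S a -> S b -> S (a + b)) ->
    (forall a b, S a -> S b -> S (a * b)) -> forall b, S b) ->
  left_ore B.
Proof.
move=> inj dom ch dg yc gen a s s0.
have [d|S Sd Sy SD SM b|b [t [t0 E]]] := @diffop_right_ore D B^c (iota_op iota)
  del (- y) g inj dom ch dg _ _ a s s0.
- rewrite /GRing.mul /= /iota_op mulrN mulNr yc.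
  by rewrite opprD subrK.
- apply: (gen S) => // [|c d Sc Sd']; last exact: SM.
  by have := SM _ _ Sy (Sd (-1)); rewrite /GRing.mul /= /iota_op rmorphN rmorph1 mulrNN mul1r.
by exists b, t.
Qed.
End Opposite.

(** * Algebras generated by g, x and y *)

Structure uGens (K : closedFieldType) (lam : K) (B : algType K) := UGens {
  u_g : B; u_gi : B; u_x : B; u_y : B;
  u_ggi : u_g * u_gi = 1;
  u_gig : u_gi * u_g = 1;
  u_gx : u_g * u_x = u_x * u_g;
  u_yg : u_y * u_g = u_g * u_y - u_x * u_g;
  u_yx : u_y * u_x - u_x * u_y =
         - (2^-1 : K) *: u_x ^+ 2 + lam *: (1 - u_g ^+ 2);
  u_gen : forall S : set B, (forall c : K, S c%:A) ->
    S u_g -> S u_gi -> S u_x -> S u_y ->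
    (forall a b, S a -> S b -> S (a + b)) ->
    (forall a b, S a -> S b -> S (a * b)) -> forall b, S b }.

Section Curve.
Variables (K : closedFieldType) (lam : K) (B : algType K) (u : uGens lam B).
Local Notation g := (u_g u).
Local Notation gi := (u_gi u).
Local Notation x := (u_x u).
Local Notation y := (u_y u).

(** The commutative subalgebra of differential operators of order 0. *)
Inductive curve_mem : B -> Prop :=
| CurveScalar c : curve_mem c%:A
| CurveG : curve_mem g
| CurveGi : curve_mem gi
| CurveX : curve_mem x
| CurveD a b : curve_mem a -> curve_mem b -> curve_mem (a + b)
| CurveM a b : curve_mem a -> curve_mem b -> curve_mem (a * b).

Lemma curve_mem_comm a b : curve_mem a -> curve_mem b -> a * b = b * a.
Proof.
have comm_ind c : c * g = g * c -> c * gi = gi * c -> c * x = x * c ->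
    forall b, curve_mem b -> c * b = b * c.
  move=> cg cgi cx ?; elim=> // [k|d e _ IHd _ IHe|d e _ IHd _ IHe].
  - by rewrite -scalerAl -scalerAr mul1r mulr1.
  - by rewrite mulrDr mulrDl IHd IHe.
  - by rewrite mulrA IHd -mulrA IHe mulrA.
have gix : gi * x = x * gi.
  by rewrite -[x in LHS]mulr1 -(u_ggi u) (mulrA x) -u_gx !mulrA u_gig mul1r.
have gig : gi * g = g * gi by rewrite u_ggi u_gig.
move=> Ha Hb; elim: Ha => [k||||d e _ IHd _ IHe|d e _ IHd _ IHe].
- by rewrite -scalerAl -scalerAr mul1r mulr1.
- by apply: comm_ind Hb => //; apply: u_gx.
- by apply: comm_ind Hb.
- by apply: comm_ind Hb; rewrite ?u_gx.
- by rewrite mulrDr mulrDl IHd IHe.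
- by rewrite -mulrA IHe mulrA IHd -mulrA.
Qed.

Definition in_curve : {pred B} := fun b => `[< curve_mem b >].
Lemma in_curveP b : reflect (curve_mem b) (b \in in_curve).
Proof. exact: asboolP. Qed.

Fact in_curve_subalg : subalg_closed in_curve.
Proof.
split.
- by apply/in_curveP; rewrite -(scale1r 1); apply: CurveScalar.
- move=> c a b /in_curveP Ha /in_curveP Hb; apply/in_curveP.
  by rewrite -mulr_algl; apply: CurveD => //; apply: CurveM => //; apply: CurveScalar.
- by move=> a b /in_curveP Ha /in_curveP Hb; apply/in_curveP; apply: CurveM.
Qed.
HB.instance Definition _ := GRing.isSubalgClosed.Build K B in_curve in_curve_subalg.

Definition curve_sub : Type := {b : B | b \in in_curve}.
HB.instance Definition _ := [isSub of curve_sub for sval].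
HB.instance Definition _ := [Choice of curve_sub by <:].
HB.instance Definition _ := [SubChoice_isSubAlgebra of curve_sub by <:].
Fact curve_sub_mulC : commutative (@GRing.mul curve_sub).
Proof.
move=> a b; apply: val_inj; rewrite !rmorphM /=.
by apply: curve_mem_comm; apply/in_curveP; apply: valP.
Qed.
HB.instance Definition _ := GRing.PzRing_hasCommutativeMul.Build curve_sub curve_sub_mulC.

Definition cval (d : curve_sub) : B := val d.
Fact cval_additive : zmod_morphism cval. Proof. by move=> a b; apply: (rmorphB val). Qed.
HB.instance Definition _ := GRing.isZmodMorphism.Build curve_sub B cval cval_additive.
Fact cval_multiplicative : monoid_morphism cval.
Proof. by split=> [|a b]; [apply: (rmorph1 val)|apply: (rmorphM val)]. Qed.
HB.instance Definition _ := GRing.isMonoidMorphism.Build curve_sub B cval cval_multiplicative.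
Fact cval_scalable : scalable cval. Proof. by move=> c a; apply: GRing.valZ. Qed.
HB.instance Definition _ := GRing.isScalable.Build K curve_sub B *:%R cval cval_scalable.

Lemma cvalZ (c : K) d : cval (c *: d) = c *: cval d.
Proof. exact: GRing.valZ. Qed.

Lemma cvalA (c : K) : cval c%:A = c%:A.
Proof. by rewrite cvalZ rmorph1. Qed.

Lemma cvalD d e : cval (d + e) = cval d + cval e. Proof. exact: rmorphD. Qed.
Lemma cvalB d e : cval (d - e) = cval d - cval e. Proof. exact: rmorphB. Qed.
Lemma cvalM d e : cval (d * e) = cval d * cval e. Proof. exact: rmorphM. Qed.

Lemma cval_inj : injective cval. Proof. exact: val_inj. Qed.

(** Commutators of [y] with the generators stay in the subalgebra; for the inverse
    of [g], [y gi - gi y = gi x]. *)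
Lemma curve_mem_der a : curve_mem a -> curve_mem (y * a - a * y).
Proof.
have curve0 : curve_mem 0 by rewrite -(scale0r 1); apply: CurveScalar.
have curveN c : curve_mem c -> curve_mem (- c).
  by move=> Hc; rewrite -mulN1r -scaleN1r; apply: CurveM => //; apply: CurveScalar.
have Cg := CurveG; have Cgi := CurveGi; have Cx := CurveX.
elim=> [c||||d e Hd IHd He IHe|d e Hd IHd He IHe].
- by rewrite -scalerAl -scalerAr mul1r mulr1 subrr.
- by rewrite u_yg addrAC subrr add0r; apply/curveN/CurveM.
- have -> : y * gi - gi * y = gi * x.
    have -> : y * gi = gi * (g * y) * gi by rewrite mulrA u_gig mul1r.
    have -> : g * y = y * g + x * g by rewrite u_yg subrK.
    rewrite mulrDr mulrDl !mulrA -!(mulrA _ g gi) u_ggi !mulr1.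
    by rewrite addrAC subrr add0r.
  exact: CurveM.
- rewrite u_yx; apply: CurveD.
    rewrite scaleNr; apply/curveN; rewrite -mulr_algl expr2.
    by apply: CurveM; [apply: CurveScalar|apply: CurveM].
  rewrite -mulr_algl; apply: CurveM; first exact: CurveScalar.
  apply: CurveD; first by rewrite -(scale1r 1); apply: CurveScalar.
  by apply/curveN; rewrite expr2; apply: CurveM.
- by rewrite mulrDr mulrDl opprD addrACA; apply: CurveD.
have -> : y * (d * e) - d * e * y = (y * d - d * y) * e + d * (y * e - e * y).
  by rewrite mulrBl mulrBr !mulrA addrA subrK.
by apply: CurveD; apply: CurveM.
Qed.

Fact curve_der_subproof (d : curve_sub) : y * cval d - cval d * y \in in_curve.
Proof. by apply/in_curveP/curve_mem_der/in_curveP; apply: valP. Qed.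

Definition curve_der (d : curve_sub) : curve_sub :=
  exist (fun b => b \in in_curve) _ (curve_der_subproof d).

Lemma cval_der d : cval (curve_der d) = y * cval d - cval d * y.
Proof. by []. Qed.

Lemma cval_comm d : y * cval d = cval d * y + cval (curve_der d).
Proof. by rewrite cval_der addrC subrK. Qed.

Definition curve_elt b (Hb : curve_mem b) : curve_sub :=
  exist (fun b => b \in in_curve) b (introT (in_curveP b) Hb).

Lemma cval_elt b Hb : cval (@curve_elt b Hb) = b.
Proof. by []. Qed.

Local Notation cg := (curve_elt CurveG).
Local Notation cgi := (curve_elt CurveGi).
Local Notation cx := (curve_elt CurveX).

Fact curve_derD : {morph curve_der : a b / a + b}.
Proof.
move=> a b; apply: cval_inj; rewrite raddfD /= !cval_der raddfD /=.
by rewrite mulrDr mulrDl opprD addrACA.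
Qed.

Fact curve_derM a b : curve_der (a * b) = curve_der a * b + a * curve_der b.
Proof.
apply: cval_inj; rewrite raddfD /= !(rmorphM cval) !cval_der (rmorphM cval).
by rewrite mulrBl mulrBr !mulrA addrA subrK.
Qed.

Fact curve_derK (c : K) : curve_der c%:A = 0.
Proof.
apply: cval_inj; rewrite raddf0 cval_der cvalZ rmorph1.
by rewrite -scalerAl -scalerAr mul1r mulr1 subrr.
Qed.

Fact curve_ggi : cg * cgi = 1.
Proof. by apply: cval_inj; rewrite rmorphM rmorph1 /= !cval_elt u_ggi. Qed.

Fact curve_delg : curve_der cg = - (cx * cg).
Proof.
apply: cval_inj; rewrite (rmorphN cval) (rmorphM cval) /= cval_der !cval_elt u_yg.
by rewrite addrAC subrr add0r.
Qed.

Fact curve_delx :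
  curve_der cx = - ((2^-1 : K)%:A * cx ^+ 2) + lam%:A * (1 - cg ^+ 2) :> curve_sub.
Proof.
apply: cval_inj; rewrite cval_der (rmorphD cval) (rmorphN cval).
rewrite (rmorphM cval _%:A (_ ^+ 2)) (rmorphM cval lam%:A) /= !cvalA !mulr_algl.
rewrite (rmorphXn cval) (rmorphB cval) (rmorphXn cval) (rmorph1 cval) /= !cval_elt.
by rewrite u_yx scaleNr.
Qed.

Fact curve_gen (S : set curve_sub) : (forall c : K, S c%:A) ->
    S cg -> S cgi -> S cx ->
    (forall a b, S a -> S b -> S (a + b)) ->
    (forall a b, S a -> S b -> S (a * b)) -> forall d, S d.
Proof.
move=> SK Sg Sgi Sx SD SM d.
suff H b : curve_mem b -> exists2 e, S e & cval e = b.
  have /in_curveP/H[e Se E] := valP d.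
  by rewrite -(cval_inj E).
elim=> [c||||a c _ [d1 S1 <-] _ [d2 S2 <-]|a c _ [d1 S1 <-] _ [d2 S2 <-]].
- by exists c%:A => //; rewrite cvalA.
- by exists cg => //; rewrite cval_elt.
- by exists cgi => //; rewrite cval_elt.
- by exists cx => //; rewrite cval_elt.
- by exists (d1 + d2); [apply: SD|rewrite rmorphD].
- by exists (d1 * d2); [apply: SM|rewrite rmorphM].
Qed.

Lemma curve_gen_y (S : set B) : (forall d, S (cval d)) -> S y ->
  (forall a b, S a -> S b -> S (a + b)) ->
  (forall a b, S a -> S b -> S (a * b)) -> forall b, S b.
Proof.
move=> Sd Sy SD SM; apply: (u_gen (u := u)) => //.
- by move=> c; have := Sd c%:A; rewrite cvalA.
- by have := Sd cg; rewrite cval_elt.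
- by have := Sd cgi; rewrite cval_elt.
- by have := Sd cx; rewrite cval_elt.
Qed.

Hypothesis primeB : prime_ring B.

(** Moving [d] across [y ^ k] produces the iterated derivatives of [d]. *)
Fact curve_prime (d e : curve_sub) :
  (forall j, iter j curve_der d * e = 0) -> d = 0 \/ e = 0.
Proof.
move=> de.
have H k : forall d' e', (forall j, iter j curve_der d' * e' = 0) ->
    cval d' * y ^+ k * cval e' = 0.
  elim: k => [|k IHk] d' e' de'.
    by rewrite mulr1 -rmorphM /= (de' 0%N) rmorph0.
  have -> : cval d' * y ^+ k.+1 = y * (cval d' * y ^+ k) - cval (curve_der d') * y ^+ k.
    by rewrite exprS mulrA mulrA cval_comm mulrDl addrK.
  rewrite mulrBl -(mulrA y) IHk // mulr0 IHk ?subrr // => j.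
  by rewrite -iterSr; apply: de'.
have [|E|E] := @primeB (cval d) (cval e); last 2 first.
- by left; apply: cval_inj; rewrite E rmorph0.
- by right; apply: cval_inj; rewrite E rmorph0.
move=> r; have [n] := @order_lt_ex curve_sub B cval curve_der y cval_comm curve_gen_y r.
elim: n r => [r ->|n IHn r [c Hc]]; first by rewrite mulr0 mul0r.
rewrite -[r](subrK (y ^+ n * cval c)) mulrDr mulrDl IHn // add0r.
rewrite mulrA -mulrA -rmorphM; apply: H => j.
by rewrite mulrCA de mulr0.
Qed.

Definition curve_diff : diffCurve lam :=
  @DiffCurve K lam curve_sub curve_der cg cgi cx curve_derD curve_derM
    curve_derK curve_ggi curve_delg curve_delx curve_gen curve_prime.

End Curve.
Section Image.
Variables (K : closedFieldType) (lam : K) (A B : algType K) (u : uGens lam A).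
Variable f : {lrmorphism A -> B}.
Hypothesis f_surj : forall b, exists a, f a = b.

Lemma uGens_image : exists v : uGens lam B,
  u_g v = f (u_g u) /\ u_x v = f (u_x u).
Proof.
unshelve eexists; first (exists (f (u_g u)) (f (u_gi u)) (f (u_x u)) (f (u_y u))).
- by rewrite -rmorphM u_ggi rmorph1.
- by rewrite -rmorphM u_gig rmorph1.
- by rewrite -!rmorphM u_gx.
- by rewrite -!rmorphM -rmorphB u_yg.
- rewrite -!rmorphM -rmorphB u_yx rmorphD /= !linearZ /= rmorphXn rmorphB rmorph1.
  by rewrite rmorphXn.
- move=> S SK Sg Sgi Sx Sy SD SM b; have [a <-] := f_surj b.
  apply: (u_gen (u := u) (S := [set a | S (f a)])) => //=.
  + by move=> c; rewrite rmorph_alg.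
  + by move=> d e; rewrite rmorphD; apply: SD.
  + by move=> d e; rewrite rmorphM; apply: SM.
by [].
Qed.

End Image.

Lemma quot_surj (K : comNzRingType) (A : algType K) (P : properIdeal A) b :
  exists a, quot_map P a = b.
Proof. by exists (repr b); rewrite quot_reprK. Qed.

Lemma rmorph_horner_alg (K : fieldType) (A B : algType K) (f : {lrmorphism A -> B})
  (a : A) (p : {poly K}) : f (horner_alg a p) = horner_alg (f a) p.
Proof.
elim/poly_ind: p => [|p c IHp]; first by rewrite !rmorph0.
rewrite !rmorphD !rmorphM /= !horner_algX !horner_algC IHp.
by rewrite rmorph_alg.
Qed.

(** * Prime algebras in which x is not zero *)

Section PrimeU.
Variables (K : closedFieldType) (hchar : [pchar K] =i pred0) (lam : K).
Variables (B : algType K) (u : uGens lam B) (primeB : prime_ring B).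
Local Notation D := (curve_diff u primeB).
Local Notation iota := (@cval K lam B u).
Local Notation y := (u_y u).
Local Notation g := (@dc_g K lam D).
Local Notation x := (@dc_x K lam D).
Local Notation z := (dc_z D).
Local Notation del := (@dc_del K lam D).
Hypothesis x0 : u_x u <> 0.

Lemma curve_x_neq0 : x <> 0.
Proof. by move=> E; apply: x0; have := congr1 iota E; rewrite rmorph0. Qed.

Lemma z_central b : iota z * b = b * iota z.
Proof.
apply: (curve_gen_y (u := u) (S := [set b | iota z * b = b * iota z])) => /=.
- by move=> d; rewrite -!rmorphM mulrC.
- by rewrite cval_comm -[curve_der z]/(del z) dc_delz // rmorph0 addr0.
- by move=> a c Ha Hc; rewrite mulrDl mulrDr Ha Hc.
- by move=> a c Ha Hc; rewrite mulrA Ha -mulrA Hc mulrA.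
Qed.

Lemma curve_char0 n (d : D) : d *+ n.+1 = 0 -> d = 0.
Proof. exact: alg_natr_eq0. Qed.

Section WithForm.
Variables (S : idomainType) (sig : {rmorphism S -> D}).
Variables (ii : {rmorphism K -> S}) (zeta : S).
Hypothesis cf : curve_form sig ii zeta.
Local Notation E := (evalg sig).

Let dom := dc_domain hchar curve_x_neq0 cf.
Let dg0 := @dc_delg_neq0 _ _ D curve_x_neq0.
Let ycomm := @cval_comm _ _ _ u.
Let genB := @curve_gen_y _ _ _ u.
Let cinj := @cval_inj _ _ _ u.

Lemma primeU_domain : domain B.
Proof. exact: (diffop_domain cinj dom curve_char0 dg0 ycomm genB). Qed.

Lemma primeU_right_ore : right_ore B.
Proof. exact: (diffop_right_ore cinj dom curve_char0 dg0 ycomm genB). Qed.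

Lemma primeU_left_ore : left_ore B.
Proof. exact: (diffop_left_ore cinj dom curve_char0 dg0 ycomm genB). Qed.

Lemma primeU_centraliser b : b * iota g = iota g * b -> exists d, b = iota d.
Proof. exact: (diffop_centraliser cinj dom curve_char0 dg0 ycomm genB). Qed.

Lemma primeU_ideal b : b <> 0 ->
  exists2 h, h <> 0 & forall I : set B, two_sided_ideal I -> I b -> I (iota (E h)).
Proof.
move=> /(diffop_ideal dom curve_char0 dg0 ycomm genB)[d d0 Hd].
have [d' [h [h0 Eh]]] := dc_norm cf d0.
by exists h => // I iI Ib; rewrite -Eh rmorphM; apply: ideal_mulr => //; apply: Hd.
Qed.

(** A multiple [h(z, g)] of [b] is nonzero at some point [(c, a)]. The left ideal
    generated by [z - c] and [g - a] is proper and acts on the vector it kills as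
    evaluation at this point, so that [h], hence [b], does not annihilate the
    simple module. *)
Lemma primeU_point_module b : b <> 0 ->
  exists (M : lmodType B) (c : K),
    [/\ simple_module M, ~ annihilator M b & annihilator M (iota z - c%:A)].
Proof.
move=> b0; have [h h0 Hh] := primeU_ideal b0.
have [phi [a [phiK a0 ha0 phis]]] := dc_point_exists cf h0.
pose c := phi zeta.
pose J : set B^o := [set b | exists b1 b2, b = b1 * (iota z - c%:A) + b2 * (iota g - a%:A)].
have JE d : iota (d * (z - c%:A)) = iota d * (iota z - c%:A).
  by rewrite rmorphM rmorphB /= cvalA.
have JE' d : iota (d * (g - a%:A)) = iota d * (iota g - a%:A).
  by rewrite rmorphM rmorphB /= cvalA.
have JEE d e : iota (d * (z - c%:A) + e * (g - a%:A)) =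
    iota d * (iota z - c%:A) + iota e * (iota g - a%:A).
  by rewrite -JE -JE' -rmorphD.
have sJ : submodule J.
  split.
  - by exists 0, 0; rewrite !mul0r addr0.
  - move=> _ _ [b1 [b2 ->]] [b3 [b4 ->]]; exists (b1 + b3), (b2 + b4).
    by rewrite !mulrDl addrACA.
  - move=> e _ [b1 [b2 ->]]; exists (e * b1), (e * b2).
    by rewrite /GRing.scale /= mulrDr !mulrA.
have J1 : ~ J 1.
  move=> [b1 [b2 E1]].
  have [d1 [b1' E_1]] := order_const_coef ycomm genB b1.
  have [d2 [b2' E_2]] := order_const_coef ycomm genB b2.
  apply: (@dc_point_proper _ _ _ hchar curve_x_neq0 _ _ _ _ cf phi a d1 d2 phiK a0).
  apply/esym/eqP; rewrite -subr_eq0; apply/eqP.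
  apply: (iota_eq_yM cinj dom curve_char0 dg0 ycomm genB
    (b := b1' * (iota z - c%:A) + b2' * (iota g - a%:A))).
  transitivity (1 - iota (d1 * (z - c%:A) + d2 * (g - a%:A))).
    by rewrite rmorphB rmorph1.
  rewrite JEE [X in X - _]E1 E_1 E_2.
  rewrite (mulrDl (iota d1)) (mulrDl (iota d2)) (mulrDr y) !mulrA.
  by rewrite addrACA addrC addrK.
have [M [m [sM m0 Jm]]] := simple_module_killed sJ J1.
exists M, c; split=> //.
  move=> Mb; have := Hh _ (annihilator_ideal M) Mb m.
  have [d1 [d2 ->]] := evalg_at_point a h phis.
  rewrite cvalD cvalA JEE scalerDl (Jm (_ + _)); last first.
    by exists (iota d1), (iota d2).
  rewrite addr0 => E0; apply: m0.
  have kk : ((map_poly phi h).[a]^-1)%:A * (map_poly phi h).[a]%:A = 1 :> B.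
    by rewrite mulr_algl scalerA mulVf ?scale1r //; apply/eqP.
  by rewrite -[m]scale1r -kk -scalerA E0 scaler0.
move=> v; have [e ->] := simple_cyclic v sM m0.
have zc : (iota z - c%:A) * e = e * (iota z - c%:A).
  by rewrite mulrBl mulrBr z_central -scalerAl -scalerAr mul1r mulr1.
rewrite scalerA zc -scalerA Jm ?scaler0 //.
by exists 1, 0; rewrite mul1r mul0r addr0.
Qed.

End WithForm.
End PrimeU.

(** * Scalar central value *)

Section AlgebraicCase.
Variables (K : closedFieldType) (hchar : [pchar K] =i pred0) (lam : K).
Variables (B : algType K) (u : uGens lam B) (primeB : prime_ring B).
Local Notation D := (curve_diff u primeB).
Local Notation iota := (@cval K lam B u).
Local Notation g := (@dc_g K lam D).
Local Notation x := (@dc_x K lam D).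
Local Notation z := (dc_z D).
Hypothesis x0 : u_x u <> 0.
Variable c : K.
Hypothesis zc : z = c%:A.

Let xD0 := curve_x_neq0 x0 (primeB := primeB).
Let cf := curve_form_algebraic hchar xD0 zc.

(** A nonzero prime contains some [h(g)] with [h <> 0]; modulo this prime [g] is
    algebraic, which forces [x] to vanish there. *)
Lemma algebraic_prime_x (Q : set B) :
  prime_ideal Q -> (exists2 q, Q q & q <> 0) -> Q (u_x u).
Proof.
move=> pQ [q Qq q0]; have [iQ Q1 _] := (prime_idealP Q).1 pQ.
have [h h0 Hh] := primeU_ideal hchar x0 cf q0.
have {Hh} Qh := Hh _ iQ Qq.
pose P := ProperIdeal iQ Q1.
have [v [vg vx]] := uGens_image u (quot_surj (P := P)).
have primeP : prime_ring (quot_alg P) by apply: quot_prime.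
have [x0'|/eqP x1] := eqVneq (u_x v) 0.
  by apply/(quot_map_eq0 P); rewrite -vx.
case: (x1); pose D' := curve_diff v primeP.
suff : dc_x D' = 0 by move=> E; have := congr1 (@cval _ _ _ v) E; rewrite rmorph0.
apply: (@dc_g_algebraic _ hchar _ D' (map_poly (in_alg D') h)).
- by move=> i; rewrite coef_map; apply: dc_delK.
- apply: (@cval_inj _ _ _ v); rewrite rmorph0.
  rewrite -[(map_poly _ _).[_]]/(horner_alg (dc_g D') h).
  rewrite (rmorph_horner_alg (@cval _ _ _ v)) /=.
  rewrite -[cval _]/(u_g v) vg -(rmorph_horner_alg (quot_map P)).
  apply/(quot_map_eq0 P) => /=; rewrite -[u_g u]/(iota g).
  by rewrite -(rmorph_horner_alg iota).
by rewrite lead_coef_map => /eqP; rewrite fmorph_eq0 lead_coef_eq0 => /eqP.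
Qed.

Lemma algebraic_loc_closed : loc_closed0 B.
Proof. by exists (u_x u) => // Q; apply: algebraic_prime_x. Qed.

(** In the point module avoiding [x] the annihilator cannot be nonzero. *)
Lemma algebraic_faithful : faithful_simple B.
Proof.
have [M [a [sM Mx _]]] := primeU_point_module hchar x0 cf x0.
exists M; split=> // b Mb; apply: contrapT => b0; apply: Mx.
by apply: algebraic_prime_x; [apply: annihilator_prime|exists b].
Qed.

End AlgebraicCase.

(** * The centre of the quotient ring *)

Section Rational.
Variables (K : closedFieldType) (hchar : [pchar K] =i pred0) (lam : K).
Variables (B : algType K) (u : uGens lam B) (primeB : prime_ring B).
Local Notation D := (curve_diff u primeB).
Local Notation iota := (@cval K lam B u).
Local Notation y := (u_y u).
Local Notation g := (@dc_g K lam D).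
Local Notation x := (@dc_x K lam D).
Local Notation z := (dc_z D).
Hypothesis x0 : u_x u <> 0.
Variable c : K.
Hypothesis zc : z = c%:A.

Let xD0 := curve_x_neq0 x0 (primeB := primeB).
Let cf := curve_form_algebraic hchar xD0 zc.
Let Bdom := primeU_domain hchar x0 cf.
Let O := OreDomain Bdom (primeU_right_ore hchar x0 cf).
Local Notation Q := (ore_frac O).
Local Notation j := (@ore_inj K O).
Local Notation E := (evalg (in_alg D)).

Lemma frac_mul_eq0 (p q : Q) : p * q = 0 -> p = 0 \/ q = 0.
Proof.
move=> pq; have [->|p0] := eqVneq p 0; [by left|right].
have pU : p \is a GRing.unit by [].
by rewrite -[q]mul1r -(mulVr pU) -mulrA pq mulr0.
Qed.

Lemma frac_curve_comm d e : j (iota d) * j (iota e) = j (iota e) * j (iota d).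
Proof.
have de : iota d * iota e = iota e * iota d by rewrite -!cvalM mulrC.
by rewrite -!(rmorphM j); congr (j _).
Qed.

Lemma frac_curveM d e : j (iota (d * e)) = j (iota d) * j (iota e).
Proof. by rewrite cvalM; apply: (rmorphM j). Qed.

Lemma frac_curveD d e : j (iota (d + e)) = j (iota d) + j (iota e).
Proof. by rewrite cvalD; apply: (rmorphD j). Qed.

Lemma frac_curve0 : j (iota 0) = 0.
Proof. by rewrite (rmorph0 iota); apply: (rmorph0 j). Qed.

Lemma frac_curveA k : j (iota k%:A) = k%:A.
Proof. by rewrite cvalA; apply: (rmorph_alg j). Qed.

(** The denominators of a central fraction form a two-sided ideal, which contains
    some [h(g)]; the corresponding numerator commutes with [g], hence has order
    0. *)
Lemma central_frac_num (q : Q) : central_elt q ->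
  exists h v w, h <> 0 /\ j (iota (E h)) * q = j (iota (E v + E w * x)).
Proof.
move=> qC; pose I : set B := [set b | exists b', j b * q = j b'].
have iI : two_sided_ideal I.
  split=> [|a b [a' Ea] [b' Eb]|a b d [b' Eb]].
  - by exists 0; rewrite !rmorph0 mul0r.
  - by exists (a' - b'); rewrite !rmorphB mulrBl Ea Eb.
  - exists (a * b' * d); rewrite !rmorphM -mulrA -(qC (j d)) mulrA -(mulrA (j a)).
    by rewrite Eb.
have [s s0 Is] : exists2 s, s <> 0 & I s.
  have [a [s [s0 qE]]] := fracP q; exists s => //; exists a.
  rewrite -qC qE /= /ore_inj -[s in X in _ * X]mulr1 fracM ?mulr1 //.
  exact: ore1_neq0.
have [h h0 Hh] := primeU_ideal hchar x0 cf s0.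
have [b Eb] := Hh _ iI Is.
have [d bd] : exists d, b = iota d.
  apply: (primeU_centraliser hchar x0 cf); apply/eqP; rewrite -subr_eq0; apply/eqP.
  apply/(@ore_inj_eq0 K O); rewrite rmorphB !rmorphM /= -Eb.
  by rewrite -mulrA qC !mulrA frac_curve_comm subrr.
have [n [v [w E1]]] := evalg_full (sig := in_alg D) (iota := idfun) (zeta := c)
  (fun=> erefl) (esym zc) d.
exists ('X^n * h), v, w; split.
  by move=> /eqP; rewrite mulf_eq0 expf_eq0 polyX_eq0 andbF /= => /eqP.
rewrite -E1 (rmorphM E) rmorphXn /= evalgX !frac_curveM -bd -Eb.
by rewrite mulrA.
Qed.

(** If [q = (v + w x) / h] then [(h q - v) ^ 2 = w ^ 2 x ^ 2] is a relation between
    [g] and [q]. Were [q] transcendental, this would make [g] algebraic over the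
    constants [K[q]] of the inner derivation of [y], whose value at [g] is not
    nilpotent. *)
Lemma central_frac_algebraic (q : Q) : central_elt q ->
  exists2 p : {poly K}, p != 0 & root (map_poly (in_alg Q) p) q.
Proof.
move=> qC; apply: contrapT => nq.
have inj p : horner_alg q p = 0 -> p = 0.
  move=> pq; apply/eqP/negPn/negP => p0; apply: nq; exists p => //.
  by apply/rootP.
have qpC p : central_elt (horner_alg q p : Q).
  move=> b; elim/poly_ind: p => [|p k IHp]; first by rewrite rmorph0 mul0r mulr0.
  rewrite rmorphD rmorphM /= horner_algX horner_algC mulrDl mulrDr; congr (_ + _).
    by rewrite -mulrA qC mulrA IHp mulrA.
  by rewrite -scalerAl -scalerAr mul1r mulr1.
have cfu : commr_rmorph (horner_alg q) (j (iota g)) by move=> p; apply/esym/qpC.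
pose ev : {rmorphism {poly {poly K}} -> Q} := horner_morph cfu.
have [h [v [w [h0 Eq]]]] := central_frac_num qC.
have evX : ev 'X = j (iota g) by rewrite /ev /= horner_morphX.
have evC p : ev p%:P = horner_alg q p by rewrite /ev /= horner_morphC.
have evE p : ev (map_poly polyC p) = j (iota (E p)).
  elim/poly_ind: p => [|p k IHp]; first by rewrite (rmorph0 E) frac_curve0 !rmorph0.
  rewrite (rmorphD E) (rmorphM E) frac_curveD frac_curveM rmorphD rmorphM.
  rewrite (rmorphD ev) (rmorphM ev) /= map_polyX map_polyC /= evX evC IHp.
  by rewrite horner_algC evalgX evalgC frac_curveA.
pose G : {poly {poly K}} := (map_poly polyC h * ('X)%:P - map_poly polyC v) ^+ 2 -
   map_poly polyC (w ^+ 2 * quad c lam).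
have G0 : ev G = 0.
  have H1 : ev (map_poly polyC h * ('X)%:P - map_poly polyC v) = j (iota (E w * x)).
    rewrite rmorphB rmorphM /= evC !evE horner_algX Eq frac_curveD.
    by rewrite addrC addKr.
  rewrite /G rmorphB rmorphXn H1 evE (rmorphM E (w ^+ 2)) rmorphXn /=.
  rewrite (@evalg_quad _ _ _ _ _ idfun) //= -(rmorphXn j) -(rmorphXn iota) exprMn.
  exact: subrr.
have Gn0 : G != 0.
  apply/eqP => GE; have := congr1 (fun p => size (swapXY p)) GE.
  (* Seen as a polynomial in the variable for [q], [G] has degree 2. *)
  rewrite rmorph0 size_poly0 /G rmorphB rmorphXn rmorphB rmorphM /=.
  rewrite !swapXY_map_polyC swapXY_Y.
  have h0' : h != 0 by apply/eqP.
  have s2 : size (h%:P * 'X - v%:P) = 2%N.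
    by rewrite -polyCN size_MXaddC polyC_eq0 (negPf h0') /= size_polyC h0'.
  rewrite size_polyDl; last first.
    rewrite size_polyN (leq_ltn_trans (size_polyC_leq1 _)) //.
    by rewrite expr2 size_mul -?size_poly_gt0 s2.
  by rewrite expr2 size_mul -?size_poly_gt0 s2.
pose dQ (r : Q) := j y * r - r * j y.
have dQj (d : D) : dQ (j (iota d)) = j (iota (@dc_del _ _ D d)).
  rewrite cval_der; transitivity (j (y * iota d : O) - j (iota d * y : O)).
    by congr (_ - _); apply/esym/(rmorphM j).
  by apply/esym/(rmorphB j).
have jC d e : GRing.comm (j (iota d)) (j (iota e)).
  exact: frac_curve_comm.
have [||||||m Em] := @derivation_algebraic Q dQ _ _ (j (iota g)) _ _ (map_poly (horner_alg q) G).
- by move=> a b; rewrite /dQ mulrDr mulrDl opprD addrACA.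
- move=> a b; rewrite /dQ mulrBl mulrBr !mulrA addrA subrK //.
- by rewrite dQj; apply: jC.
- by rewrite !dQj; apply: jC.
- by move=> i; rewrite coef_map /dQ /= qpC subrr.
- exact: G0.
have linj : injective (horner_alg q) by apply: raddf_inj.
rewrite lead_coef_map_inj ?rmorph0 // in Em.
have [E1|E1] := frac_mul_eq0 Em.
  have /inj/eqP : horner_alg q (lead_coef G) = 0.
    by case: _`! (fact_gt0 (size (map_poly (horner_alg q) G)).-1) E1 => // k _; apply: alg_natr_eq0.
  by rewrite lead_coef_eq0 (negPf Gn0).
have : dQ (j (iota g)) = 0.
  elim: m E1 {Em} => [/eqP|m IHm]; first by rewrite oner_eq0.
  by rewrite exprS => /frac_mul_eq0[|/IHm].
rewrite dQj => /ore_inj_eq0 E2; apply: (@dc_delg_neq0 _ _ D xD0).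
by apply: (@cval_inj _ _ _ u); rewrite rmorph0.
Qed.

Lemma algebraic_rational : exists (Q : unitAlgType K) (f : {lrmorphism B -> Q}),
  goldie_quotient f /\ centre_algebraic_field Q.
Proof.
exists Q, (j : {lrmorphism O -> Q}); split.
  exact: (@ore_goldie_quotient K O (primeU_left_ore hchar x0 cf)).
move=> q qC; split; last exact: central_frac_algebraic.
by move=> q0; exact: q0.
Qed.

End Rational.

(** * Transcendental central value *)

Section TranscendentalCase.
Variables (K : closedFieldType) (hchar : [pchar K] =i pred0) (lam : K).
Variables (B : algType K) (u : uGens lam B) (primeB : prime_ring B).
Local Notation D := (curve_diff u primeB).
Local Notation iota := (@cval K lam B u).
Local Notation y := (u_y u).
Local Notation g := (@dc_g K lam D).
Local Notation x := (@dc_x K lam D).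
Local Notation z := (dc_z D).
Local Notation del := (@dc_del K lam D).
Hypothesis x0 : u_x u <> 0.
Hypothesis zinj : injective (horner_alg z).

Let xD0 := curve_x_neq0 x0 (primeB := primeB).
Let cf := curve_form_transcendental hchar zinj.
Local Notation sig := (horner_alg z).
Local Notation E := (evalg sig).

Lemma iota_eq0 (d : D) : iota d = 0 -> d = 0.
Proof. by move=> d0; apply: (@cval_inj _ _ _ u); rewrite rmorph0. Qed.

Lemma sig_eq0 p : sig p = 0 -> p = 0.
Proof. by rewrite -(rmorph0 sig) => /zinj. Qed.

Lemma z_neq_scalar (c : K) : iota z - c%:A <> 0.
Proof.
move=> zc; have : 'X - c%:P = 0 :> {poly K}.
  apply: sig_eq0; rewrite rmorphB /= horner_algX horner_algC.
  by apply: iota_eq0; rewrite cvalB cvalA.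
by move/eqP; rewrite polyXsubC_eq0.
Qed.

(** Every [b <> 0] is avoided by the annihilator of a point module, a prime that
    contains some [z - c]. *)
Lemma transcendental_not_loc_closed : ~ loc_closed0 B.
Proof.
move=> [b b0 Hb].
have [M [c [sM Mb Mz]]] := primeU_point_module hchar x0 cf b0.
apply: Mb; apply: Hb; first exact: annihilator_prime.
by exists (iota z - c%:A) => //; apply: z_neq_scalar.
Qed.

Lemma transcendental_not_rational :
  ~ exists (Q : unitAlgType K) (f : {lrmorphism B -> Q}),
      goldie_quotient f /\ centre_algebraic_field Q.
Proof.
move=> [Q [f [[finj funit fr _] cQ]]].
have zC : central_elt (f (iota z)).
  move=> q; have [a [s [rs ->]]] := fr q.
  rewrite mulrA -rmorphM z_central // rmorphM -!mulrA; congr (_ * _).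
  by apply: commrV; rewrite /GRing.comm -!rmorphM z_central.
have [_ [p p0 /rootP]] := cQ _ zC.
rewrite -[(map_poly _ _).[_]]/(horner_alg (f (iota z)) p) -rmorph_horner_alg.
rewrite -(rmorph_horner_alg iota) -(rmorph0 f) => /finj/iota_eq0/sig_eq0 pE.
by rewrite pE eqxx in p0.
Qed.

Section SimpleFaithful.
Variable M : lmodType B.
Hypothesis sM : simple_module M.
Hypothesis fM : forall b, annihilator M b -> b = 0.

Local Notation "d ** m" := (iota d *: m) (at level 40).

Lemma curve_scaleA d e (m : M) : (d * e) ** m = d ** (e ** m).
Proof. by rewrite cvalM scalerA. Qed.
Lemma curve_scaleC d e (m : M) : d ** (e ** m) = e ** (d ** m).
Proof. by rewrite -!curve_scaleA mulrC. Qed.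
Lemma curve_scaleD d e (m : M) : (d + e) ** m = d ** m + e ** m.
Proof. by rewrite cvalD scalerDl. Qed.
Lemma curve_scaleB d e (m : M) : (d - e) ** m = d ** m - e ** m.
Proof. by rewrite cvalB scalerBl. Qed.
Lemma curve_scale1 (m : M) : 1 ** m = m.
Proof. by rewrite rmorph1 scale1r. Qed.
Lemma curve_scale0 (m : M) : 0 ** m = 0.
Proof. by rewrite rmorph0 scale0r. Qed.

Lemma g_scale_inj (m : M) : g ** m = 0 -> m = 0.
Proof.
by move=> gm; rewrite -[m]curve_scale1 -(dc_ggi D) mulrC curve_scaleA gm scaler0.
Qed.

Lemma gX_scale_inj n (m : M) : g ^+ n ** m = 0 -> m = 0.
Proof.
elim: n m => [|n IHn] m; first by rewrite curve_scale1.
by rewrite exprS curve_scaleA => /g_scale_inj/IHn.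
Qed.

Lemma sig_central p b : iota (sig p) * b = b * iota (sig p).
Proof.
elim/poly_ind: p => [|p c IHp]; first by rewrite rmorph0 rmorph0 mul0r mulr0.
rewrite rmorphD rmorphM /= horner_algX horner_algC cvalD cvalM cvalA.
rewrite mulrDl mulrDr; congr (_ + _); first by rewrite -mulrA z_central // !mulrA IHp.
by rewrite -scalerAl -scalerAr mul1r mulr1.
Qed.

Lemma sig_scale_inj p (m : M) : sig p ** m = 0 -> p = 0 \/ m = 0.
Proof.
move=> pm; have [->|/eqP m0] := eqVneq m 0; [by right|left].
apply/sig_eq0/iota_eq0/fM => v; have [b ->] := simple_cyclic v sM m0.
by rewrite scalerA sig_central -scalerA pm scaler0.
Qed.

Lemma sig_scale_surj p (m : M) : p <> 0 -> exists v, sig p ** v = m.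
Proof.
move=> p0; have [_ sN] := sM.
have [|E0|ET] := sN [set v | exists w, v = sig p ** w].
- split=> [|_ _ [v ->] [w ->]|b _ [v ->]].
  + by exists 0; rewrite scaler0.
  + by exists (v + w); rewrite scalerDr.
  + by exists (b *: v); rewrite !scalerA sig_central.
- have [[w w0] _] := sM.
  have : [set v | exists w, v = sig p ** w] (sig p ** w) by exists w.
  by rewrite E0 => /= /sig_scale_inj[//|wE]; rewrite wE eqxx in w0.
by have : setT m by []; rewrite -ET => -[v ->]; exists v.
Qed.

Definition zc (c : K) : D := z - c%:A.
Lemma zcE c : zc c = sig ('X - c%:P).
Proof. by rewrite rmorphB /= horner_algX horner_algC. Qed.

Lemma zc_scale_inj c (m : M) : zc c ** m = 0 -> m = 0.
Proof. by rewrite zcE => /sig_scale_inj[/eqP|//]; rewrite polyXsubC_eq0. Qed.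

Lemma zc_scale_surj c (m : M) : exists v, zc c ** v = m.
Proof. by rewrite zcE; apply: sig_scale_surj; apply/eqP; rewrite polyXsubC_eq0. Qed.

Let Bdom := primeU_domain hchar x0 cf.
Let Ddom := dc_domain hchar xD0 cf.
Let dg0 := @dc_delg_neq0 _ _ D xD0.
Let ycomm := @cval_comm _ _ _ u.
Let genB := @curve_gen_y _ _ _ u.
Let cinj := @cval_inj _ _ _ u.
Let ch0 := @curve_char0 _ hchar _ _ u primeB.

(** At a point where a multiple [h(z, g)] of the element does not vanish, [z - c]
    and [g - a] would generate the unit ideal. *)
Lemma not_all_divisible (h : D) : h <> 0 ->
  ~ forall c, exists n r, zc c * r = h ^+ n.
Proof.
move=> h0 Hh; have [h' [H [H0 EH]]] := dc_norm cf h0.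
have [phi [a [phiK a0 Ha phis]]] := dc_point_exists cf H0.
have [n [r Er]] := Hh (phi 'X).
have [d1 [d2 Ed]] := evalg_at_point (zeta := 'X) a (H ^+ n) phis.
pose k := (map_poly phi (H ^+ n)).[a].
have k0 : k != 0.
  by rewrite /k rmorphXn horner_exp expf_neq0 //; apply/eqP.
have kk : (k^-1)%:A * k%:A = 1 :> D by rewrite mulr_algl scalerA mulVf // scale1r.
apply: (@dc_point_proper _ _ _ hchar xD0 _ _ _ _ cf phi a
  ((k^-1)%:A * (r * h' ^+ n - d1)) (- (k^-1)%:A * d2) phiK a0).
transitivity ((k^-1)%:A * (zc (phi 'X) * r * h' ^+ n
    - (d1 * (z - (phi 'X)%:A) + d2 * (g - a%:A)))); first by rewrite /zc; ring.
by rewrite Er -exprMn EH -rmorphXn /= Ed -/k addrK kk.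
Qed.

Lemma curve_of_zc c b d : iota (zc c) * b = iota d -> exists r : D, b = iota r /\ zc c * r = d.
Proof.
move=> Eb; have zn0 : iota (zc c) <> 0 by rewrite cvalB cvalA; apply: z_neq_scalar.
have [r br] : exists r, b = iota r.
  apply: (primeU_centraliser hchar x0 cf); apply/eqP; rewrite -subr_eq0; apply/eqP.
  have : iota (zc c) * (b * iota g - iota g * b) = 0; last by move/Bdom => -[].
  rewrite mulrBr !mulrA Eb zcE sig_central -[iota g * _ * b]mulrA -zcE Eb.
  by rewrite -!cvalM mulrC subrr.
exists r; split=> //; apply: cinj; by rewrite cvalM -br.
Qed.

(** Otherwise let [s] be of least order among the operators killing [m]. Solving
    [(z - c) a m = m] and reducing [a] modulo [s] leaves, by minimality, an
    equation [(z - c) r = e ^ k] in the curve, where [e] is the symbol of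
    [s]. *)
Lemma torsion_exists : exists (d : D) (m : M), [/\ d <> 0, m <> 0 & d ** m = 0].
Proof.
apply: contrapT => ntor; have [[m /eqP m0] _] := sM.
pose L b := b *: m = 0.
have div c : exists b, L (iota (zc c) * b - 1).
  have [v Ev] := zc_scale_surj c m; have [b bE] := simple_cyclic v sM m0.
  by exists b; rewrite /L scalerBl -scalerA -bE Ev scale1r subrr.
have [[b [b0 Lb]]|L0] := pselect (exists b, b <> 0 /\ L b); last first.
  apply: (@not_all_divisible 1); first exact/eqP/oner_neq0.
  move=> c; have [b Lb] := div c.
  have [|r [_ Er]] := @curve_of_zc c b 1; last by exists 0%N, r.
  apply/eqP; rewrite -subr_eq0; apply/eqP; apply: contrapT => nz.
  by apply: L0; exists (iota (zc c) * b - 1); rewrite rmorph1 in nz.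
have [n [s [e [e0 Ls Hs min]]]] : exists n s e, [/\ e <> 0, L s, has_symbol iota y n s e &
    forall k s' e', (k < n)%N -> L s' -> has_symbol iota y k s' e' -> e' = 0].
  have [n [e [e0 He]]] := symbol_ex ycomm genB b0.
  elim/ltn_ind: n => n IHn in b b0 Lb e e0 He *.
  have [[k [s' [e' [kn Ls' Hs' e'0]]]]|nmin] := pselect (exists k s' e',
      [/\ (k < n)%N, L s', has_symbol iota y k s' e' & e' <> 0]).
    apply: (IHn k kn s' _ Ls' e' e'0 Hs') => s'0; apply: e'0.
    by apply: (symbol0_eq0 cinj Ddom ch0 dg0 ycomm (n := k)); rewrite -s'0.
  exists n, b, e; split=> // k s' e' kn Ls' Hs'; apply: contrapT => e'0.
  by apply: nmin; exists k, s', e'.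
have min0 s' : L s' -> order_lt iota y n s' -> s' = 0.
  move=> Ls' /order_lt_symbol[//|[k [e' [kn e'0 He']]]].
  by case: e'0; apply: min He'.
case: n => [|n] in Hs min min0 *.
  move: Hs; rewrite /has_symbol /= mul1r => /eqP; rewrite subr_eq0 => /eqP sE.
  by apply: ntor; exists e, m; split=> //; rewrite -sE.
apply: (not_all_divisible e0) => c; have [a La] := div c.
have [N Ha] := order_lt_ex ycomm genB a.
have [w [k Hr]] := pseudo_division_left ycomm Hs Ha.
set r := _ - _ in Hr.
have [|r' [_ Er']] := @curve_of_zc c r (e ^+ k); last by exists k, r'.
apply/eqP; rewrite -subr_eq0; apply/eqP; apply: min0.
  have -> : iota (zc c) * r - iota (e ^+ k) =
     iota (e ^+ k) * (iota (zc c) * a - 1) - iota (zc c) * w * s.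
    have -> : iota (zc c) * r = iota (e ^+ k) * (iota (zc c) * a) - iota (zc c) * w * s.
      rewrite /r mulrBr !mulrA; congr (_ * _ - _).
      by rewrite -!cvalM mulrC.
    by rewrite mulrBr mulr1 addrAC.
  by rewrite /L scalerBl -!scalerA La Ls !scaler0 subrr.
apply: order_ltB; last first.
  apply: (@order_lt_le _ _ iota y 1%N) => //.
  by exists (e ^+ k); rewrite mul1r subrr.
by apply: (order_ltMl ycomm).
Qed.

Lemma natmul_scale_inj n (d : D) (m : M) : (d *+ n.+1) ** m = 0 -> d ** m = 0.
Proof.
move=> dm; pose k : K := n.+1%:R; have k0 : k != 0 by apply: char0_natr.
have -> : d = (k^-1)%:A * (d *+ n.+1).
  by rewrite -scaler_nat -/k mulr_algl scalerA mulVf // scale1r.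
by rewrite curve_scaleA dm scaler0.
Qed.

Section Lowering.
Variables (t : D) (m : M).
Hypothesis tm : t ** m = 0.
Hypothesis dt_inj : forall e, del t ** (e ** m) = 0 -> e ** m = 0.

(** The commutator with [t] lowers orders and [t] kills [m], as for the pair
    [d/dX], [X] of the Weyl algebra acting on [K[d/dX]]. *)
Lemma lowering_symbol n b d : has_symbol iota y n b d -> b *: m = 0 -> d ** m = 0.
Proof.
elim: n b d => [|n IHn] b d.
  by rewrite /has_symbol /= mul1r => /eqP; rewrite subr_eq0 => /eqP ->.
move=> /(adg_symbol t ycomm)/IHn Hd bm; apply: dt_inj; rewrite -curve_scaleA.
apply: (@natmul_scale_inj n); apply: Hd.
by rewrite /adg scalerBl -!scalerA tm bm !scaler0 subrr.
Qed.

Lemma lowering_kernel n b : order_lt iota y n.+1 b -> t ** (b *: m) = 0 ->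
  exists d : D, b *: m = d ** m.
Proof.
elim: n b => [|n IHn] b [d Hd] tbm.
  by exists d; move: Hd; rewrite /= mul1r => /eqP; rewrite subr_eq0 => /eqP ->.
have dm : d ** m = 0.
  apply: dt_inj; rewrite -curve_scaleA; apply: (@natmul_scale_inj n).
  apply: (lowering_symbol (adg_symbol t ycomm Hd)).
  by rewrite /adg scalerBl -!scalerA tm tbm !scaler0 subrr.
have bE : b *: m = (b - y ^+ n.+1 * iota d) *: m.
  by rewrite scalerBl -scalerA dm scaler0 subr0.
by rewrite bE; apply: IHn; rewrite // -bE.
Qed.
End Lowering.

Lemma minimal_annihilator : exists H : {poly {poly K}},
  [/\ H <> 0, exists m : M, m <> 0 /\ E H ** m = 0 &
      forall (G : {poly {poly K}}) (m : M), m <> 0 -> E G ** m = 0 -> (size G < size H)%N -> G = 0].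
Proof.
have [d [m [d0 m0 dm]]] := torsion_exists.
have [d' [H [H0 EH]]] := dc_norm cf d0.
have {d0 dm EH} Hm : E H ** m = 0 by rewrite -EH mulrC curve_scaleA dm scaler0.
have [n] := ubnP (size H); elim: n => // n IHn in H H0 m m0 Hm * => sH.
have [[G [v [v0 Gv GH G0]]]|nmin] := pselect (exists G (v : M),
    [/\ v <> 0, E G ** v = 0, (size G < size H)%N & G <> 0]).
  by apply: (IHn G G0 v v0 Gv); apply: leq_trans GH _; rewrite -ltnS.
exists H; split=> //; first by exists m.
move=> G v v0 Gv GH; apply: contrapT => G0; apply: nmin; by exists G, v.
Qed.

Section Minimal.
Variable H : {poly {poly K}}.
Hypothesis H0 : H <> 0.
Hypothesis Hmin :
  forall (G : {poly {poly K}}) (m : M), m <> 0 -> E G ** m = 0 -> (size G < size H)%N -> G = 0.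
Variable m0 : M.
Hypothesis m0n : m0 <> 0.
Hypothesis Hm0 : E H ** m0 = 0.

Lemma H_size : (1 < size H)%N.
Proof.
rewrite ltnNge; apply/negP => /size1_polyC HE.
by move: Hm0; rewrite HE evalgC => /sig_scale_inj[E0|//]; apply: H0; rewrite HE E0 polyC0.
Qed.

(** The remainder of the pseudo-division by [H] kills [m] as well. *)
Lemma H_divides (G : {poly {poly K}}) (m : M) : m <> 0 -> E H ** m = 0 -> E G ** m = 0 ->
  exists W, lead_coef H ^+ scalp G H *: G = W * H.
Proof.
move=> mn Hm Gm; have GE := Pdiv.Idomain.divp_eq G H.
exists (G %/ H); rewrite GE; suff -> : G %% H = 0 by rewrite addr0.
apply: (Hmin mn); last by rewrite ltn_modp; apply/eqP.
have -> : G %% H = (lead_coef H ^+ scalp G H)%:P * G - (G %/ H) * H.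
  by rewrite mul_polyC GE addrC addKr.
rewrite rmorphB (rmorphM E _ G) (rmorphM E _ H) /= curve_scaleB.
by rewrite (curve_scaleA _ (E G)) (curve_scaleA _ (E H)) Gm Hm !scaler0 subrr.
Qed.

Lemma H_deriv_inj (m : M) : E H ** m = 0 -> E H^`() ** m = 0 -> m = 0.
Proof.
move=> Hm Hd; apply: contrapT => mn.
have sH := H_size.
have : H^`() = 0 by apply: Hmin mn Hd _; apply: lt_size_deriv; apply/eqP.
move/(congr1 (fun p : {poly {poly K}} => p`_(size H).-2)); rewrite coef_deriv coef0.
have -> : (size H).-2.+1 = (size H).-1 by lia.
have -> : (size H).-1 = (size H).-2.+1 by lia.
move/(alg_natr_eq0 hchar); have -> : (size H).-2.+1 = (size H).-1 by lia.
by move/eqP; rewrite -lead_coefE lead_coef_eq0 => /eqP.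
Qed.

Lemma H_const_neq0 : H`_0 <> 0.
Proof.
move=> h0.
have [H1 HE] : exists H1, H = H1 * 'X.
  have /factor_theorem[H1] : root H 0 by rewrite /root horner_coef0 h0.
  by rewrite polyC0 subr0; exists H1.
have H10 : H1 != 0 by apply/eqP => H10; apply: H0; rewrite HE H10 mul0r.
have /eqP : H1 = 0; last by rewrite (negPf H10).
apply: (Hmin (m := g ** m0)).
- by move/g_scale_inj.
- by rewrite -curve_scaleA -(evalgX sig) -rmorphM -HE.
by rewrite HE size_mulX.
Qed.

Lemma E_scale_del (P : {poly {poly K}}) : del (E P) = E P^`() * del g.
Proof.
rewrite evalgE (@derivation_horner D del (@dc_delD _ _ D) (@dc_delM _ _ D)).
- by rewrite evalgE deriv_map.
- exact: mulrC.
by move=> i; rewrite coef_map; apply: dc_del_horner_z.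
Qed.

(** The lowering operator is [x] if it kills a vector killed by [E H], and [E H]
    otherwise, whose derivative is [- H'(g) x g]. *)
Lemma lowering_exists : exists (t : D) (m : M),
  [/\ m <> 0, E H ** m = 0, t ** m = 0 &
      forall e, del t ** (e ** m) = 0 -> e ** m = 0].
Proof.
have HeE e (m : M) : E H ** m = 0 -> E H ** (e ** m) = 0.
  by move=> Hm; rewrite curve_scaleC Hm scaler0.
have [[m [mn Hm xm]]|xinj] := pselect (exists m : M, [/\ m <> 0, E H ** m = 0 & x ** m = 0]).
  exists x, m; split=> // e; move: (HeE e m Hm).
  have : x ** (e ** m) = 0 by rewrite curve_scaleC xm scaler0.
  move: (e ** m) => v xv Hv.
  have x2v : x ^+ 2 ** v = 0 by rewrite expr2 curve_scaleA xv scaler0.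
  rewrite dc_delx curve_scaleD.
  have -> : (- ((2^-1 : K)%:A * x ^+ 2)) ** v = 0.
    by rewrite -sub0r curve_scaleB curve_scale0 curve_scaleA x2v scaler0 subrr.
  rewrite add0r => lv.
  (* On vectors killed by [x], [del x] acts as [lam (1 - g ^ 2)], which together
     with [x ^ 2] generates a nonzero polynomial in [z]. *)
  pose p : {poly K} := 'X^2 - (lam ^+ 2 *+ 16)%:P.
  have pn0 : p <> 0.
    apply/eqP; rewrite -size_poly_gt0 size_polyDl size_polyXn //.
    by rewrite size_polyN (leq_ltn_trans (size_polyC_leq1 _)).
  have pE : g ^+ 2 * sig p = (x ^+ 2 - lam%:A *+ 4 * (1 + g ^+ 2)) * x ^+ 2 +
      (lam%:A *+ 4 * (1 - g ^+ 2)) * (lam%:A * (1 - g ^+ 2)).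
    have -> : sig p = z ^+ 2 - lam%:A ^+ 2 *+ 16.
      rewrite rmorphB rmorphXn /= horner_algX horner_algC.
      by rewrite -[(lam ^+ 2 *+ 16)%:A]/(in_alg D _) rmorphMn rmorphXn.
    by rewrite mulrBr -exprMn dc_gz; ring.
  have [] // : p = 0 \/ v = 0.
  apply: sig_scale_inj; apply: (@gX_scale_inj 2); rewrite -curve_scaleA pE.
  rewrite curve_scaleD (curve_scaleA _ (x ^+ 2)) (curve_scaleA _ (_%:A * _)).
  by rewrite x2v lv !scaler0 addr0.
exists (E H), m0; split=> // e; move: (HeE e m0 Hm0); move: (e ** m0) => v Hv.
rewrite E_scale_del dc_delg => E1.
have {}E1 : x ** (g ** (E H^`() ** v)) = 0.
  rewrite -!curve_scaleA; have -> : x * g * E H^`() = - (E H^`() * - (x * g)) by ring.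
  by rewrite -sub0r curve_scaleB E1 curve_scale0 subrr.
apply: (H_deriv_inj Hv); apply: g_scale_inj; apply: contrapT => nz.
by apply: xinj; exists (g ** (E H^`() ** v)); split=> //; apply/HeE/HeE.
Qed.

(** For a value [c] of [z] at which the outer coefficients of [H] survive, a
    solution of [(z - c) v = m] would make [H] at [c] divide a power of the
    variable. *)
Lemma minimal_absurd : False.
Proof.
have [t [m [mn Hm tm dt_inj]]] := lowering_exists.
have pq0 : lead_coef H * H`_0 != 0.
  by rewrite mulf_neq0 // ?lead_coef_eq0; apply/eqP => //; apply: H_const_neq0.
have [c] := closed_nonrootP _ pq0.
rewrite /root hornerM mulf_eq0 => /norP[lc hc].
have [v Ev] := zc_scale_surj c m.
have [b bE] := simple_cyclic v sM mn.
have tv : t ** v = 0 by apply: (@zc_scale_inj c); rewrite curve_scaleC Ev tm.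
have [n Hb] := order_lt_ex ycomm genB b.
have [d vE] : exists d : D, v = d ** m.
  by rewrite bE in tv *; apply: (lowering_kernel tm dt_inj (order_ltS Hb) tv).
have [N [p [q Ed]]] := evalg_full (cf_alg cf) (cf_zeta cf) d.
pose r : {poly {poly K}} := ('X - c%:P)%:P.
have rE : E r = zc c by rewrite evalgC zcE.
pose G := ('X^N - r * p) ^+ 2 - (r * q) ^+ 2 * quad 'X lam%:P.
(* [G] is the norm of [g ^ N - (z - c) g ^ N d], which kills [m]. *)
have GE : E G = (g ^+ N - zc c * (E p - E q * x)) * (g ^+ N - zc c * (E p + E q * x)).
  rewrite /G rmorphB (rmorphM E ((r * q) ^+ 2)) !(rmorphXn E) rmorphB.
  rewrite (rmorphM E r p) (rmorphM E r q) /= rE rmorphXn /= evalgX.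
  rewrite (evalg_quad (cf_alg cf) (cf_zeta cf)).
  by rewrite -[curve_elt (CurveG u)]/g -[curve_elt (CurveX u)]/x; ring.
have Gm : E G ** m = 0.
  rewrite GE curve_scaleA -Ed.
  have -> : g ^+ N - zc c * (g ^+ N * d) = g ^+ N * (1 - zc c * d) by ring.
  rewrite (curve_scaleA (g ^+ N)) (curve_scaleB 1) curve_scale1.
  by rewrite (curve_scaleA (zc c)) -vE Ev subrr !scaler0.
have [W WE] := H_divides mn Hm Gm.
pose phi : {rmorphism {poly {poly K}} -> {poly K}} := map_poly (horner_eval c).
have phiH : size (phi H) = size H by rewrite /= size_map_poly_id0.
have [xi rxi] : exists xi, root (phi H) xi.
  by apply/closed_rootP; rewrite phiH neq_ltn H_size orbT.
have xi0 : xi != 0.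
  apply: contraNneq hc => xi0; move: rxi; rewrite xi0 /root horner_coef0 coef_map.
  by move=> /eqP E0; apply/eqP.
have phir : phi r = 0.
  by rewrite /= map_polyC /= /horner_eval hornerXsubC subrr.
have phiG : phi G = ('X^N) ^+ 2.
  rewrite /G (rmorphB phi) (rmorphM phi ((r * q) ^+ 2)) !(rmorphXn phi) (rmorphB phi).
  rewrite (rmorphM phi r p) (rmorphM phi r q) phir !mul0r expr0n mul0r !subr0.
  by rewrite (rmorphXn phi) /= map_polyX.
have E1 : (phi ((lead_coef H ^+ scalp G H)%:P * G)).[xi] = 0.
  by rewrite mul_polyC WE (rmorphM phi) hornerM (rootP rxi) mulr0.
move: E1; rewrite (rmorphM phi) phiG /= map_polyC /= hornerM hornerC.
rewrite rmorphXn /= /horner_eval !horner_exp hornerX; apply/eqP.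
by rewrite mulf_neq0 // !expf_neq0.
Qed.

End Minimal.

Lemma simple_faithful_absurd : False.
Proof.
have [H [H0 [m [mn Hm]] Hmin]] := minimal_annihilator.
exact: (minimal_absurd H0 Hmin mn Hm).
Qed.

End SimpleFaithful.

Lemma transcendental_not_faithful : ~ faithful_simple B.
Proof. by move=> [M [sM fM]]; apply: simple_faithful_absurd sM fM. Qed.

End TranscendentalCase.

(** * Prime algebras in which x is zero *)

Section Specialisation.
Variables (K : closedFieldType) (S : idomainType) (B : nzRingType).
Variable ev : {rmorphism {poly S} -> B}.
Hypothesis Bdom : domain B.
Hypothesis ev_inj : forall s, ev s%:P = 0 -> s = 0.

(** Specialisation of the elements of a finitely generated algebra, one
    generator at a time. When the generator is algebraic over [S], a relation
    [F] of least degree generates all relations up to its leading coefficient,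
    and the ideal of a nonzero element meets [S] outside 0. *)
Lemma specialisation (r : {poly S}) : ev r <> 0 ->
  exists2 s : S, s != 0 & forall phi : {rmorphism S -> K}, phi s != 0 ->
    exists xi : K, (forall f, ev f = 0 -> (map_poly phi f).[xi] = 0) /\
      (map_poly phi r).[xi] != 0.
Proof.
move=> r0.
have minimal (P : {poly S} -> Prop) : (exists f, P f) ->
    exists f, P f /\ forall h, P h -> (size f <= size h)%N.
  move=> [f]; have [n] := ubnP (size f); elim: n => // n IHn in f * => sf Pf.
  have [[h [Ph hf]]|nh] := pselect (exists h, P h /\ (size h < size f)%N).
    by apply: (IHn h) => //; apply: leq_trans hf _; rewrite -ltnS.
  exists f; split=> // h Ph; rewrite leqNgt; apply/negP => hf; apply: nh.
  by exists h.
have [inj|] := pselect (forall f, ev f = 0 -> f = 0).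
  exists (lead_coef r) => [|phi phir].
    by rewrite lead_coef_eq0; apply: contra_notN r0 => /eqP ->; rewrite rmorph0.
  have rp0 : map_poly phi r != 0.
    by apply: contraNneq phir => rp0; rewrite lead_coefE -coef_map rp0 coef0.
  have [xi rxi] := closed_nonrootP _ rp0; exists xi; split; last exact: rxi.
  by move=> f /inj ->; rewrite rmorph0 horner0.
move=> /existsNP[F0 /not_implyP[evF0 F00]].
have [|F [[F_0 evF] Fmin]] := minimal (fun f => f <> 0 /\ ev f = 0).
  by exists F0.
have [|m [[m0 [w evm]] mmin]] := minimal (fun m => m <> 0 /\ exists w, ev m = ev (r * w)).
  by exists F; split=> //; exists 0; rewrite mulr0 rmorph0.
have rem (f m' : {poly S}) : f %% m' = (lead_coef m' ^+ scalp f m')%:P * f - (f %/ m') * m'.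
  by rewrite mul_polyC Pdiv.Idomain.divp_eq addrC addKr.
have sz (f m' : {poly S}) : m' <> 0 -> (size (f %% m')%R < size m')%N.
  by move=> m'0; rewrite ltn_modp; apply/eqP.
have lead_ev k (m' : {poly S}) : m' <> 0 -> ev (lead_coef m' ^+ k)%:P <> 0.
  by move=> m'0 /ev_inj/eqP; rewrite expf_eq0 lead_coef_eq0 => /andP[_ /eqP].
have Fdiv (f : {poly S}) : ev f = 0 -> f %% F = 0.
  move=> evf; apply: contrapT => nz; have := sz f F F_0; rewrite ltnNge => /negP; apply.
  apply: Fmin; split=> //; rewrite rem rmorphB !rmorphM evf evF !mulr0 subrr //.
have mrem (f w' : {poly S}) : ev f = ev (r * w') -> f %% m = 0.
  move=> evf; apply: contrapT => nz; have := sz f m m0; rewrite ltnNge => /negP; apply.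
  apply: mmin; split=> //.
  exists ((lead_coef m ^+ scalp f m)%:P * w' - (f %/ m) * w).
  by rewrite mulrBr rem !rmorphB !(rmorphM ev) evf evm -!(rmorphM ev) !mulrA
    ![_ * r]mulrC -!mulrA.
have sm : size m = 1%N.
  apply/eqP; rewrite eqn_leq lt0n size_poly_eq0 andbC; apply/andP; split; first exact/eqP.
  rewrite leqNgt; apply/negP => sm.
  have FE : (lead_coef m ^+ scalp F m)%:P * F = (F %/ m) * m.
    by apply/eqP; rewrite -subr_eq0 -rem (mrem _ 0) // mulr0 rmorph0.
  have [W0|evm0] : ev (F %/ m) = 0 \/ ev m = 0.
  - by apply: Bdom; rewrite -rmorphM -FE rmorphM evF mulr0.
  - have Wn0 : F %/ m <> 0.
      move=> W0'; move/eqP: FE; rewrite W0' mul0r mulf_eq0 polyC_eq0 expf_eq0 lead_coef_eq0.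
      by case/orP => [/andP[_ /eqP]|/eqP].
    have := Fmin _ (conj Wn0 W0).
    have <- : size ((lead_coef m ^+ scalp F m)%:P * F) = size F.
      by rewrite mul_polyC size_scale // expf_neq0 // lead_coef_eq0; apply/eqP.
    rewrite FE size_mul; [|exact/eqP|exact/eqP].
    move/eqP: Wn0; rewrite -size_poly_gt0; lia.
  have rE : (lead_coef m ^+ scalp r m)%:P * r = (r %/ m) * m.
    by apply/eqP; rewrite -subr_eq0 -rem (mrem _ 1) // mulr1.
  have : ev (lead_coef m ^+ scalp r m)%:P * ev r = 0.
    by rewrite -rmorphM rE rmorphM evm0 mulr0.
  by move/Bdom => [/lead_ev|//]; apply.
have [s1 s10 mE] : exists2 s1, s1 != 0 & m = s1%:P.
  by apply/size_poly1P; rewrite sm.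
exists (lead_coef F * s1); first by rewrite mulf_neq0 // lead_coef_eq0; apply/eqP.
move=> phi; rewrite rmorphM mulf_eq0 => /norP[phiF phis].
have [xi rxi] : exists xi, root (map_poly phi F) xi.
  apply/closed_rootP; rewrite size_map_poly_id0 //; apply/negP => /size_poly1P[k k0 FE].
  by move: evF; rewrite FE => /ev_inj/eqP; rewrite (negPf k0).
have ker f : ev f = 0 -> (map_poly phi f).[xi] = 0.
  move=> /Fdiv; rewrite rem => /eqP; rewrite subr_eq0 => /eqP/(congr1 (map_poly phi)).
  move/(congr1 (fun p => p.[xi])); rewrite !rmorphM /= map_polyC !hornerM (rootP rxi) mulr0.
  rewrite hornerC /= rmorphXn => /eqP; rewrite mulf_eq0 expf_eq0 (negPf phiF) andbF.
  by move/eqP.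
exists xi; split=> //.
have : ev (r * w - s1%:P) = 0 by rewrite rmorphB -evm mE subrr.
move/ker; rewrite rmorphB rmorphM /= map_polyC hornerD hornerN hornerM hornerC.
move/eqP; rewrite subr_eq0 => /eqP E1.
by apply: contraNneq phis => E0; rewrite -E1 E0 mul0r.
Qed.

End Specialisation.

Definition scalar_ring (K : fieldType) (B : algType K) := forall b : B, exists c : K, b = c%:A.

Section CommutativeCase.
Variables (K : closedFieldType) (lam : K) (B : algType K) (u : uGens lam B).
Hypothesis primeB : prime_ring B.
Hypothesis x0 : u_x u = 0.
Local Notation g := (u_g u).
Local Notation y := (u_y u).

Lemma commB (a b : B) : a * b = b * a.
Proof.
have yg : y * g = g * y by rewrite u_yg x0 mul0r subr0.
have comm_gi c : c * g = g * c -> c * u_gi u = u_gi u * c.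
  move=> cg; rewrite -[c * _]mul1r -(u_gig u) -!mulrA; congr (_ * _).
  by rewrite mulrA -cg -mulrA u_ggi mulr1.
have ind c : c * g = g * c -> c * y = y * c -> forall b, c * b = b * c.
  move=> cg cy; apply: (u_gen (u := u)) => //.
  - by move=> k; rewrite -scalerAl -scalerAr mul1r mulr1.
  - exact: comm_gi.
  - by rewrite x0 mulr0 mul0r.
  - by move=> d e Hd He; rewrite mulrDr mulrDl Hd He.
  - by move=> d e Hd He; rewrite mulrA Hd -mulrA He mulrA.
move: a b; apply: (u_gen (u := u)).
- by move=> k b; rewrite -scalerAl -scalerAr mul1r mulr1.
- exact: ind.
- by apply: ind; [rewrite u_gig u_ggi|apply/esym/comm_gi].
- by move=> b; rewrite x0 mulr0 mul0r.
- by apply: ind.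
- by move=> d e Hd He b; rewrite mulrDr mulrDl Hd He.
- by move=> d e Hd He b; rewrite -mulrA He mulrA Hd -mulrA.
Qed.

Lemma comm_domain : domain B.
Proof.
move=> a b ab; apply: primeB => r; by rewrite -mulrA (commB r) mulrA ab mul0r.
Qed.

Lemma algebraic_scalar (b : B) (p : {poly K}) : p != 0 -> horner_alg b p = 0 ->
  exists c : K, b = c%:A.
Proof.
move=> p0; have [r pE] := closed_field_poly_normal p.
rewrite pE -mul_polyC rmorphM /= horner_algC => /comm_domain[/eqP|].
  by rewrite scaler_eq0 oner_eq0 orbF lead_coef_eq0 (negPf p0).
elim: r {pE} => [|a r IHr]; first by rewrite big_nil rmorph1 => /eqP; rewrite oner_eq0.
rewrite big_cons rmorphM /= => /comm_domain[|//].
rewrite rmorphB /= horner_algX horner_algC => /eqP; rewrite subr_eq0 => /eqP.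
by exists a.
Qed.

Section PointOf.
Variables (S : idomainType) (ev : {rmorphism {poly S} -> B}).
Variables (ii : {rmorphism K -> S}) (gam : S).
Hypothesis ev_inj : forall s, ev s%:P = 0 -> s = 0.
Hypothesis evK : forall c, ev (ii c)%:P = c%:A.
Hypothesis evg : ev gam%:P = g.
Hypothesis evy : ev 'X = y.
Hypothesis pts : forall s : S, s != 0 -> exists phi : {rmorphism S -> K},
  phi s != 0 /\ forall c, phi (ii c) = c.

Lemma gX_mul_inj n (b : B) : g ^+ n * b = 0 -> b = 0.
Proof.
elim: n => [|n IHn]; first by rewrite mul1r.
rewrite exprS -mulrA => /comm_domain[g0|//].
by have := u_ggi u; rewrite g0 mul0r => /eqP; rewrite eq_sym oner_eq0.
Qed.

Lemma ev_full (b : B) : exists n r, g ^+ n * b = ev r.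
Proof.
move: b; apply: (u_gen (u := u)).
- by move=> c; exists 0%N, (ii c)%:P; rewrite mul1r evK.
- by exists 0%N, gam%:P; rewrite mul1r evg.
- by exists 1%N, 1; rewrite rmorph1 expr1 u_ggi.
- by exists 0%N, 0; rewrite rmorph0 x0 mulr0.
- by exists 0%N, 'X; rewrite mul1r evy.
- move=> a b [n [r Ea]] [m [s Eb]].
  exists (n + m)%N, (gam%:P ^+ m * r + gam%:P ^+ n * s).
  rewrite rmorphD !rmorphM !rmorphXn /= evg -Ea -Eb mulrDr exprD -!mulrA.
  by congr (_ + _); rewrite !mulrA; congr (_ * _); apply: commB.
move=> a b [n [r Ea]] [m [s Eb]]; exists (n + m)%N, (r * s).
rewrite rmorphM -Ea -Eb exprD -!mulrA; congr (_ * _).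
by rewrite !mulrA; congr (_ * _); apply: commB.
Qed.

(** [J] is the kernel of a specialisation of [g] and [y] to scalars. *)
Lemma comm_point_of (a : B) : a <> 0 -> exists J : set B,
  [/\ two_sided_ideal J, ~ J a & forall b, exists c : K, J (b - c%:A)].
Proof.
move=> a0; have [n0 [r0 Er0]] := ev_full a.
have r00 : ev r0 <> 0 by rewrite -Er0 => /gX_mul_inj.
have gam0 : gam != 0.
  apply/eqP => gam0; have := u_ggi u; rewrite -evg gam0 polyC0 rmorph0 mul0r.
  by move/eqP; rewrite eq_sym oner_eq0.
have [s s0 Hs] := @specialisation K S B ev comm_domain ev_inj _ r00.
have [phi [phis phiK]] := pts (mulf_neq0 s0 gam0).
move: phis; rewrite rmorphM mulf_eq0 => /norP[phis phig].
have [xi [ker rxi]] := Hs _ phis.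
pose val (r : {poly S}) := (map_poly phi r).[xi].
have valM r r' : val (r * r') = val r * val r' by rewrite /val rmorphM hornerM.
have valB r r' : val (r - r') = val r - val r'.
  by rewrite /val rmorphB hornerD hornerN.
have valg n : val (gam%:P ^+ n) = phi gam ^+ n.
  by rewrite /val rmorphXn /= map_polyC horner_exp hornerC.
have valC c : val (ii c)%:P = c by rewrite /val map_polyC /= hornerC phiK.
have evgX n : ev (gam%:P ^+ n) = g ^+ n by rewrite rmorphXn /= evg.
pose J : set B := [set b | exists n r, g ^+ n * b = ev r /\ val r = 0].
have JE b n r : g ^+ n * b = ev r -> J b -> val r = 0.
  move=> Er [m [r' [Er' v0]]].
  have : val (gam%:P ^+ m * r - gam%:P ^+ n * r') = 0.
    apply: ker; rewrite rmorphB !(rmorphM ev) !evgX -Er -Er' !mulrA.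
    by rewrite (commB (g ^+ m)) subrr.
  rewrite valB !valM !valg v0 mulr0 subr0 => /eqP.
  by rewrite mulf_eq0 expf_eq0 (negPf phig) andbF => /eqP.
exists J; split.
- split.
  + by exists 0%N, 0; rewrite mulr0 rmorph0 /val rmorph0 horner0.
  + move=> b c [n [r [Eb v]]] [m [r' [Ec v']]].
    exists (n + m)%N, (gam%:P ^+ m * r - gam%:P ^+ n * r'); split.
      rewrite rmorphB !(rmorphM ev) !evgX -Eb -Ec mulrBr exprD !mulrA.
      by rewrite (commB (g ^+ m)).
    by rewrite valB !valM v v' !mulr0 subr0.
  move=> b c d [n [r [Ec v]]]; have [m [r' Eb]] := ev_full (b * d).
  exists (m + n)%N, (r' * r); split; last by rewrite valM v mulr0.
  rewrite (rmorphM ev) -Eb -Ec exprD.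
  have -> : b * c * d = b * d * c by rewrite -mulrA (commB c) mulrA.
  rewrite -!(mulrA (g ^+ m)); congr (_ * _).
  move: (b * d) => e; by rewrite (mulrA (g ^+ n)) (commB (g ^+ n) e) -mulrA.
- by move/(JE _ _ _ Er0)/eqP; rewrite (negPf rxi).
move=> b; have [n [r Er]] := ev_full b.
exists (val r / phi gam ^+ n), n, (r - gam%:P ^+ n * (ii (val r / phi gam ^+ n))%:P).
split; first by rewrite rmorphB (rmorphM ev) evgX evK mulrBr Er.
by rewrite valB valM valg valC mulrC divfK ?subrr // expf_neq0.
Qed.

End PointOf.

(** If [g] is algebraic over [K] it is a scalar and [B] is generated by [y];
    otherwise [B] is generated by [y] over [K[g]], up to powers of [g]. *)
Lemma comm_point (a : B) : a <> 0 -> exists J : set B,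
  [/\ two_sided_ideal J, ~ J a & forall b, exists c : K, J (b - c%:A)].
Proof.
have [[p p0 pg]|ng] := pselect (exists2 p : {poly K}, p != 0 & horner_alg g p = 0).
  have [c gc] := algebraic_scalar p0 pg.
  apply: (@comm_point_of K (horner_alg y) idfun c).
  - move=> s; rewrite /= horner_algC => /eqP; rewrite scaler_eq0 oner_eq0 orbF.
    by move/eqP.
  - by move=> k; rewrite /= horner_algC.
  - by rewrite /= horner_algC gc.
  - by rewrite /= horner_algX.
  - by move=> s s0; exists idfun.
have cfu : commr_rmorph (horner_alg g) y by move=> p; apply: commB.
apply: (@comm_point_of {poly K} (horner_morph cfu) polyC 'X).
- move=> s; rewrite /= horner_morphC => sg; apply/eqP/negPn/negP => s0; apply: ng.
  by exists s.
- by move=> k; rewrite /= horner_morphC /= horner_algC.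
- by rewrite /= horner_morphC /= horner_algX.
- by rewrite /= horner_morphX.
move=> s s0; have [c rc] := closed_nonrootP _ s0.
exists (horner_eval c); split; first exact: rc.
by move=> k; rewrite /= /horner_eval hornerC.
Qed.

Lemma point_prime (J : set B) : two_sided_ideal J -> ~ J 1 ->
  (forall b, exists c : K, J (b - c%:A)) -> prime_ideal J.
Proof.
move=> iJ J1 Jc; apply/prime_idealP; split=> // a b Jab.
have [c Ja] := Jc a; have [c0|c0] := eqVneq c 0.
  by left; move: Ja; rewrite c0 scale0r subr0.
right; have Jcb : J (c%:A * b).
  have -> : c%:A * b = a * 1 * b - (a - c%:A) * b.
    by rewrite mulr1 mulrBl opprB addrC subrK.
  have [_ JB _] := iJ.
  by apply: JB; [apply: Jab|apply: ideal_mulr].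
have -> : b = (c^-1)%:A * (c%:A * b).
  by rewrite !mulr_algl scalerA mulVf // scale1r.
exact: ideal_mull.
Qed.

Lemma zero_ideal_scalar (J : set B) : (forall r, J r -> r = 0) ->
  (forall b, exists c : K, J (b - c%:A)) -> scalar_ring B.
Proof.
move=> J0 Jc b; have [c /J0/eqP] := Jc b; rewrite subr_eq0 => /eqP bc.
by exists c.
Qed.

Lemma comm_loc_closed : loc_closed0 B -> scalar_ring B.
Proof.
move=> [b b0 Hb]; have [J [iJ Jb Jc]] := comm_point b0.
apply: (zero_ideal_scalar (J := J)) => // r Jr; apply: contrapT => r0; apply: (Jb).
apply: Hb; last by exists r.
apply: point_prime => // J1; apply: Jb.
by rewrite -[b]mulr1; apply: ideal_mull.
Qed.

Lemma comm_faithful : faithful_simple B -> scalar_ring B.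
Proof.
move=> [M [sM fM]].
have one0 : 1 <> 0 :> B by apply/eqP/oner_neq0.
have [J [iJ J1 Jc]] := comm_point one0.
apply: (zero_ideal_scalar (J := J)) => // r Jr; apply: contrapT => r0; apply: J1.
have [[m /eqP m0] _] := sM.
have rm : r *: m <> 0.
  move=> rm; apply: r0; apply: fM => v; have [b ->] := simple_cyclic v sM m0.
  by rewrite scalerA commB -scalerA rm scaler0.
have [b mE] := simple_cyclic m sM rm.
have br : 1 - b * r = 0.
  apply: fM => v; have [d ->] := simple_cyclic v sM m0.
  by rewrite scalerA commB -scalerA scalerBl scale1r -scalerA -mE subrr scaler0.
by move/eqP: br; rewrite subr_eq0 => /eqP ->; apply: ideal_mull.
Qed.

Lemma comm_rational : (exists (Q : unitAlgType K) (f : {lrmorphism B -> Q}),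
  goldie_quotient f /\ centre_algebraic_field Q) -> scalar_ring B.
Proof.
move=> [Q [f [[finj funit fr _] cQ]]] b.
have zC : central_elt (f b).
  move=> q; have [a [s [rs ->]]] := fr q.
  rewrite mulrA -rmorphM commB rmorphM -!mulrA; congr (_ * _).
  by apply: commrV; rewrite /GRing.comm -!rmorphM commB.
have [_ [p p0 /rootP]] := cQ _ zC.
rewrite -[(map_poly _ _).[_]]/(horner_alg (f b) p) -rmorph_horner_alg.
by rewrite -(rmorph0 f) => /finj; apply: algebraic_scalar.
Qed.

Section Scalar.
Hypothesis scB : scalar_ring B.

Lemma scalar_unit (b : B) : b <> 0 -> exists c, c * b = 1.
Proof.
move=> b0; have [k bE] := scB b; exists (k^-1)%:A.
have k0 : k != 0 by apply/eqP => k0; apply: b0; rewrite bE k0 scale0r.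
by rewrite bE mulr_algl scalerA mulVf // scale1r.
Qed.

Lemma scalar_loc_closed : loc_closed0 B.
Proof.
exists 1; first exact/eqP/oner_neq0.
move=> Q /prime_idealP[iQ _ _] [q Qq /scalar_unit[c <-]]; exact: ideal_mull.
Qed.

Lemma scalar_faithful : faithful_simple B.
Proof.
exists B^o; split.
  split; first by exists (1 : B); apply: oner_neq0.
  move=> N [N0 ND NZ].
  have [[b Nb b0]|nb] := pselect (exists2 b, N b & b <> 0).
    right; rewrite -subTset => v _; have [c cb] := scalar_unit b0.
    by have := NZ (v * c) _ Nb; rewrite /GRing.scale /= -mulrA cb mulr1.
  left; apply/seteqP; split=> [v Nv|v ->//] /=.
  by apply: contrapT => v0; apply: nb; exists v.
by move=> b /(_ (1 : B)); rewrite /GRing.scale /= mulr1.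
Qed.

Lemma scalar_rational : exists (Q : unitAlgType K) (f : {lrmorphism B -> Q}),
  goldie_quotient f /\ centre_algebraic_field Q.
Proof.
have rore : right_ore B by move=> a s s0; exists a, s; split=> //; apply: commB.
have lore : left_ore B by move=> a s s0; exists a, s; split=> //; apply: commB.
pose O := OreDomain comm_domain rore.
exists (ore_frac O), (@ore_inj K O : {lrmorphism O -> ore_frac O}); split.
  exact: (@ore_goldie_quotient K O lore).
move=> q _; split=> //; have [a [s [s0 qE]]] := fracP q.
have [c cs] := scalar_unit s0; have [k kE] := scB (c * a).
exists ('X - k%:P); first by rewrite polyXsubC_eq0.
apply/rootP; rewrite rmorphB /= map_polyX map_polyC /= hornerXsubC.
apply/eqP; rewrite subr_eq0 qE -(rmorph_alg (@ore_inj K O)) /= -kE; apply/eqP.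
apply: (@frac_eq K O _ _ _ _ (1 : B) s) => //; try exact: ore1_neq0.
- by rewrite mulr1 mul1r.
- have aE : (a : B) = c * a * s by rewrite (commB (c * a)) mulrA (commB s) cs mul1r.
  by rewrite mulr1.
Qed.

End Scalar.
End CommutativeCase.

(** * The generators of frakU *)

Section Presentation.
Variable K : closedFieldType.

Lemma free4_gen (S : set (free4 K)) : (forall c : K, S c%:A) ->
  (forall i, S (free_gen K i)) ->
  (forall a b, S a -> S b -> S (a + b)) ->
  (forall a b, S a -> S b -> S (a * b)) -> forall f, S f.
Proof.
move=> SK Sg SD SM f.
have mulU c1 c2 (m1 m2 : {fmonom 'I_4}) :
    (mkmalgU m1 c1 : free4 K) * (mkmalgU m2 c2 : free4 K) =
    mkmalgU (mmul m1 m2) (c1 * c2) :> free4 K.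
  by rewrite [LHS]malgM_def fgmulUU.
have S1 (m : {fmonom 'I_4}) : S (mkmalgU m (1 : K)).
  case: m => s; elim: s => [|i s IHs].
    have -> : mkmalgU (FMonom [::]) (1 : K) = (1 : K)%:A :> free4 K; last exact: SK.
    rewrite scale1r; congr mkmalgU; apply/eqP; rewrite fmP fm1 //.
  have -> : mkmalgU (FMonom (i :: s)) (1 : K) =
      free_gen K i * mkmalgU (FMonom s) (1 : K) :> free4 K.
    rewrite mulU mulr1; congr mkmalgU; apply/eqP; rewrite fmP fmM fmU //.
  exact: SM.
have S0 : S 0 by rewrite -(scale0r 1); apply: SK.
rewrite [f]monalgE; elim/big_ind: _ => // m _.
have -> : mkmalgU m f@_m = (f@_m)%:A * mkmalgU m (1 : K) :> free4 K.
  rewrite mulr_algl -mul_malgC [RHS]mulU mulr1; congr mkmalgU.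
  by rewrite mul1m.
exact: SM.
Qed.

Variable lam : K.

Lemma uGens_of_relators (A B : algType K) (f : {lrmorphism A -> B}) (g gV x y : A) :
  (forall b, exists a, f a = b) ->
  (forall i, (i < 5)%N -> f (nth 0 (U_relators lam g gV x y) i) = 0) ->
  (forall S : set A, (forall c : K, S c%:A) -> S g -> S gV -> S x -> S y ->
    (forall a b, S a -> S b -> S (a + b)) ->
    (forall a b, S a -> S b -> S (a * b)) -> forall a, S a) ->
  inhabited (uGens lam B).
Proof.
move=> f_surj rels gen.
have rel a b : f (a - b) = 0 -> f a = f b.
  by rewrite rmorphB => /eqP; rewrite subr_eq0 => /eqP.
have ggi : f g * f gV = 1.
  by have /rel := rels 0%N isT; rewrite rmorphM rmorph1.
have gig : f gV * f g = 1.
  by have /rel := rels 1%N isT; rewrite rmorphM rmorph1.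
have mulgi a b : a * f gV = b -> a = b * f g.
  by move=> <-; rewrite -mulrA gig mulr1.
constructor; apply: (@UGens K lam B (f g) (f gV) (f x) (f y)) => //.
- by have /rel := rels 2%N isT; rewrite !rmorphM => /mulgi.
- have /rel := rels 3%N isT; rewrite !rmorphM rmorphD => /mulgi ->.
  by rewrite mulrDl addrK.
- have /rel := rels 4%N isT; rewrite rmorphB !rmorphM rmorphD /= !linearZ /=.
  by rewrite rmorphXn rmorphB rmorph1 rmorphXn.
move=> S SK Sg Sgi Sx Sy SD SM b; have [a <-] := f_surj b.
apply: (gen [set a | S (f a)]) => //= [c|c d|c d].
- by rewrite rmorph_alg.
- by rewrite rmorphD; apply: SD.
- by rewrite rmorphM; apply: SM.
Qed.

Lemma frakU_gens : inhabited (uGens lam (frakU lam)).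
Proof.
apply: (@uGens_of_relators (free4 K) (quot_alg (U_ideal lam)) (quot_map (U_ideal lam))
  (free_g K) (free_gV K) (free_x K) (free_y K)).
- exact: quot_surj.
- move=> i Hi; apply/(quot_map_eq0 (U_ideal lam)) => J [_]; apply.
  exact: mem_nth.
move=> S SK Sg SgV Sx Sy SD SM; apply: free4_gen => // -[i].
by case: i => [|[|[|[|//]]]] lti; rewrite (bool_irrelevance lti isT).
Qed.

End Presentation.

(** The equivalences for a prime quotient, according to whether [x] vanishes in
    it and whether the central element is algebraic. *)
Lemma dixmier_moeglin_prime_quotient (K : closedFieldType)
  (hchar : [pchar K] =i pred0) (lam : K) (B : algType K) (u : uGens lam B) :
  prime_ring B ->
  (loc_closed0 B <-> faithful_simple B) /\
  (faithful_simple B <-> exists (Q : unitAlgType K) (f : {lrmorphism B -> Q}),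
     goldie_quotient f /\ centre_algebraic_field Q).
Proof.
move=> pB; have [x0|/eqP x0] := eqVneq (u_x u) 0.
  have := comm_loc_closed pB x0; have := comm_faithful pB x0.
  have := comm_rational pB x0; have := @scalar_loc_closed K B.
  have := @scalar_faithful K B; have := scalar_rational pB x0.
  by move=> *; split; split; auto.
have [[c zc]|zinj] := dc_z_cases hchar (curve_diff u pB).
  have := algebraic_loc_closed hchar x0 zc; have := algebraic_faithful hchar x0 zc.
  have := algebraic_rational hchar x0 zc.
  by move=> *; split; split.
have := transcendental_not_loc_closed hchar x0 zinj.
have := transcendental_not_faithful hchar x0 zinj.
have := transcendental_not_rational hchar zinj.
by move=> *; split; split.
Qed.

Theorem corollary4p12 (K : closedFieldType) (hchar : [pchar K] =i pred0)
  (lam : K) : dixmier_moeglin (frakU lam).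
Proof.
move=> P pP; have [u] := frakU_gens lam.
have [v _] := uGens_image u (quot_surj (P := P)).
have [LP PR] := dixmier_moeglin_prime_quotient hchar v (quot_prime pP).
rewrite locally_closed_quot // primitive_quot.
by split.
Qed.
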